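(* Let $\mathfrak g$ be a finite-dimensional simple complex Lie algebra which is not of type $\mathsf G_2$, and regard the twisted Yangian ${}^\imath\mathscr Y$ as a right coideal subalgebra of the Yangian $\mathscr Y$ via $\varphi$. For every $i\in\mathbb I$, $$h_i(u)\equiv\xi_i(u)\xi_i(-u)\pmod{\mathscr Y_{Q_+}[\![u^{-1}]\!]},$$ $$b_i(u)\equiv\tfrac12\{x_i^+(u),\xi_i(-u)\}+x_i^-(-u)\pmod{\mathscr Y^{\geqslant0}_{\alpha_i+Q_+}[\![u^{-1}]\!]},$$ $$\Delta(h_i(u))\equiv h_i(u)\otimes\xi_i(u)\xi_i(-u)\pmod{{}^\imath\mathscr Y\otimes\mathscr Y_{Q_+}[\![u^{-1}]\!]},$$ $$\Delta(b_i(u))\equiv b_i(u)\otimes\xi_i(-u)+1\otimes b_i(u)\pmod{{}^\imath\mathscr Y\otimes\mathscr Y_{Q_+}[\![u^{-1}]\!]}.$$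
   Context: All algebras are over $\mathbb C$, $\mathbb N=\{0,1,2,\dots\}$, $\{x,y\}=xy+yx$. Lie algebra. $\mathfrak g$ has Cartan matrix $(c_{ij})_{i,j\in\mathbb I}$, simple roots $\alpha_i$, positive roots $\Phi^+$, root lattice $Q$, a fixed invariant inner product $(\cdot,\cdot)$, $d_i=\frac12(\alpha_i,\alpha_i)$, $d_ic_{ij}=(\alpha_i,\alpha_j)$. Chevalley generators $x_i^\pm,\xi_i$ are normalized by $(x_i^+,x_i^-)=1$, $\xi_i=[x_i^+,x_i^-]$. The Chevalley involution is $\omega:\xi_i\mapsto-\xi_i$, $x_i^\pm\mapsto-x_i^\mp$. For $\alpha\in\Phi^+$ the root vectors $x_\alpha^\pm\in\mathfrak g_{\pm\alpha}$ satisfy $(x_\alpha^+,x_\alpha^-)=1$, $x_{\alpha_i}^\pm=x_i^\pm$, $\omega(x_\alpha^\pm)=-x_\alpha^\mp$. Yangian. $\mathscr Y$ is the unital associative algebra with generators $x_{i,r}^\pm,\xi_{i,r}$ ($i\in\mathbb I,r\in\mathbb N$) and relations $[\xi_{i,r},\xi_{j,s}]=0$; $[\xi_{i,0},x_{j,s}^\pm]=\pm(\alpha_i,\alpha_j)x_{j,s}^\pm$; $[x_{i,r}^+,x_{j,s}^-]=\delta_{ij}\xi_{i,r+s}$; $[\xi_{i,r+1},x_{j,s}^\pm]-[\xi_{i,r},x_{j,s+1}^\pm]=\pm\frac12(\alpha_i,\alpha_j)\{\xi_{i,r},x_{j,s}^\pm\}$; $[x_{i,r+1}^\pm,x_{j,s}^\pm]-[x_{i,r}^\pm,x_{j,s+1}^\pm]=\pm\frac12(\alpha_i,\alpha_j)\{x_{i,r}^\pm,x_{j,s}^\pm\}$;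 and for $i\ne j$, $m=1-c_{ij}$, $\sum_{\sigma\in\mathfrak S_m}[x^\pm_{i,r_{\sigma(1)}},[x^\pm_{i,r_{\sigma(2)}},\cdots,[x^\pm_{i,r_{\sigma(m)}},x^\pm_{j,s}]\cdots]]=0$. $\mathrm U(\mathfrak g)$ is a subalgebra via $\xi_i\mapsto\xi_{i,0}$, $x_i^\pm\mapsto x_{i,0}^\pm$. $\mathscr Y$ is a Hopf algebra whose coproduct is determined by $\Delta(x)=x\otimes1+1\otimes x$ for $x\in\mathfrak g$ and $\Delta(\xi_{i,1})=\xi_{i,1}\otimes1+1\otimes\xi_{i,1}+\xi_i\otimes\xi_i-\sum_{\alpha\in\Phi^+}(\alpha,\alpha_i)x_\alpha^-\otimes x_\alpha^+$. Set $\xi_i(u)=1+\sum_{r\ge0}\xi_{i,r}u^{-r-1}$, $x_i^\pm(u)=\sum_{r\ge0}x_{i,r}^\pm u^{-r-1}$. $\mathscr Y$ is $Q$-graded by $\deg\xi_{i,r}=0$, $\deg x_{i,r}^\pm=\pm\alpha_i$. $\mathscr Y^{\geqslant0}$ is the subalgebra generated by all $\xi_{i,r},x_{i,r}^+$. For $\mathsf S\subset Q$, $\mathscr Y_{\mathsf S}$ (resp. $\mathscr Y^{\geqslant0}_{\mathsf S}$) is the span of homogeneous elements of $\mathscr Y$ (resp. $\mathscr Y^{\geqslant0}$) with degree in $\mathsf S$. $Q_+=\{\sum_ik_i\alpha_i: k_i\in\mathbb N,\sum_ik_i>0\}$. Twisted Yangian. ${}^\imath\mathscr Y$ is the unital associative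 algebra generated by $h_{i,2r+1},b_{i,r}$ ($i\in\mathbb I,r\in\mathbb N$) with relations ($h_{i,-1}=1$, $h_{i,r}=0$ if $r$ is even or $r<-1$; $r,s\in\mathbb N$): $[h_{i,r},h_{j,s}]=0$; $[h_{i,r+1},b_{j,s}]-[h_{i,r-1},b_{j,s+2}]=(\alpha_i,\alpha_j)\{h_{i,r-1},b_{j,s+1}\}+\frac14(\alpha_i,\alpha_j)^2[h_{i,r-1},b_{j,s}]$; $[b_{i,r+1},b_{j,s}]-[b_{i,r},b_{j,s+1}]=\frac12(\alpha_i,\alpha_j)\{b_{i,r},b_{j,s}\}-2\delta_{ij}(-1)^sh_{i,r+s+1}$; $[b_{i,0},b_{j,0}]=0$ if $c_{ij}=0$; $\mathrm{ad}(b_{i,0})^2(b_{j,0})=-d_ib_{j,0}$ if $c_{ij}=-1$; $\mathrm{ad}(b_{i,0})^3(b_{j,0})=-4d_i[b_{i,0},b_{j,0}]$ if $c_{ij}=-2$; $\mathrm{ad}(b_{i,0})^4(b_{j,0})=-10d_i[b_{i,0},[b_{i,0},b_{j,0}]]-9d_i^2b_{j,0}$ if $c_{ij}=-3$. It is generated by the $h_{i,1},b_{i,0}$. Set $h_i(u)=1+\sum_{r\ge0}h_{i,2r+1}u^{-2r-2}$, $b_i(u)=\sum_{r\ge0}b_{i,r}u^{-r-1}$. Embedding. For $\mathfrak g$ not of type $\mathsf G_2$, $\varphi:{}^\imath\mathscr Y\to\mathscr Y$ is the injective algebra homomorphism with $b_{i,0}\mapsto x_i^+-x_i^-$ and $h_{i,1}\mapsto2\xi_{i,1}-\xi_{i}^2+\sum_{\alpha\in\Phi^+}(\alpha,\alpha_i)(x_\alpha^+)^2$;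 its image is a right coideal subalgebra, $\Delta({}^\imath\mathscr Y)\subset{}^\imath\mathscr Y\otimes\mathscr Y$. Congruences of series are coefficientwise. *)

(* Defs.v *)
From HB Require Import structures.
From mathcomp Require Import all_boot all_order all_algebra all_fingroup.
From mathcomp Require Import generic_quotient ring_quotient.
From mathcomp Require Import boolp.
From mathcomp.multinomials Require Import monalg.
From mathcomp Require Import finmap.

Set Implicit Arguments.
Unset Strict Implicit.
Unset Printing Implicit Defensive.

Import GRing.Theory.
Import Quotient.

Local Open Scope ring_scope.
Local Open Scope quotient_scope.

(* Keeps conversion from unfolding the algebra operations below. *)
Fact op_key : unit. Proof. exact: tt. Qed.

Section LinearSpan.
Variables (K : fieldType) (V : lmodType K) (P : V -> Prop).

Inductive lspan : V -> Prop :=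
| lspan0 : lspan 0
| lspanZD (c : K) (x y : V) : P x -> lspan y -> lspan (c *: x + y).

Lemma lspan_gen x : P x -> lspan x.
Proof.
move=> Px; rewrite -[x]scale1r -[_ *: _]addr0.
by apply: lspanZD => //; apply: lspan0.
Qed.

Lemma lspanD x y : lspan x -> lspan y -> lspan (x + y).
Proof.
elim=> [|c u v Pu _ IHv] Sy; first by rewrite add0r.
by rewrite -addrA; constructor=> //; apply: IHv.
Qed.

Lemma lspanZ c x : lspan x -> lspan (c *: x).
Proof.
elim=> [|d u v Pu _ IHv]; first by rewrite scaler0; constructor.
by rewrite scalerDr scalerA; constructor.
Qed.

Lemma lspanN x : lspan x -> lspan (- x).
Proof. by rewrite -scaleN1r; apply: lspanZ. Qed.

Definition lspan_pred : {pred V} := fun x => `[< lspan x >].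

Lemma lspan_predP x : reflect (lspan x) (x \in lspan_pred).
Proof. exact: asboolP. Qed.

Fact lspan_zmod_closed : zmod_closed lspan_pred.
Proof.
split=> [|x y /lspan_predP Sx /lspan_predP Sy]; apply/lspan_predP.
  exact: lspan0.
by apply: lspanD => //; apply: lspanN.
Qed.

HB.instance Definition _ :=
  GRing.isZmodClosed.Build V lspan_pred lspan_zmod_closed.

Definition quotmod := {quot lspan_pred}.
HB.instance Definition _ := GRing.Zmodule.on quotmod.

Definition qpi : V -> quotmod :=
  locked_with op_key (fun x => \pi_({quot lspan_pred}) x).

Lemma qpiE x : qpi x = \pi_({quot lspan_pred}) x.
Proof. by rewrite /qpi unlock. Qed.

Lemma qpi_eq x y : (qpi x = qpi y) <-> lspan (x - y).
Proof.
rewrite !qpiE; split=> [/eqP|Sxy].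
  by rewrite -idealrBE => /lspan_predP.
by apply/eqP; rewrite -idealrBE; apply/lspan_predP.
Qed.

Lemma qpi_repr (x : quotmod) : qpi (repr (x : {quot lspan_pred})) = x.
Proof. by rewrite qpiE reprK. Qed.

Lemma qpiP (x : quotmod) : exists y, x = qpi y.
Proof. by exists (repr (x : {quot lspan_pred})); rewrite qpi_repr. Qed.

Lemma qpi0 : qpi 0 = 0. Proof. by rewrite qpiE raddf0. Qed.
Lemma qpiD : {morph qpi : x y / x + y}. Proof. by move=> x y; rewrite !qpiE raddfD. Qed.

Definition qscale : K -> quotmod -> quotmod :=
  locked_with op_key
    (fun c x => qpi (c *: repr (x : {quot lspan_pred}))).

Lemma qpiZ c x : qpi (c *: x) = qscale c (qpi x).
Proof.
rewrite /qscale unlock; apply/qpi_eq; rewrite -scalerBr; apply: lspanZ; apply/qpi_eq.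
by rewrite qpi_repr.
Qed.

Fact qscaleA a b v : qscale a (qscale b v) = qscale (a * b) v.
Proof. by case: (qpiP v) => x ->; rewrite -!qpiZ scalerA. Qed.
Fact qscale1 : left_id 1 qscale.
Proof. by move=> v; case: (qpiP v) => x ->; rewrite -qpiZ scale1r. Qed.
Fact qscaleDr : right_distributive qscale +%R.
Proof.
move=> a u v; case: (qpiP u) (qpiP v) => x -> [y ->].
by rewrite -qpiD -!qpiZ scalerDr qpiD.
Qed.
Fact qscaleDl v : {morph qscale^~ v : a b / a + b}.
Proof. by move=> a b; case: (qpiP v) => x ->; rewrite -!qpiZ scalerDl qpiD. Qed.

HB.instance Definition _ := GRing.Zmodule_isLmodule.Build K quotmod
  qscaleA qscale1 qscaleDr qscaleDl.

Fact qpi_linear : linear qpi.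
Proof. by move=> c x y; rewrite qpiD qpiZ. Qed.
HB.instance Definition _ := GRing.isLinear.Build K V quotmod _ qpi qpi_linear.

End LinearSpan.

(* The quotient of the algebra E by the two-sided ideal generated by the
   differences x - y, for all pairs with [rel x y]; the relations of a
   presentation are the pairs (left-hand side, right-hand side). *)
Section QuotientAlgebra.
Variables (K : fieldType) (E : algType K) (rel : E -> E -> Prop).

Definition ideal_gens (z : E) : Prop :=
  exists a b x y, rel x y /\ z = a * (x - y) * b.

Definition quotalg := quotmod ideal_gens.
HB.instance Definition _ := GRing.Lmodule.on quotalg.

Definition apr (x : E) : quotalg := qpi ideal_gens x.

Lemma aprP (x : quotalg) : exists y, x = apr y. Proof. exact: qpiP. Qed.

Lemma idealMl a x : lspan ideal_gens x -> lspan ideal_gens (a * x).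
Proof.
elim=> [|c u v [b [d [p [q [Pu ->]]]]] _ IH].
  by rewrite mulr0; constructor.
rewrite mulrDr -scalerAr; constructor=> //.
by exists (a * b), d, p, q; rewrite !mulrA.
Qed.

Lemma idealMr a x : lspan ideal_gens x -> lspan ideal_gens (x * a).
Proof.
elim=> [|c u v [b [d [p [q [Pu ->]]]]] _ IH].
  by rewrite mul0r; constructor.
rewrite mulrDl -scalerAl; constructor=> //.
by exists b, (d * a), p, q; rewrite !mulrA.
Qed.

Definition qmul : quotalg -> quotalg -> quotalg :=
  locked_with op_key
    (fun x y => apr (repr (x : {quot _}) * repr (y : {quot _}))).

Lemma aprM x y : apr (x * y) = qmul (apr x) (apr y).
Proof.
rewrite /qmul unlock; apply/qpi_eq; set x' := repr _; set y' := repr _.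
have Ex : lspan ideal_gens (x - x') by apply/qpi_eq; rewrite qpi_repr.
have Ey : lspan ideal_gens (y - y') by apply/qpi_eq; rewrite qpi_repr.
have -> : x * y - x' * y' = (x - x') * y + x' * (y - y').
  by rewrite mulrBl mulrBr addrA subrK.
by apply: lspanD; [apply: idealMr|apply: idealMl].
Qed.

Fact qmulA : associative qmul.
Proof.
move=> u v w; case: (aprP u) (aprP v) (aprP w) => x -> [y ->] [z ->].
by rewrite -!aprM mulrA.
Qed.
Fact qmul1 : left_id (apr 1) qmul.
Proof. by move=> u; case: (aprP u) => x ->; rewrite -aprM mul1r. Qed.
Fact qmulr1 : right_id (apr 1) qmul.
Proof. by move=> u; case: (aprP u) => x ->; rewrite -aprM mulr1. Qed.
Fact qmulDl : left_distributive qmul +%R.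
Proof.
move=> u v w; case: (aprP u) (aprP v) (aprP w) => x -> [y ->] [z ->].
by rewrite -[apr x + apr y]qpiD -!aprM mulrDl; apply: qpiD.
Qed.
Fact qmulDr : right_distributive qmul +%R.
Proof.
move=> u v w; case: (aprP u) (aprP v) (aprP w) => x -> [y ->] [z ->].
by rewrite -[apr y + apr z]qpiD -!aprM mulrDr; apply: qpiD.
Qed.

HB.instance Definition _ := GRing.Zmodule_isPzRing.Build quotalg
  qmulA qmul1 qmulr1 qmulDl qmulDr.

Fact apr_linear : linear apr. Proof. exact: qpi_linear. Qed.
Fact apr_monoid_morphism : monoid_morphism apr.
Proof. by split=> // x y; apply: aprM. Qed.
HB.instance Definition _ := GRing.isLinear.Build K E quotalg _ apr apr_linear.
HB.instance Definition _ :=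
  GRing.isMonoidMorphism.Build E quotalg apr apr_monoid_morphism.

Lemma quotalg_scaleAl (c : K) (x y : quotalg) : c *: (x * y) = (c *: x) * y.
Proof.
case: (aprP x) (aprP y) => u -> [v ->].
by rewrite -rmorphM -!linearZ -rmorphM /= scalerAl.
Qed.

Lemma quotalg_scaleAr (c : K) (x y : quotalg) : c *: (x * y) = x * (c *: y).
Proof.
case: (aprP x) (aprP y) => u -> [v ->].
by rewrite -rmorphM -!linearZ -rmorphM /= scalerAr.
Qed.

(* An algebra morphism from E to K compatible with the relations shows that
   the quotient is not the zero ring. *)
Lemma quotalg_neq0 (eps : {rmorphism E -> K}) :
  (forall x y, rel x y -> eps x = eps y) -> (1 : quotalg) != 0.
Proof.
move=> eps_rel; apply/eqP; rewrite -(qpi0 ideal_gens) => /qpi_eq.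
rewrite subr0 => S1; have: eps 1 = 0.
  suff Hall z : lspan ideal_gens z -> forall a, eps (a * z) = 0.
    by rewrite -[1](mul1r 1) Hall.
  elim=> [a|c u v [b [d [p [q [Pu ->]]]]] _ IH a].
    by rewrite mulr0 rmorph0.
  rewrite mulrDr rmorphD IH addr0 -scalerAr scalerAl !rmorphM rmorphB.
  by rewrite (eps_rel _ _ Pu) subrr mulr0 mul0r mulr0.
by apply/eqP; rewrite rmorph1 oner_neq0.
Qed.

End QuotientAlgebra.

Fact malg_scaleAr (M : monomType) (K : fieldType) (c : K) (x y : {malg K[M]}) :
  c *: (x * y) = x * (c *: y).
Proof.
apply/malgP=> k; rewrite mcoeffZ mcoeffMl.
rewrite (mcoeffMlw k (fsubset_refl (msupp x)) (msuppZ_le c y)).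
rewrite mulr_sumr; apply: eq_bigr => k1 _.
rewrite mulr_sumr; apply: eq_bigr => k2 _.
by rewrite mcoeffZ mulrnAr mulrCA.
Qed.

Section FreeAlgebra.
Variables (K : fieldType) (X : choiceType).

Local Notation malgX := {malg K[{fmonom X}]}.

Definition freealg := malgX.
HB.instance Definition _ := Choice.on freealg.

Definition fzero : freealg := locked_with op_key (0 : malgX).
Definition fone : freealg := locked_with op_key (1 : malgX).
Definition fopp : freealg -> freealg :=
  locked_with op_key (fun x => - (x : malgX)).
Definition fadd : freealg -> freealg -> freealg :=
  locked_with op_key (fun x y => (x : malgX) + (y : malgX)).
Definition fmul : freealg -> freealg -> freealg :=
  locked_with op_key (fun x y => (x : malgX) * (y : malgX)).
Definition fscale : K -> freealg -> freealg :=
  locked_with op_key (fun c x => c *: (x : malgX)).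

Lemma fzeroE : fzero = (0 : malgX). Proof. by rewrite /fzero unlock. Qed.
Lemma foneE : fone = (1 : malgX). Proof. by rewrite /fone unlock. Qed.
Lemma foppE x : fopp x = - (x : malgX). Proof. by rewrite /fopp unlock. Qed.
Lemma faddE x y : fadd x y = (x : malgX) + (y : malgX).
Proof. by rewrite /fadd unlock. Qed.
Lemma fmulE x y : fmul x y = (x : malgX) * (y : malgX).
Proof. by rewrite /fmul unlock. Qed.
Lemma fscaleE c x : fscale c x = c *: (x : malgX).
Proof. by rewrite /fscale unlock. Qed.

Fact faddA : associative fadd.
Proof. by move=> x y z; rewrite !faddE; apply: addrA. Qed.
Fact faddC : commutative fadd.
Proof. by move=> x y; rewrite !faddE; apply: addrC. Qed.
Fact fadd0 : left_id fzero fadd.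
Proof. by move=> x; rewrite faddE fzeroE; apply: add0r. Qed.
Fact faddN : left_inverse fzero fopp fadd.
Proof. by move=> x; rewrite faddE fzeroE foppE; apply: addNr. Qed.
HB.instance Definition _ :=
  GRing.isZmodule.Build freealg faddA faddC fadd0 faddN.

Fact fscaleA a b x : fscale a (fscale b x) = fscale (a * b) x.
Proof. by rewrite !fscaleE; apply: scalerA. Qed.
Fact fscale1 : left_id 1 fscale.
Proof. by move=> x; rewrite fscaleE; apply: scale1r. Qed.
Fact fscaleDr : right_distributive fscale +%R.
Proof.
move=> a x y; rewrite -[x + y]/(fadd x y) -[RHS]/(fadd _ _).
by rewrite !fscaleE !faddE; apply: scalerDr.
Qed.
Fact fscaleDl x : {morph fscale^~ x : a b / a + b}.
Proof.
move=> a b; rewrite -[RHS]/(fadd _ _).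
by rewrite !fscaleE !faddE; apply: scalerDl.
Qed.
HB.instance Definition _ := GRing.Zmodule_isLmodule.Build K freealg
  fscaleA fscale1 fscaleDr fscaleDl.

Fact fmulA : associative fmul.
Proof. by move=> x y z; rewrite !fmulE; apply: mulrA. Qed.
Fact fmul1 : left_id fone fmul.
Proof. by move=> x; rewrite fmulE foneE; apply: mul1r. Qed.
Fact fmulr1 : right_id fone fmul.
Proof. by move=> x; rewrite fmulE foneE; apply: mulr1. Qed.
Fact fmulDl : left_distributive fmul +%R.
Proof.
move=> x y z; rewrite -[x + y]/(fadd x y) -[RHS]/(fadd _ _).
by rewrite !fmulE !faddE; apply: mulrDl.
Qed.
Fact fmulDr : right_distributive fmul +%R.
Proof.
move=> x y z; rewrite -[y + z]/(fadd y z) -[RHS]/(fadd _ _).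
by rewrite !fmulE !faddE; apply: mulrDr.
Qed.
Fact fone_neq0 : fone != 0.
Proof. by rewrite -[0]/fzero foneE fzeroE; apply: oner_neq0. Qed.
HB.instance Definition _ := GRing.Zmodule_isNzRing.Build freealg
  fmulA fmul1 fmulr1 fmulDl fmulDr fone_neq0.

Fact fscaleAl (c : K) (x y : freealg) : c *: (x * y) = c *: x * y.
Proof.
rewrite -[x * y]/(fmul x y) -[RHS]/(fmul (fscale c x) y).
by rewrite -[LHS]/(fscale c _) !fscaleE !fmulE; apply: scalerAl.
Qed.
HB.instance Definition _ :=
  GRing.Lmodule_isLalgebra.Build K freealg fscaleAl.

Fact fscaleAr (c : K) (x y : freealg) : c *: (x * y) = x * (c *: y).
Proof.
rewrite -[x * y]/(fmul x y) -[RHS]/(fmul x (fscale c y)).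
by rewrite -[LHS]/(fscale c _) !fscaleE !fmulE; apply: malg_scaleAr.
Qed.
HB.instance Definition _ :=
  GRing.Lalgebra_isAlgebra.Build K freealg fscaleAr.

Definition fvar : X -> freealg :=
  locked_with op_key (fun x => mkmalgU (fmu x) 1 : malgX).

Lemma fvarE x : fvar x = (mkmalgU (fmu x) 1 : malgX).
Proof. by rewrite /fvar unlock. Qed.

Definition faug : freealg -> K :=
  locked_with op_key (fun x : malgX => mcoeff mone x).

Lemma faugE x : faug x = mcoeff mone (x : malgX).
Proof. by rewrite /faug unlock. Qed.

Fact faug_zmod_morphism : zmod_morphism faug.
Proof.
move=> x y; rewrite -[x - y]/(fadd x (fopp y)) !faugE faddE foppE.
exact: mcoeffB.
Qed.
Fact faug_monoid_morphism : monoid_morphism faug.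
Proof.
case: (@mcoeff1g_is_multiplicative {fmonom X} K) => fM f1; split.
  by rewrite -[1]/fone faugE foneE; apply: f1.
by move=> x y; rewrite -[x * y]/(fmul x y) !faugE fmulE; apply: fM.
Qed.
HB.instance Definition _ :=
  GRing.isZmodMorphism.Build freealg K faug faug_zmod_morphism.
HB.instance Definition _ :=
  GRing.isMonoidMorphism.Build freealg K faug faug_monoid_morphism.

Lemma faug0 : faug 0 = 0. Proof. exact: rmorph0. Qed.
Lemma faugD x y : faug (x + y) = faug x + faug y.
Proof. exact: rmorphD. Qed.
Lemma faugB x y : faug (x - y) = faug x - faug y.
Proof. exact: rmorphB. Qed.
Lemma faugZ c (x : freealg) : faug (c *: x) = c * faug x.
Proof. by rewrite -[c *: x]/(fscale c x) !faugE fscaleE; apply: mcoeffZ. Qed.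

Lemma faug_var x : faug (fvar x) = 0.
Proof.
rewrite faugE fvarE mcoeffU1; case: eqP => // /(congr1 (@fmonom_val X)).
by rewrite fmuE /mone /= fmoneE.
Qed.

End FreeAlgebra.

Section Tensor.
Variables (K : fieldType) (V W : lmodType K).

Local Notation free := {malg K[(V * W)%type]}.
Local Notation sym v w := (mkmalgU (v, w) 1 : free).

Inductive tensor_rel : free -> Prop :=
| tensor_rel_l c v v' w :
    tensor_rel (sym (c *: v + v') w - (c *: sym v w + sym v' w))
| tensor_rel_r c v w w' :
    tensor_rel (sym v (c *: w + w') - (c *: sym v w + sym v w')).

Definition tensor := quotmod tensor_rel.
HB.instance Definition _ := GRing.Lmodule.on tensor.

Definition tens : V -> W -> tensor :=
  locked_with op_key (fun v w => qpi tensor_rel (sym v w)).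

Lemma tensE v w : tens v w = qpi tensor_rel (sym v w).
Proof. by rewrite /tens unlock. Qed.

Lemma tens_linear_l w : linear (tens^~ w).
Proof.
move=> c v v'; rewrite !tensE -linearP; apply/qpi_eq; apply: lspan_gen.
exact: tensor_rel_l.
Qed.

Lemma tens_linear_r v : linear (tens v).
Proof.
move=> c w w'; rewrite !tensE -linearP; apply/qpi_eq; apply: lspan_gen.
exact: tensor_rel_r.
Qed.

Lemma tensor_ind (Q : tensor -> Prop) :
  Q 0 -> (forall c v w t, Q t -> Q (c *: tens v w + t)) -> forall t, Q t.
Proof.
move=> Q0 QD t; case: (qpiP t) => x ->; rewrite [x]monalgE.
elim: (enum_fset _) => [|k s IH]; first by rewrite big_nil qpi0.
rewrite big_cons qpiD; have -> : mkmalgU k x@_k = x@_k *: sym k.1 k.2.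
  by case: k => v w; apply/malgP=> m; rewrite mcoeffZ !mcoeffU mulrnAr mulr1.
by rewrite [X in X + _]linearZ /= -tensE; apply: QD.
Qed.

Section Lift.
Variables (U : lmodType K) (f : V -> W -> U).
Hypothesis f_linear_l : forall w, linear (f^~ w).
Hypothesis f_linear_r : forall v, linear (f v).

Definition flift (x : free) : U := \sum_(k <- msupp x) x@_k *: f k.1 k.2.

Lemma fliftEw (d : {fset (V * W)%type}) (x : free) : (msupp x `<=` d)%fset ->
  flift x = \sum_(k <- d) x@_k *: f k.1 k.2.
Proof.
move=> le; rewrite /flift (big_fset_incl _ le) //= => k _ /mcoeff_outdom ->.
by rewrite scale0r.
Qed.

Lemma flift_linear : linear flift.
Proof.
move=> c x y; set d := (msupp (c *: x + y)%R `|` (msupp x `|` msupp y))%fset.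
rewrite !(fliftEw (d := d)) /d ?fsubsetUl //.
- rewrite scaler_sumr -big_split; apply: eq_bigr => k _ /=.
  by rewrite mcoeffD mcoeffZ scalerDl scalerA.
- by apply/fsubsetP=> k; rewrite !in_fsetE => ->; rewrite !orbT.
- by apply/fsubsetP=> k; rewrite !in_fsetE => ->; rewrite !orbT.
Qed.
HB.instance Definition _ :=
  GRing.isLinear.Build K free U _ flift flift_linear.

Lemma flift_sym v w : flift (sym v w) = f v w.
Proof.
by rewrite (fliftEw msuppU_le) big_seq_fset1 mcoeffUU scale1r.
Qed.

Lemma flift_rel x : lspan tensor_rel x -> flift x = 0.
Proof.
elim=> [|c u v Ru _ IH]; first exact: linear0.
rewrite linearP /= IH addr0; case: Ru => [d a a' b|d a b b'];
  by rewrite linearB linearP /= !flift_sym ?f_linear_l ?f_linear_r subrr scaler0.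
Qed.

Definition tlift (t : tensor) : U := flift (repr (t : {quot _})).

Lemma tlift_pi x : tlift (qpi tensor_rel x) = flift x.
Proof.
apply/eqP; rewrite -subr_eq0 -linearB /=; apply/eqP/flift_rel/qpi_eq.
by rewrite qpi_repr.
Qed.

Lemma tlift_linear : linear tlift.
Proof.
move=> c t t'; case: (qpiP t) (qpiP t') => x -> [y ->].
by rewrite -linearP !tlift_pi linearP.
Qed.

Lemma tlift_tens v w : tlift (tens v w) = f v w.
Proof. by rewrite tensE tlift_pi flift_sym. Qed.

End Lift.

End Tensor.

Section TensorAlgebra.
Variables (K : fieldType) (A B : algType K).

Local Notation T := (tensor A B).

Definition tmull (a : A) (b : B) : T -> T :=
  tlift (fun a' b' => tens (a * a') (b * b')).

Lemma tmull_linear a b : linear (tmull a b).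
Proof.
apply: tlift_linear => [b'|a'] c x y /=.
  by rewrite mulrDr -scalerAr tens_linear_l.
by rewrite mulrDr -scalerAr tens_linear_r.
Qed.

Lemma tmull_tens a b a' b' : tmull a b (tens a' b') = tens (a * a') (b * b').
Proof.
apply: tlift_tens => [b0|a0] c x y /=.
  by rewrite mulrDr -scalerAr tens_linear_l.
by rewrite mulrDr -scalerAr tens_linear_r.
Qed.

Lemma lin0 (U U' : lmodType K) (f : U -> U') : linear f -> f 0 = 0.
Proof.
by move=> lf; have := lf (-1) 0 0; rewrite scaler0 add0r scaleN1r addNr.
Qed.

Lemma linZ (U U' : lmodType K) (f : U -> U') c x :
  linear f -> f (c *: x) = c *: f x.
Proof. by move=> lf; have := lf c x 0; rewrite (lin0 lf) !addr0. Qed.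

Lemma linD (U U' : lmodType K) (f : U -> U') x y :
  linear f -> f (x + y) = f x + f y.
Proof. by move=> lf; have := lf 1 x y; rewrite !scale1r. Qed.

Lemma linDZ (U U' : lmodType K) (f h : U -> U') c :
  linear f -> linear h -> linear (fun x => c *: f x + h x).
Proof.
move=> lf lh d x y; rewrite lf lh !scalerDr !scalerA [c * d]mulrC.
exact: addrACA.
Qed.

Lemma tens_eq (U : lmodType K) (f g : T -> U) : linear f -> linear g ->
  (forall a b, f (tens a b) = g (tens a b)) -> f =1 g.
Proof.
move=> lf lg fg; apply: tensor_ind; first by rewrite (lin0 lf) (lin0 lg).
by move=> c v w t IH; rewrite lf lg fg IH.
Qed.

Lemma tmull_linear_l t b : linear (fun a => tmull a b t).
Proof.
move=> c a a'; move: t; apply: tens_eq; first exact: tmull_linear.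
  by apply: linDZ; apply: tmull_linear.
by move=> x y; rewrite !tmull_tens mulrDl -scalerAl tens_linear_l.
Qed.

Lemma tmull_linear_r t a : linear (fun b => tmull a b t).
Proof.
move=> c b b'; move: t; apply: tens_eq; first exact: tmull_linear.
  by apply: linDZ; apply: tmull_linear.
by move=> x y; rewrite !tmull_tens mulrDl -scalerAl tens_linear_r.
Qed.

Definition tmul : T -> T -> T :=
  locked_with op_key (fun t t' => tlift (fun a b => tmull a b t') t).

Lemma tmulE t t' : tmul t t' = tlift (fun a b => tmull a b t') t.
Proof. by rewrite /tmul unlock. Qed.

Lemma tmul_linear_l t' : linear (tmul^~ t').
Proof.
move=> c x y; rewrite !tmulE.
by apply: tlift_linear => [b|a]; [apply: tmull_linear_l|apply: tmull_linear_r].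
Qed.

Lemma tmulEl a b t : tmul (tens a b) t = tmull a b t.
Proof.
rewrite tmulE tlift_tens //.
  by move=> b'; apply: tmull_linear_l.
by move=> a'; apply: tmull_linear_r.
Qed.

Lemma tmul_linear_r t : linear (tmul t).
Proof.
move=> c x y; move: t; apply: tens_eq; first exact: tmul_linear_l.
  by apply: linDZ; apply: tmul_linear_l.
by move=> a b; rewrite !tmulEl tmull_linear.
Qed.

Lemma tmul_tens a b a' b' :
  tmul (tens a b) (tens a' b') = tens (a * a') (b * b').
Proof. by rewrite tmulEl tmull_tens. Qed.

Fact tmulA : associative tmul.
Proof.
move=> x y z; move: z; apply: tens_eq.
- by move=> c u v; rewrite !tmul_linear_r.
- exact: tmul_linear_r.
move=> a3 b3; move: y; apply: tens_eq.
- by move=> c u v; rewrite tmul_linear_l tmul_linear_r.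
- by move=> c u v; rewrite tmul_linear_r tmul_linear_l.
move=> a2 b2; move: x; apply: tens_eq.
- exact: tmul_linear_l.
- by move=> c u v; rewrite !tmul_linear_l.
by move=> a1 b1; rewrite !tmul_tens !mulrA.
Qed.

Fact tmul1 : left_id (tens 1 1) tmul.
Proof.
apply: tens_eq; [exact: tmul_linear_r|by []|].
by move=> a b; rewrite tmul_tens !mul1r.
Qed.

Fact tmulr1 : right_id (tens 1 1) tmul.
Proof.
apply: tens_eq; [exact: tmul_linear_l|by []|].
by move=> a b; rewrite tmul_tens !mulr1.
Qed.

Fact tmulDl : left_distributive tmul +%R.
Proof. by move=> x y z; rewrite (linD _ _ (tmul_linear_l z)). Qed.
Fact tmulDr : right_distributive tmul +%R.
Proof. by move=> x y z; rewrite (linD _ _ (tmul_linear_r x)). Qed.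

HB.instance Definition _ := GRing.Zmodule_isPzRing.Build (tensor A B)
  tmulA tmul1 tmulr1 tmulDl tmulDr.

End TensorAlgebra.


Record lieAlgebra (K : fieldType) := LieAlgebra {
  lie_sort :> vectType K;
  lie_br : lie_sort -> lie_sort -> lie_sort;
  lie_br_linear_l : forall y, linear (lie_br^~ y);
  lie_br_linear_r : forall x, linear (lie_br x);
  lie_br_alt : forall x, lie_br x x = 0;
  lie_jacobi : forall x y z,
    lie_br x (lie_br y z) + lie_br y (lie_br z x) + lie_br z (lie_br x y) = 0
}.

Section LieAlgebra.
Variables (K : fieldType) (g : lieAlgebra K).

Definition lie_simple :=
  (exists x y : g, lie_br x y != 0) /\
  (forall U : {vspace g},
     (forall x u : g, u \in U -> lie_br x u \in U) ->
     U = 0%VS \/ U = fullv).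

Definition ad_semisimple (x : g) :=
  exists2 b : seq g, basis_of fullv b &
    forall v, v \in b -> exists c : K, lie_br x v = c *: v.

(* A Cartan subalgebra of a semisimple Lie algebra: a maximal abelian
   (equivalently, self-centralizing) subalgebra of ad-semisimple elements. *)
Definition is_cartan_subalgebra (h : {vspace g}) :=
  (forall x : g, x \in h <-> (forall y, y \in h -> lie_br x y = 0)) /\
  (forall x : g, x \in h -> ad_semisimple x).

End LieAlgebra.

(* The root lattice Q, in coordinates with respect to the simple roots. *)
Notation rootLattice I := {ffun I -> int}.

Section RootLattice.
Variable I : finType.

Definition simple_root (i : I) : rootLattice I := [ffun j => (j == i)%:Z].

Definition Qplus (b : rootLattice I) : Prop :=
  (forall i, 0 <= b i) /\ 0 < \sum_i b i.

(* A sign is a boolean, [false] for + and [true] for -. *)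
Definition signQ (s : bool) (b : rootLattice I) : rootLattice I :=
  if s then - b else b.

End RootLattice.

(* The choices attached to g: an invariant inner product, a Cartan subalgebra
   with a base of the roots, Chevalley generators and root vectors.
   The inner product is any nondegenerate invariant symmetric bilinear form:
   positivity on the real span of the roots is not required.
   The dual of the Cartan subalgebra h is identified with h through the inner
   product, so that t in h stands for the linear form H |-> (t, H), and the
   inner product of two linear forms is that of the elements of h. *)
Record chevalleyData (K : fieldType) (g : lieAlgebra K) (I : finType) :=
ChevalleyData {
  form : g -> g -> K;
  form_linear : forall x (c : K) y z,
    form x (c *: y + z) = c * form x y + form x z;
  form_sym : forall x y, form x y = form y x;
  form_invariant : forall x y z, form (lie_br x y) z = form x (lie_br y z);
  form_nondegenerate : forall x, (forall y, form x y = 0) -> x = 0;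

  cartan_sub : {vspace g};
  cartan_subP : is_cartan_subalgebra cartan_sub;

  alpha : I -> g;
  alpha_basis : basis_of cartan_sub (codom alpha);
  weight (b : rootLattice I) : g := \sum_i (b i)%:~R *: alpha i;
  in_weight_space (t x : g) :=
    forall y, y \in cartan_sub -> lie_br y x = form t y *: x;
  is_root (t : g) :=
    [/\ t \in cartan_sub, t != 0 & exists2 x, x != 0 & in_weight_space t x];
  root_decomposition : forall t, is_root t ->
    exists2 b, Qplus b & t = weight b \/ t = - weight b;

  cartan_mx : I -> I -> int;
  cartan_mxP : forall i j,
    form (alpha i) (alpha i) / 2 * (cartan_mx i j)%:~R
      = form (alpha i) (alpha j);

  pos_roots : seq (rootLattice I);
  pos_roots_uniq : uniq pos_roots;
  pos_rootsP : forall b, b \in pos_roots <-> Qplus b /\ is_root (weight b);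

  chev : bool -> I -> g;
  chev_weight : forall s i,
    in_weight_space (weight (signQ s (simple_root i))) (chev s i);
  chev_form : forall i, form (chev false i) (chev true i) = 1;
  chev_generate : forall U : {vspace g},
    (forall s i, chev s i \in U) ->
    (forall x y, x \in U -> y \in U -> lie_br x y \in U) -> U = fullv;

  chev_xi (i : I) : g := lie_br (chev false i) (chev true i);

  omega : g -> g;
  omega_linear : linear omega;
  omega_lie : forall x y, omega (lie_br x y) = lie_br (omega x) (omega y);
  omega_xi : forall i, omega (chev_xi i) = - chev_xi i;
  omega_chev : forall s i, omega (chev s i) = - chev (~~ s) i;

  rvec : bool -> rootLattice I -> g;
  rvec_weight : forall s b, b \in pos_roots ->
    in_weight_space (weight (signQ s b)) (rvec s b);
  rvec_form : forall b, b \in pos_roots -> form (rvec false b) (rvec true b) = 1;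
  rvec_simple : forall s i, rvec s (simple_root i) = chev s i;
  rvec_omega : forall s b, b \in pos_roots ->
    omega (rvec s b) = - rvec (~~ s) b
}.

Section Datum.
Variables (K : fieldType) (g : lieAlgebra K) (I : finType).
Variable D : chevalleyData g I.

Definition ipQ (b c : rootLattice I) : K := form D (weight D b) (weight D c).
Definition ip (i j : I) : K := ipQ (simple_root i) (simple_root j).
Definition dnum (i : I) : K := ip i i / 2.

Definition typeG2 :=
  #|I| = 2 /\ exists i j, cartan_mx D i j = -1 /\ cartan_mx D j i = -3.

End Datum.

Definition cbr (A : pzRingType) (x y : A) : A := x * y - y * x.
Definition abr (A : pzRingType) (x y : A) : A := x * y + y * x.

(* [inl (i, r)] is the generator xi_{i,r}; [inr (s, i, r)] is x^s_{i,r}. *)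
Definition ygen (I : finType) : choiceType := (I * nat + bool * I * nat)%type.

Lemma rmorph_cbr (A : pzRingType) (B : comPzRingType) (f : {rmorphism A -> B})
  (x y : A) : f (cbr x y) = 0.
Proof. by rewrite /cbr rmorphB !rmorphM mulrC subrr. Qed.

Lemma rmorph_abr0 (A B : pzRingType) (f : {rmorphism A -> B}) (x y : A) :
  f y = 0 -> f (abr x y) = 0.
Proof. by rewrite /abr rmorphD !rmorphM => ->; rewrite mul0r mulr0 addr0. Qed.

Lemma faug_cbr (K : fieldType) (X : choiceType) (x y : freealg K X) :
  faug (cbr x y) = 0.
Proof. exact: rmorph_cbr. Qed.

Lemma faug_abr (K : fieldType) (X : choiceType) (x : freealg K X) (b : X) :
  faug (abr x (fvar K b)) = 0.
Proof. by apply: rmorph_abr0; apply: faug_var. Qed.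

Section Yangian.
Variables (K : fieldType) (g : lieAlgebra K) (I : finType).
Variable D : chevalleyData g I.

Local Notation F := (freealg K (ygen I)).
Local Notation fxi i r := (fvar K (inl (i, r) : ygen I)).
Local Notation fx s i r := (fvar K (inr (s, i, r) : ygen I)).

Inductive yangian_rel : F -> F -> Prop :=
| yrel_xi_xi i j r s : yangian_rel (cbr (fxi i r) (fxi j s)) 0
| yrel_xi0_x e i j s :
    yangian_rel (cbr (fxi i 0) (fx e j s)) (((-1) ^+ e * ip D i j) *: fx e j s)
| yrel_x_x i j r s :
    yangian_rel (cbr (fx false i r) (fx true j s))
                (if i == j then fxi i (r + s) else 0)
| yrel_xi_x e i j r s :
    yangian_rel (cbr (fxi i r.+1) (fx e j s) - cbr (fxi i r) (fx e j s.+1))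
                (((-1) ^+ e * (ip D i j / 2)) *: abr (fxi i r) (fx e j s))
| yrel_xe_xe e i j r s :
    yangian_rel (cbr (fx e i r.+1) (fx e j s) - cbr (fx e i r) (fx e j s.+1))
                (((-1) ^+ e * (ip D i j / 2)) *: abr (fx e i r) (fx e j s))
| yrel_serre e i j m (r : 'I_m -> nat) s :
    i != j -> m%:Z = 1 - cartan_mx D i j ->
    yangian_rel
      (\sum_(sigma : 'S_m)
         foldr (fun k y => cbr (fx e i (r (sigma k))) y) (fx e j s) (enum 'I_m))
      0.

Definition yangian := quotalg yangian_rel.
HB.instance Definition _ := GRing.Lmodule.on yangian.
HB.instance Definition _ := GRing.PzRing.on yangian.

Lemma faug_yangian x y : yangian_rel x y -> faug x = faug y.
Proof.
case=> [i j r s|e i j s|i j r s|e i j r s|e i j r s|e i j m r s neq_ij mE].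
- by rewrite faug_cbr faug0.
- by rewrite faug_cbr faugZ faug_var mulr0.
- by rewrite faug_cbr; case: eqP => _; rewrite ?faug_var ?faug0.
- by rewrite faugB !faug_cbr subrr faugZ faug_abr mulr0.
- by rewrite faugB !faug_cbr subrr faugZ faug_abr mulr0.
rewrite faug0 (big_morph _ (@faugD K (ygen I)) (faug0 _ _)) big1 // => sigma _.
by case: (enum 'I_m) => [|k l]; rewrite /= ?faug_var ?faug_cbr.
Qed.

Fact yangian1_neq0 : (1 : yangian) != 0.
Proof. exact: quotalg_neq0 faug_yangian. Qed.

HB.instance Definition _ :=
  GRing.PzSemiRing_isNonZero.Build yangian yangian1_neq0.
HB.instance Definition _ := GRing.Lmodule_isLalgebra.Build K yangian
  (@quotalg_scaleAl _ _ yangian_rel).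
HB.instance Definition _ := GRing.Lalgebra_isAlgebra.Build K yangian
  (@quotalg_scaleAr _ _ yangian_rel).

Definition ygenerator (a : ygen I) : yangian := apr yangian_rel (fvar K a).
Definition yxi (i : I) (r : nat) : yangian := ygenerator (inl (i, r)).
Definition yx (s : bool) (i : I) (r : nat) : yangian :=
  ygenerator (inr (s, i, r)).

Definition ydeg (a : ygen I) : rootLattice I :=
  match a with
  | inl _ => 0
  | inr (s, i, _) => signQ s (simple_root i)
  end.

Definition yhomog (b : rootLattice I) : yangian -> Prop :=
  lspan (fun y => exists2 w : seq (ygen I),
    \sum_(a <- w) ydeg a = b & y = \prod_(a <- w) ygenerator a).

Inductive yangian_ge0 : yangian -> Prop :=
| yge0_xi i r : yangian_ge0 (yxi i r)
| yge0_x i r : yangian_ge0 (yx false i r)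
| yge0_scalar c : yangian_ge0 c%:A
| yge0_add x y : yangian_ge0 x -> yangian_ge0 y -> yangian_ge0 (x + y)
| yge0_mul x y : yangian_ge0 x -> yangian_ge0 y -> yangian_ge0 (x * y).

Definition yangian_in (S : rootLattice I -> Prop) : yangian -> Prop :=
  lspan (fun y => exists2 b, S b & yhomog b y).

Definition yangian_ge0_in (S : rootLattice I -> Prop) : yangian -> Prop :=
  lspan (fun y => yangian_ge0 y /\ exists2 b, S b & yhomog b y).

Definition shift_Qplus (i : I) (b : rootLattice I) : Prop :=
  exists2 c, Qplus c & b = simple_root i + c.

End Yangian.

(* [inl (i, r)] is the generator h_{i,2r+1}; [inr (i, r)] is b_{i,r}. *)
Definition tgen (I : finType) : choiceType := (I * nat + I * nat)%type.

Section TwistedYangian.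
Variables (K : fieldType) (g : lieAlgebra K) (I : finType).
Variable D : chevalleyData g I.

Local Notation F := (freealg K (tgen I)).
Local Notation fb i r := (fvar K (inr (i, r) : tgen I)).

(* h_{i,n}, with h_{i,-1} = 1 and h_{i,n} = 0 for n even or n < -1 *)
Definition fh (i : I) (n : int) : F :=
  match n with
  | Posz r => if odd r then fvar K (inl (i, r./2) : tgen I) else 0
  | Negz 0 => 1
  | Negz _ => 0
  end.

Local Notation ad x := (cbr x).

Inductive twisted_rel : F -> F -> Prop :=
| trel_h_h i j (r s : nat) : twisted_rel (cbr (fh i r) (fh j s)) 0
| trel_h_b i j (r s : nat) :
    twisted_rel
      (cbr (fh i (r%:Z + 1)) (fb j s) - cbr (fh i (r%:Z - 1)) (fb j s.+2))
      (ip D i j *: abr (fh i (r%:Z - 1)) (fb j s.+1)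
       + (ip D i j ^+ 2 / 4) *: cbr (fh i (r%:Z - 1)) (fb j s))
| trel_b_b i j (r s : nat) :
    twisted_rel
      (cbr (fb i r.+1) (fb j s) - cbr (fb i r) (fb j s.+1))
      ((ip D i j / 2) *: abr (fb i r) (fb j s)
       - (2 * (i == j)%:R * (-1) ^+ s) *: fh i (r%:Z + s%:Z + 1))
| trel_serre0 i j : cartan_mx D i j = 0 ->
    twisted_rel (cbr (fb i 0) (fb j 0)) 0
| trel_serre1 i j : cartan_mx D i j = -1 ->
    twisted_rel (iter 2 (ad (fb i 0)) (fb j 0)) (- dnum D i *: fb j 0)
| trel_serre2 i j : cartan_mx D i j = -2 ->
    twisted_rel (iter 3 (ad (fb i 0)) (fb j 0))
                ((- 4 * dnum D i) *: cbr (fb i 0) (fb j 0))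
| trel_serre3 i j : cartan_mx D i j = -3 ->
    twisted_rel (iter 4 (ad (fb i 0)) (fb j 0))
                ((- 10 * dnum D i) *: cbr (fb i 0) (cbr (fb i 0) (fb j 0))
                 - (9 * dnum D i ^+ 2) *: fb j 0).

Definition twisted_yangian := quotalg twisted_rel.
HB.instance Definition _ := GRing.Lmodule.on twisted_yangian.
HB.instance Definition _ := GRing.PzRing.on twisted_yangian.

Lemma faug_fh_nat i (r : nat) : faug (fh i r) = 0.
Proof. by rewrite /fh; case: odd; rewrite ?faug_var ?faug0. Qed.

Lemma faug_twisted x y : twisted_rel x y -> faug x = faug y.
Proof.
case=> [i j r s|i j r s|i j r s|i j _|i j _|i j _|i j _].
- by rewrite faug_cbr faug0.
- by rewrite faugB !faug_cbr faugD !faugZ faug_cbr faug_abr !mulr0 subrr addr0.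
- rewrite faugB !faug_cbr faugB !faugZ faug_abr.
  have -> : r%:Z + s%:Z + 1 = (r + s).+1 by rewrite -!PoszD addn1.
  by rewrite faug_fh_nat !mulr0 !subrr.
- by rewrite faug_cbr faug0.
- by rewrite iterS faug_cbr faugZ faug_var mulr0.
- by rewrite iterS faug_cbr faugZ faug_cbr mulr0.
- by rewrite iterS faug_cbr faugB !faugZ faug_cbr faug_var !mulr0 subrr.
Qed.

Fact twisted1_neq0 : (1 : twisted_yangian) != 0.
Proof. exact: quotalg_neq0 faug_twisted. Qed.

HB.instance Definition _ :=
  GRing.PzSemiRing_isNonZero.Build twisted_yangian twisted1_neq0.
HB.instance Definition _ := GRing.Lmodule_isLalgebra.Build K twisted_yangian
  (@quotalg_scaleAl _ _ twisted_rel).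
HB.instance Definition _ := GRing.Lalgebra_isAlgebra.Build K twisted_yangian
  (@quotalg_scaleAr _ _ twisted_rel).

Definition th (i : I) (n : int) : twisted_yangian := apr twisted_rel (fh i n).
Definition tb (i : I) (r : nat) : twisted_yangian := apr twisted_rel (fb i r).

End TwistedYangian.

Section StructureMaps.
Variables (K : fieldType) (g : lieAlgebra K) (I : finType).
Variable D : chevalleyData g I.

Local Notation Y := (yangian D).
Local Notation tY := (twisted_yangian D).

(* the restriction to g of the inclusion of U(g) in the Yangian *)
Definition is_g_inclusion (iota : g -> Y) :=
  [/\ linear iota, injective iota,
      forall x y, iota (lie_br x y) = cbr (iota x) (iota y)
    & (forall i, iota (chev_xi D i) = yxi D i 0) /\
      (forall s i, iota (chev D s i) = yx D s i 0)].

Definition is_coproduct (iota : g -> Y) (Delta : Y -> tensor Y Y) :=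
  [/\ linear Delta, monoid_morphism Delta,
      forall x, Delta (iota x) = tens (iota x) 1 + tens 1 (iota x)
    & forall i, Delta (yxi D i 1) =
        tens (yxi D i 1) 1 + tens 1 (yxi D i 1) + tens (yxi D i 0) (yxi D i 0)
        - \sum_(b <- pos_roots D) ipQ D b (simple_root i) *:
            tens (iota (rvec D true b)) (iota (rvec D false b))].

(* the subspace im(phi) (x) M of Y (x) Y *)
Definition im_tens (phi : tY -> Y) (M : Y -> Prop) : tensor Y Y -> Prop :=
  lspan (fun t => exists a y, M y /\ t = tens (phi a) y).

Definition is_coideal_embedding (iota : g -> Y) (Delta : Y -> tensor Y Y)
    (phi : tY -> Y) :=
  [/\ linear phi, monoid_morphism phi, injective phi,
      (forall i, phi (tb D i 0) =
         iota (chev D false i) - iota (chev D true i)) /\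
      (forall i, phi (th D i 1) =
         2 *: yxi D i 1 - yxi D i 0 ^+ 2
         + \sum_(b <- pos_roots D)
             ipQ D b (simple_root i) *: iota (rvec D false b) ^+ 2)
    & forall a, im_tens phi (fun=> True) (Delta (phi a))].

End StructureMaps.

(* A series in u^-1 is the sequence of its coefficients: [f n] is the
   coefficient of u^-n. *)
Section Series.
Variables (K : fieldType).

Definition series_mul (A : pzRingType) (f h : nat -> A) (n : nat) : A :=
  \sum_(k < n.+1) f k * h (n - k)%N.

Definition series_abr (A : pzRingType) (f h : nat -> A) (n : nat) : A :=
  series_mul f h n + series_mul h f n.

Definition series_tens (A B : lmodType K) (f : nat -> A) (h : nat -> B)
    (n : nat) : tensor A B :=
  \sum_(k < n.+1) tens (f k) (h (n - k)%N).

(* f(-u) *)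
Definition series_opp (A : lmodType K) (f : nat -> A) (n : nat) : A :=
  (-1) ^+ n *: f n.

Definition series_eqmod (A : zmodType) (M : A -> Prop) (f h : nat -> A) :=
  forall n, M (f n - h n).

Variables (g : lieAlgebra K) (I : finType) (D : chevalleyData g I).

Definition xi_series (i : I) (n : nat) : yangian D :=
  if n is r.+1 then yxi D i r else 1.

Definition x_series (s : bool) (i : I) (n : nat) : yangian D :=
  if n is r.+1 then yx D s i r else 0.

(* the coefficient of u^-n in h_i(u) is h_{i,n-1}, also when it is 0 or 1 *)
Definition h_series (i : I) (n : nat) : twisted_yangian D := th D i (n%:Z - 1).

Definition b_series (i : I) (n : nat) : twisted_yangian D :=
  if n is r.+1 then tb D i r else 0.

End Series.

(* Main.v *)
From HB Require Import structures.
Require Import Defs.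
From mathcomp Require Import all_boot all_order all_algebra.
From mathcomp Require Import ring.
From mathcomp Require Import boolp functions.
From mathcomp Require Import reals complex.

(** Fix i, write d = d_i, xi(u) = xi_i(u), x^s(u) = x_i^s(u), and let
    Z(u) = x^-(-u), X(u) = {x^+(u), xi(-u)} / 2, V(u) = {x^+(-u), xi(-u)} / 2.
    In the twisted Yangian, a telescoping sum of the relations between the b_{i,r}
    gives h_i(u) = 1 + d b_i(u)^2 - [b_i(u), b_{i,0}], and
    [h_{i,1}, b_{i,r}] = 4 d b_{i,r+1}.  Hence all the series are determined by
    the action of ad h_{i,1} on b_{i,0}.

    The congruences in Y and in Y (x) Y are one computation, in an algebra with a
    right factor Y and a left factor which is either trivial or the coideal.  With
    left copies a(u) of b_i(u) and h(u) of h_i(u) (a = 0 and h = 1 in the trivial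
    case), the image of b_i(u) is
      Z(u) + a(u) xi(-u) + h(u) X(u) - d a(u)^2 V(u) + err(u),
    where err has right degrees in Q_+: the four explicit terms satisfy the
    recursion defined by ad h_{i,1} up to terms coming from the roots other than
    alpha_i.  In the formula for h_i(u) this is multiplied by Z(u) and x^-_{i,0},
    which lowers degrees, so one also needs that D_0(err) has degrees in Q_+, where
    D_s(y) = [y, x^-_{i,s}] + d {Z_s, y} and Z_s is Z shifted by s.  This follows
    from the recursion, because D_s kills xi(-u) and, when alpha_i occurs exactly
    once in alpha <> alpha_i, also [x_alpha^+, Z(u)].

    The terms (x_alpha^+ - x_alpha^-) (x) x_alpha^+ of the coproduct of h_{i,1} lie
    in the coideal because the fixed points of the Chevalley involution are
    generated by the x_j^+ - x_j^-. *)

Set Implicit Arguments.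
Unset Strict Implicit.
Unset Printing Implicit Defensive.

Import Order.TTheory GRing.Theory Num.Theory.
Local Open Scope ring_scope.

(** * Identities in noncommutative algebras *)

(** D_0 is the linear part at Z(u) of the quadratic formula for h_i(u), with only the summand
    -x^-_{i,0} of b_{i,0} kept in the bracket. The other indices s are forced by the recursion: the
    part of h_{i,1} of right degree 0 brackets x^-_{i,s} to a multiple of x^-_{i,s+1}, so
    coefficient n+1 of D_s(err) involves coefficient n of D_{s+1}(err). A root alpha <> alpha_i is
    harmless if alpha_i does not occur in it, because x_alpha^+ then commutes with every x^-_{i,s},
    and also if alpha_i occurs at least twice, because lowering by alpha_i twice still leaves a
    degree in Q_+. Multiplicity one is the delicate case, where D_s has to vanish. The terms h(u)
    X(u) and d a(u)^2 V(u) do not come from other roots. Together they solve the recursion in right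
    degree alpha_i, and in the formula for h_i(u) the V-term removes the square d (a(u)
    xi(-u))^2. *)

Section NormalForm.
Variables (K : fieldType) (A : algType K).

(* [NL] and [NR] are two families of atoms such that each atom of the first
   family commutes with each atom of the second one. *)
Inductive nexp : Type :=
| NL of nat | NR of nat | N0 | N1
| NAdd of nexp & nexp | NOpp of nexp | NMul of nexp & nexp
| NScale of K & nexp.

Definition mono := (seq nat * seq nat)%type.

(** A private copy of concatenation, like [nadd] and the comparisons [neqn] and [neqs], so that
    [nca] can reduce by an explicit list of names without unfolding anything inside the scalars. *)
Fixpoint napp (s t : seq nat) := if s is x :: s' then x :: napp s' t else t.

Fixpoint nmul1 (c : K) (m : mono) (t : seq (K * mono)) :=
  if t is (c', m') :: t' then
    (c * c', (napp m.1 m'.1, napp m.2 m'.2)) :: nmul1 c m t'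
  else [::].

Fixpoint nadd (s t : seq (K * mono)) :=
  if s is x :: s' then x :: nadd s' t else t.

Fixpoint nmul (s t : seq (K * mono)) :=
  if s is (c, m) :: s' then nadd (nmul1 c m t) (nmul s' t) else [::].

Fixpoint nscale (k : K) (s : seq (K * mono)) :=
  if s is (c, m) :: s' then (k * c, m) :: nscale k s' else [::].

Fixpoint nnorm (e : nexp) : seq (K * mono) :=
  match e with
  | NL n => [:: (1, ([:: n], [::]))]
  | NR n => [:: (1, ([::], [:: n]))]
  | N0 => [::]
  | N1 => [:: (1, ([::], [::]))]
  | NAdd e f => nadd (nnorm e) (nnorm f)
  | NOpp e => nscale (-1) (nnorm e)
  | NMul e f => nmul (nnorm e) (nnorm f)
  | NScale c e => nscale c (nnorm e)
  end.

Fixpoint neqn (m n : nat) :=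
  match m, n with
  | 0, 0 => true | m'.+1, n'.+1 => neqn m' n' | _, _ => false
  end.

Fixpoint neqs (s t : seq nat) :=
  match s, t with
  | [::], [::] => true
  | x :: s', y :: t' => if neqn x y then neqs s' t' else false
  | _, _ => false
  end.

Fixpoint ninsert (c : K) (m : mono) (s : seq (K * mono)) :=
  if s is (c', m') :: s' then
    if (if neqs m.1 m'.1 then neqs m.2 m'.2 else false)
    then (c + c', m') :: s' else (c', m') :: ninsert c m s'
  else [:: (c, m)].

Fixpoint ncollect (s : seq (K * mono)) :=
  if s is (c, m) :: s' then ninsert c m (ncollect s') else [::].

(** A proposition and not a test: each vanishing coefficient becomes a goal in [K], left to [ring]
    or [field]. The singleton case avoids a final conjunct [True]. *)
Fixpoint nzero (s : seq (K * mono)) : Prop :=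
  match s with
  | [::] => True
  | [:: (c, _)] => c = 0
  | (c, _) :: s' => c = 0 /\ nzero s'
  end.

Variables l r : seq A.

Fixpoint neval (e : nexp) : A :=
  match e with
  | NL n => nth 0 l n
  | NR n => nth 0 r n
  | N0 => 0
  | N1 => 1
  | NAdd e f => neval e + neval f
  | NOpp e => - neval e
  | NMul e f => neval e * neval f
  | NScale c e => c *: neval e
  end.

Definition nprod (e : seq A) (s : seq nat) := \prod_(j <- s) nth 0 e j.
Definition nsum (s : seq (K * mono)) :=
  \sum_(x <- s) x.1 *: (nprod l x.2.1 * nprod r x.2.2).

Fixpoint ncommute1 (x : A) (s : seq A) : Prop :=
  match s with
  | [::] => True
  | y :: s' => x * y = y * x /\ ncommute1 x s'
  end.

Fixpoint ncommute (s : seq A) : Prop :=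
  match s with
  | [::] => True
  | x :: s' => ncommute1 x r /\ ncommute s'
  end.

Hypothesis lr_commute : ncommute l.

Lemma ncommuteP i j : nth 0 l i * nth 0 r j = nth 0 r j * nth 0 l i.
Proof.
elim: l lr_commute i => [|x l' IH] /=; first by move=> _ i; rewrite nth_nil mulr0 mul0r.
case=> xr /IH {}IH [|i] //= {IH}.
elim: r xr j => [|y r' IHr] /= xr j; first by rewrite nth_nil mulr0 mul0r.
by case: xr => xy /IHr {}IHr; case: j.
Qed.

Lemma nprod_commute s t : nprod l s * nprod r t = nprod r t * nprod l s.
Proof.
apply/commr_prod => j _; apply/commr_sym; apply/commr_prod => i _.
by rewrite /GRing.comm ncommuteP.
Qed.

Lemma napp_cat s t : napp s t = s ++ t.
Proof. by elim: s => //= x s ->. Qed.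

Lemma nadd_cat s t : nadd s t = s ++ t.
Proof. by elim: s => //= x s ->. Qed.

Lemma nsum_add s t : nsum (nadd s t) = nsum s + nsum t.
Proof. by rewrite nadd_cat /nsum big_cat. Qed.

Lemma nsum_scale k s : nsum (nscale k s) = k *: nsum s.
Proof.
elim: s => [|[c m] s IH]; rewrite /nsum /= ?big_nil ?scaler0 //.
by rewrite !big_cons -/(nsum _) IH scalerDr scalerA.
Qed.

(** This is where the commutation of the two families matters: the right word of [m] has to pass the
    left words of [t]. *)
Lemma nsum_mul1 c m t :
  nsum (nmul1 c m t) = (c *: (nprod l m.1 * nprod r m.2)) * nsum t.
Proof.
elim: t => [|[c' m'] t IH]; rewrite /nsum /= ?big_nil ?mulr0 //.
rewrite !big_cons -/(nsum _) IH mulrDr; congr (_ + _) => /=.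
rewrite -scalerAl -scalerAr scalerA !napp_cat /nprod !big_cat /=.
by rewrite -!/(nprod _ _) mulrA -[_ * _ * nprod r m.2]mulrA nprod_commute !mulrA.
Qed.

Lemma nsum_mul s t : nsum (nmul s t) = nsum s * nsum t.
Proof.
elim: s => [|[c m] s IH]; rewrite /= ?nsum_add ?nsum_mul1 ?IH.
  by rewrite /nsum big_nil mul0r.
by rewrite /nsum big_cons mulrDl.
Qed.

Lemma nnormP e : neval e = nsum (nnorm e).
Proof.
elim: e => [n|n|||e IHe f IHf|e IHe|e IHe f IHf|c e IHe] /=.
- by rewrite /nsum /nprod !big_seq1 big_nil mulr1 scale1r.
- by rewrite /nsum /nprod !big_seq1 big_nil mul1r scale1r.
- by rewrite /nsum big_nil.
- by rewrite /nsum /nprod !big_seq1 !big_nil mul1r scale1r.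
- by rewrite nsum_add IHe IHf.
- by rewrite nsum_scale IHe scaleN1r.
- by rewrite nsum_mul IHe IHf.
- by rewrite nsum_scale IHe.
Qed.

Lemma neqnP m n : neqn m n -> m = n.
Proof. by elim: m n => [|m IH] [|n] //= /IH ->. Qed.

Lemma neqsP s t : neqs s t -> s = t.
Proof.
by elim: s t => [|x s IH] [|y t] //=; case: ifP => // /neqnP -> /IH ->.
Qed.

Lemma nsum_insert c m s :
  nsum (ninsert c m s) = c *: (nprod l m.1 * nprod r m.2) + nsum s.
Proof.
elim: s => [|[c' m'] s IH] /=; first by rewrite /nsum big_seq1 big_nil addr0.
case: ifP => [|_]; last first.
  by rewrite /nsum !big_cons -!/(nsum _) IH addrCA.
case: ifP => // /neqsP e1 /neqsP e2; rewrite /nsum !big_cons /= addrA.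
by rewrite e1 e2 scalerDl.
Qed.

Lemma nsum_collect s : nsum (ncollect s) = nsum s.
Proof.
elim: s => [|[c m] s IH] //=.
by rewrite nsum_insert IH /nsum big_cons.
Qed.

Lemma nsum_zero s : nzero s -> nsum s = 0.
Proof.
elim: s => [|[c m] s IH] /=; first by rewrite /nsum big_nil.
rewrite /nsum big_cons -/(nsum _); case: s IH => [_ ->|y s IH [-> /IH ->]].
  by rewrite /nsum big_nil scale0r addr0.
by rewrite scale0r addr0.
Qed.

Lemma neval_eq e f :
  nzero (ncollect (nnorm (NAdd e (NOpp f)))) -> neval e = neval f.
Proof.
move=> /nsum_zero; rewrite nsum_collect -nnormP /= => /eqP.
by rewrite subr_eq0 => /eqP.
Qed.

End NormalForm.

Ltac nca_find x s k :=
  lazymatch s with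
  | cons ?y ?s' =>
    match goal with
    | _ => let _ := match goal with _ => constr_eq x y end in constr:(Some k)
    | _ => nca_find x s' (S k)
    end
  | _ => constr:(@None nat)
  end.

Ltac nca_snoc s x :=
  lazymatch s with
  | cons ?y ?s' => let t := nca_snoc s' x in constr:(cons y t)
  | @nil ?T => constr:(@cons T x (@nil T))
  end.

(** In continuation-passing style, because the list [r] of right atoms grows while the expression is
    read: an unknown term becomes a new right atom. *)
Ltac nca_reify K l r e k :=
  lazymatch e with
  | @GRing.add _ ?x ?y =>
    nca_reify K l r x ltac:(fun r1 ex =>
      nca_reify K l r1 y ltac:(fun r2 ey => k r2 (@NAdd K ex ey)))
  | @GRing.opp _ ?x => nca_reify K l r x ltac:(fun r1 ex => k r1 (@NOpp K ex))
  | @GRing.mul _ ?x ?y =>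
    nca_reify K l r x ltac:(fun r1 ex =>
      nca_reify K l r1 y ltac:(fun r2 ey => k r2 (@NMul K ex ey)))
  | @GRing.scale _ _ ?c ?x =>
    nca_reify K l r x ltac:(fun r1 ex => k r1 (@NScale K c ex))
  | @GRing.one _ => k r (@N1 K)
  | @GRing.zero _ => k r (@N0 K)
  | ?x =>
    let o := nca_find x l O in
    lazymatch o with
    | Some ?n => k r (@NL K n)
    | None =>
      let o' := nca_find x r O in
      lazymatch o' with
      | Some ?n => k r (@NR K n)
      | None =>
        let r' := nca_snoc r x in
        let o'' := nca_find x r' O in
        lazymatch o'' with Some ?n => k r' (@NR K n) end
      end
    end
  end.

(* [l] is the list of the left atoms; their commutation with the other atoms
   is looked up in the context. *)
Ltac nca K l :=
  rewrite /cbr /abr ?expr2;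
  lazymatch goal with
  | |- @eq ?A ?x ?y =>
    nca_reify K l (@nil A) x ltac:(fun r1 ex =>
    nca_reify K l r1 y ltac:(fun r2 ey =>
      refine (@neval_eq K _ l r2 _ ex ey _)));
    cbv [nzero ncollect nnorm ninsert neqs neqn nscale nmul nadd nmul1 napp
         ncommute ncommute1 fst snd]; do ?split; try assumption
  end.

(** * Formal power series *)

Section Series.
Variables (K : fieldType) (A : algType K).

(** A separate name for the function type: it keeps the pointwise module structure but receives the
    Cauchy product instead of the pointwise one. *)
Definition ser := nat -> A.
HB.instance Definition _ := GRing.Lmodule.copy ser (nat -> A).

Implicit Types f g h : ser.

Definition smul f g : ser := series_mul f g.

(** Coefficient n of a product depends only on truncations, so associativity can be borrowed from
    polynomials. *)
Lemma smul_poly N f g n : (n < N)%N ->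
  smul f g n = ((\poly_(k < N) f k) * (\poly_(k < N) g k))`_n.
Proof.
move=> nN; rewrite coefM; apply: eq_bigr => k _; rewrite !coef_poly.
by rewrite (leq_ltn_trans _ nN) ?leq_ord // (leq_ltn_trans _ nN) ?leq_subr.
Qed.

Lemma coefM_eq (p p' q q' : {poly A}) n :
  (forall k, (k <= n)%N -> p`_k = p'`_k) ->
  (forall k, (k <= n)%N -> q`_k = q'`_k) -> (p * q)`_n = (p' * q')`_n.
Proof.
move=> pp' qq'; rewrite !coefM; apply: eq_bigr => k _.
by rewrite pp' ?leq_ord // qq' ?leq_subr.
Qed.

Fact smulA : associative smul.
Proof.
move=> f g h; apply/funext => n.
rewrite !(@smul_poly n.+1) //; pose F := \poly_(k < n.+1) f k.
pose G := \poly_(k < n.+1) g k; pose H := \poly_(k < n.+1) h k.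
transitivity ((F * (G * H))`_n).
  apply: coefM_eq => // k kn; rewrite coef_poly ltnS kn.
  exact: smul_poly.
rewrite mulrA; apply: coefM_eq => // k kn; rewrite coef_poly ltnS kn.
by rewrite -smul_poly.
Qed.

Definition scst (x : A) : ser := fun n => if n is 0 then x else 0.

Lemma smul_scst x f n : smul (scst x) f n = x * f n.
Proof.
rewrite /smul /series_mul big_ord_recl subn0 big1 ?addr0 // => k _.
by rewrite mul0r.
Qed.

Lemma smulr_scst x f n : smul f (scst x) n = f n * x.
Proof.
rewrite /smul /series_mul big_ord_recr /= subnn big1 ?add0r // => k _.
by rewrite -(@subnSK k n) ?mulr0 //= ltn_ord.
Qed.

Fact smul1 : left_id (scst 1) smul.
Proof. by move=> f; apply/funext => n; rewrite smul_scst mul1r. Qed.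
Fact smulr1 : right_id (scst 1) smul.
Proof. by move=> f; apply/funext => n; rewrite smulr_scst mulr1. Qed.
Fact smulDl : left_distributive smul +%R.
Proof.
move=> f g h; apply/funext => n.
rewrite -[RHS]/(smul f h n + smul g h n) -big_split; apply: eq_bigr => k _.
exact: mulrDl.
Qed.
Fact smulDr : right_distributive smul +%R.
Proof.
move=> f g h; apply/funext => n.
rewrite -[RHS]/(smul f g n + smul f h n) -big_split; apply: eq_bigr => k _.
exact: mulrDr.
Qed.
Fact sone_neq0 : scst 1 != 0 :> ser.
Proof. by apply/eqP => /(congr1 (fun f => f 0%N)) /eqP; rewrite oner_eq0. Qed.
HB.instance Definition _ := GRing.Zmodule_isNzRing.Build ser
  smulA smul1 smulr1 smulDl smulDr sone_neq0.

Fact sscaleAl (c : K) f g : c *: (f * g) = c *: f * g.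
Proof.
apply/funext => n; rewrite -[LHS]/(c *: smul f g n) scaler_sumr.
by apply: eq_bigr => k _; rewrite scalerAl.
Qed.
HB.instance Definition _ := GRing.Lmodule_isLalgebra.Build K ser sscaleAl.
Fact sscaleAr (c : K) f g : c *: (f * g) = f * (c *: g).
Proof.
apply/funext => n; rewrite -[LHS]/(c *: smul f g n) scaler_sumr.
by apply: eq_bigr => k _; rewrite scalerAr.
Qed.
HB.instance Definition _ := GRing.Lalgebra_isAlgebra.Build K ser sscaleAr.

Lemma serD f g n : (f + g) n = f n + g n. Proof. by []. Qed.
Lemma serN f n : (- f) n = - f n. Proof. by []. Qed.
Lemma serB f g n : (f - g) n = f n - g n. Proof. by []. Qed.
Lemma serZ c f n : (c *: f) n = c *: f n. Proof. by []. Qed.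
Lemma ser0 n : (0 : ser) n = 0. Proof. by []. Qed.
Lemma serM f g n : (f * g) n = \sum_(k < n.+1) f k * g (n - k)%N.
Proof. by []. Qed.
Lemma ser1 : 1 = scst 1 :> ser. Proof. by []. Qed.
Lemma scstMn x f n : (scst x * f) n = x * f n. Proof. exact: smul_scst. Qed.
Lemma mulscstn x f n : (f * scst x) n = f n * x. Proof. exact: smulr_scst. Qed.

(* multiplication by u^-1 *)
Definition sh f : ser := fun n => if n is k.+1 then f k else 0.

Lemma sh_linear : linear sh.
Proof. by move=> c f g; apply/funext => -[|n] //=; rewrite !serD serZ scaler0 addr0. Qed.
HB.instance Definition _ := GRing.isLinear.Build K ser ser _ sh sh_linear.

Lemma shD f g : sh (f + g) = sh f + sh g. Proof. exact: linearD. Qed.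
Lemma shB f g : sh (f - g) = sh f - sh g. Proof. exact: linearB. Qed.
Lemma shN f : sh (- f) = - sh f. Proof. exact: linearN. Qed.
Lemma shZ c f : sh (c *: f) = c *: sh f. Proof. exact: linearZ. Qed.

Lemma shMl f g : sh f * g = sh (f * g).
Proof.
apply/funext => -[|n]; rewrite !serM big_ord_recl mul0r add0r ?big_ord0 //.
Qed.

Lemma shMr f g : f * sh g = sh (f * g).
Proof.
apply/funext => -[|n]; rewrite !serM; first by rewrite big_ord1 mulr0.
rewrite big_ord_recr /= subnn mulr0 addr0.
by apply: eq_bigr => k _; rewrite subSn // -ltnS.
Qed.

Lemma ser_cbr f g n : cbr f g n = \sum_(k < n.+1) cbr (f k) (g (n - k)%N).
Proof.
rewrite /cbr serB !serM sumrB; congr (_ - _).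
rewrite [LHS](reindex_inj rev_ord_inj) /=; apply: eq_bigr => k _.
by rewrite subSS subKn // -ltnS.
Qed.

Lemma sh_cbrl f g : cbr (sh f) g = sh (cbr f g).
Proof. by rewrite /cbr linearB shMl shMr. Qed.
Lemma sh_cbrr f g : cbr f (sh g) = sh (cbr f g).
Proof. by rewrite /cbr linearB shMl shMr. Qed.
Lemma sh_abrl f g : abr (sh f) g = sh (abr f g).
Proof. by rewrite /abr linearD shMl shMr. Qed.
Lemma sh_abrr f g : abr f (sh g) = sh (abr f g).
Proof. by rewrite /abr linearD shMl shMr. Qed.

Lemma scst_linear : linear scst.
Proof. by move=> c x y; apply/funext => -[|n] //; rewrite serD serZ scaler0 addr0. Qed.
HB.instance Definition _ := GRing.isLinear.Build K A ser _ scst scst_linear.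

Lemma scstD x y : scst (x + y) = scst x + scst y. Proof. exact: linearD. Qed.
Lemma scstB x y : scst (x - y) = scst x - scst y. Proof. exact: linearB. Qed.
Lemma scstZ c x : scst (c *: x) = c *: scst x. Proof. exact: linearZ. Qed.

Lemma scstM x y : scst (x * y) = scst x * scst y.
Proof. by apply/funext => -[|n]; rewrite scstMn //= mulr0. Qed.

Lemma scst_cbr x y : scst (cbr x y) = cbr (scst x) (scst y).
Proof. by rewrite /cbr linearB /= !scstM. Qed.

Lemma ser_comm f g : (forall k l, f k * g l = g l * f k) -> f * g = g * f.
Proof.
move=> fg; apply/funext => n; rewrite !serM (reindex_inj rev_ord_inj) /=.
by apply: eq_bigr => k _; rewrite fg subSS subKn // -ltnS.
Qed.

Lemma ser_cbr_scst f x n : cbr f (scst x) n = cbr (f n) x.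
Proof. by rewrite /cbr serB mulscstn scstMn. Qed.
Lemma scst_ser_cbr f x n : cbr (scst x) f n = cbr x (f n).
Proof. by rewrite /cbr serB mulscstn scstMn. Qed.
Lemma ser_abr_scst f x n : abr f (scst x) n = abr (f n) x.
Proof. by rewrite /abr serD mulscstn scstMn. Qed.
(** Each use of the recursion trades s for s+1 and lowers the coefficient index by one. This proves
    identities between families of series indexed by s, applied to the difference of the two
    sides. *)
Lemma sh_rec0 (e : nat -> ser) c :
  (forall s, e s = c *: sh (e s.+1)) -> forall s, e s = 0.
Proof.
move=> eE s; apply/funext => n; elim: n s => [|n IH] s; rewrite eE serZ /=.
  exact: scaler0.
by rewrite IH ser0 scaler0.
Qed.

End Series.


(** * Linear classes of elements and of coefficients *)

Section LinearClasses.
Variables (K : fieldType) (A : algType K).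
Implicit Types (P Q R : A -> Prop) (f g : ser A).

Definition lin P := P 0 /\ forall c x y, P x -> P y -> P (c *: x + y).

Lemma linp0 P : lin P -> P 0. Proof. by case. Qed.
Lemma linpD P x y : lin P -> P x -> P y -> P (x + y).
Proof. by case=> _ lP Px Py; rewrite -[x]scale1r; apply: lP. Qed.
Lemma linpZ P c x : lin P -> P x -> P (c *: x).
Proof. by case=> P0 lP Px; rewrite -[_ *: _]addr0; apply: lP. Qed.
Lemma linpN P x : lin P -> P x -> P (- x).
Proof. by move=> lP Px; rewrite -scaleN1r; apply: linpZ. Qed.
Lemma linpB P x y : lin P -> P x -> P y -> P (x - y).
Proof. by move=> lP Px Py; apply: linpD => //; apply: linpN. Qed.
Lemma linp_sum P (J : Type) (r : seq J) (D : pred J) (F : J -> A) : lin P ->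
  (forall j, D j -> P (F j)) -> P (\sum_(j <- r | D j) F j).
Proof.
by move=> lP PF; elim/big_ind: _ => // [|x y Px Py]; [apply: linp0|apply: linpD].
Qed.

Definition cf P f := forall n, P (f n).

Lemma cfD P f g : lin P -> cf P f -> cf P g -> cf P (f + g).
Proof. by move=> lP Pf Pg n; apply: linpD. Qed.
Lemma cfZ P c f : lin P -> cf P f -> cf P (c *: f).
Proof. by move=> lP Pf n; apply: linpZ. Qed.
Lemma cfB P f g : lin P -> cf P f -> cf P g -> cf P (f - g).
Proof. by move=> lP Pf Pg n; apply: linpB. Qed.
Lemma cf_scst P x : lin P -> P x -> cf P (scst x).
Proof. by move=> lP Px [|n] //; apply: linp0. Qed.
Lemma cf_sub P Q f : (forall x, P x -> Q x) -> cf P f -> cf Q f.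
Proof. by move=> PQ Pf n; apply: PQ. Qed.

Lemma cfM P Q R f g : lin R -> (forall x y, P x -> Q y -> R (x * y)) ->
  cf P f -> cf Q g -> cf R (f * g).
Proof. by move=> lR PQ Pf Qg n; apply: linp_sum => // k _; apply: PQ. Qed.

Lemma cf_cbr P Q R f g : lin R -> (forall x y, P x -> Q y -> R (x * y)) ->
  (forall x y, P x -> Q y -> R (y * x)) ->
  cf P f -> cf Q g -> cf R (cbr f g).
Proof.
move=> lR PQ QP Pf Qg; apply: cfB => //; first exact: cfM PQ Pf Qg.
by apply: (cfM lR _ Qg Pf) => x y Qx Py; apply: QP.
Qed.

Lemma cf_abr P Q R f g : lin R -> (forall x y, P x -> Q y -> R (x * y)) ->
  (forall x y, P x -> Q y -> R (y * x)) ->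
  cf P f -> cf Q g -> cf R (abr f g).
Proof.
move=> lR PQ QP Pf Qg; apply: cfD => //; first exact: cfM PQ Pf Qg.
by apply: (cfM lR _ Qg Pf) => x y Qx Py; apply: QP.
Qed.

End LinearClasses.

(** * The rank one computation *)

Section RankOne.
Variables (K : fieldType) (T : algType K) (d : K).
Hypotheses (two_neq0 : 2 != 0 :> K) (d_neq0 : d != 0).
Variables xi p m : nat -> T.
Hypothesis xi_xi : forall r s, cbr (xi r) (xi s) = 0.
Hypothesis xi0_p : forall s, cbr (xi 0) (p s) = (2 * d) *: p s.
Hypothesis xi0_m : forall s, cbr (xi 0) (m s) = (2 * - d) *: m s.
Hypothesis p_m : forall r s, cbr (p r) (m s) = xi (r + s).
Hypothesis xi_p : forall r s,
  cbr (xi r.+1) (p s) - cbr (xi r) (p s.+1) = d *: abr (xi r) (p s).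
Hypothesis xi_m : forall r s,
  cbr (xi r.+1) (m s) - cbr (xi r) (m s.+1) = (- d) *: abr (xi r) (m s).
Hypothesis m_m : forall r s,
  cbr (m r.+1) (m s) - cbr (m r) (m s.+1) = (- d) *: abr (m r) (m s).

Local Notation S := (ser T).
Local Ltac nc := nca K (@nil T).
Local Ltac ncS := nca K (@nil (ser T)).

(* [XI] is xi(u), [XM] is xi(-u), [gen q] is the sum of the q_r u^{-r-1}, and
   [alt q s] is the sum of the q_{s+r} (-u)^{-r-1}. *)
Definition XI : S := fun n => if n is r.+1 then xi r else 1.
Definition XM : S := series_opp XI.
Definition gen (q : nat -> T) : S := fun n => if n is r.+1 then q r else 0.
Definition alt (q : nat -> T) (s : nat) : S :=
  fun n => if n is r.+1 then (-1) ^+ r.+1 *: q (s + r)%N else 0.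

Lemma altE q s : alt q s = - sh (scst (q s) + alt q s.+1).
Proof.
apply/funext => -[|[|n]]; rewrite serN /= ?oppr0 // serD /=.
  by rewrite expr1 scaleN1r addn0 addr0.
by rewrite add0r addSnnS exprS -scalerA scaleN1r.
Qed.

(** The relation between xi_{i,r+1} and q_s, written for all r at once at -u. Here and below e is d
    for x^+ and -d for x^-, which treats both signs together. The bracket with xi_0 is needed only
    for the coefficient of u^-1. *)
Lemma XM_rec e q s : cbr (xi 0) (q s) = (2 * e) *: q s ->
  (forall r, cbr (xi r.+1) (q s) - cbr (xi r) (q s.+1) = e *: abr (xi r) (q s)) ->
  cbr XM (scst (q s)) = - sh (cbr XM (scst (q s.+1)) + e *: abr XM (scst (q s))).
Proof.
move=> xi0 xir; apply/funext => -[|[|n]];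
  rewrite serN ser_cbr_scst /= ?serD ?serZ ?ser_cbr_scst ?ser_abr_scst.
- by rewrite /XM /series_opp /= expr0 scale1r /cbr mul1r mulr1 subrr oppr0.
- rewrite /XM /series_opp /= expr0 expr1 scale1r.
  have -> : cbr (-1 *: xi 0) (q s) = - cbr (xi 0) (q s) by nc; ring.
  by rewrite xi0; nc; ring.
rewrite /XM /series_opp /= !exprS; set u := _ ^+ n.
have -> : cbr ((-1 * (-1 * u)) *: xi n.+1) (q s) = u *: cbr (xi n.+1) (q s).
  by nc; ring.
by rewrite -[cbr (xi n.+1) _](subrK (cbr (xi n) (q s.+1))) xir; nc; ring.
Qed.

(** By [XM_rec] and [altE], the difference of the two sides is -u^-1 times the same difference at
    s+1. *)
Lemma XM_alt e q : (forall s, cbr (xi 0) (q s) = (2 * e) *: q s) ->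
  (forall r s, cbr (xi r.+1) (q s) - cbr (xi r) (q s.+1) = e *: abr (xi r) (q s)) ->
  forall s, cbr XM (scst (q s)) = e *: abr XM (alt q s).
Proof.
move=> xi0 xir s; apply/eqP; rewrite -subr_eq0; apply/eqP; move: s.
apply: (@sh_rec0 _ _ (fun s => cbr XM (scst (q s)) - e *: abr XM (alt q s)) (-1)).
move=> s; rewrite (XM_rec (xi0 s) (xir^~ s)) altE.
rewrite -!(shN, shZ) sh_abrr -!(shN, shZ) -!shD; congr sh.
by ncS; ring.
Qed.

Lemma XM_p s : cbr XM (scst (p s)) = d *: abr XM (alt p s).
Proof. exact: XM_alt xi0_p xi_p s. Qed.

Definition Dd s (y : S) : S := cbr y (scst (m s)) + d *: abr (alt m s) y.

Lemma Dd_XM s : Dd s XM = 0.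
Proof.
by rewrite /Dd (XM_alt xi0_m xi_m) scaleNr [X in - _ + _ *: X]addrC addNr.
Qed.

Lemma alt_m_rec r s :
  cbr (alt m r) (scst (m s)) = - sh (cbr (scst (m r)) (scst (m s)) +
    cbr (alt m r) (scst (m s.+1)) - d *: abr (alt m r) (scst (m s))).
Proof.
apply/funext => -[|[|n]];
  rewrite serN ser_cbr_scst /= ?serD ?serN ?serZ ?ser_cbr_scst ?ser_abr_scst /=.
- by nc; ring.
- by rewrite addn0 expr1; nc; ring.
rewrite addnS !exprS; set u := _ ^+ n.
have -> : cbr ((-1 * (-1 * u)) *: m (r + n).+1) (m s) =
          u *: cbr (m (r + n).+1) (m s) by nc; ring.
by rewrite -[cbr (m _.+1) _](subrK (cbr (m (r + n)) (m s.+1))) m_m; nc; ring.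
Qed.

Lemma alt_m_m r s : Dd s (alt m r) = cbr (scst (m r)) (alt m s).
Proof.
apply/eqP; rewrite -subr_eq0; apply/eqP; move: s.
apply: (@sh_rec0 _ _ (fun s => Dd s (alt m r) - cbr (scst (m r)) (alt m s)) (-1)).
move=> s; rewrite /Dd alt_m_rec [alt m s]altE.
rewrite -!(shN, shZ) sh_abrl sh_cbrr -!(shN, shZ) -!shD; congr sh.
by ncS; ring.
Qed.

Local Notation Z := (alt m 0).
Local Notation m0 := (scst (m 0)).
Local Notation p0 := (scst (p 0)).
Local Notation PU := (gen p).
Local Notation PM := (alt p 0).

Lemma Z_m0 : cbr Z m0 + d *: (Z * Z) = 0.
Proof.
(* For r = s = 0 the bracket of Z and m_0 occurs on both sides with opposite signs, and {Z, Z} = 2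
   Z^2: everything is doubled. *)
have /eqP := alt_m_m 0 0; rewrite -subr_eq0 => /eqP e.
have : 2 *: (cbr Z m0 + d *: (Z * Z)) = 0 by rewrite -[RHS]e /Dd; ncS; ring.
by move/eqP; rewrite scaler_eq0 (negPf two_neq0) => /eqP.
Qed.

Lemma p0_Z : cbr p0 Z = XM - 1.
Proof.
apply/funext => -[|n]; rewrite scst_ser_cbr serB /XM /series_opp /=.
  by rewrite /cbr mulr0 mul0r subrr expr0 scale1r subrr.
by rewrite add0n subr0 -[in RHS](add0n n) -p_m; nc; ring.
Qed.

Lemma PU_m0 : cbr PU m0 = XI - 1.
Proof.
apply/funext => -[|n]; rewrite ser_cbr_scst serB /=.
  by rewrite /cbr mulr0 mul0r !subrr.
by rewrite subr0 p_m addn0.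
Qed.

Lemma PM_m0 : cbr PM m0 = XM - 1.
Proof.
apply/funext => -[|n]; rewrite ser_cbr_scst serB /XM /series_opp /=.
  by rewrite /cbr mulr0 mul0r subrr expr0 scale1r subrr.
by have <- : cbr (p n) (m 0) = xi n; [rewrite p_m addn0|rewrite add0n subr0; nc; ring].
Qed.

Lemma xi_comm r s : xi r * xi s = xi s * xi r.
Proof. exact/subr0_eq/xi_xi. Qed.

Lemma xi_XM r n : xi r * XM n = XM n * xi r.
Proof.
rewrite /XM /series_opp -scalerAl -scalerAr; congr (_ *: _).
by case: n => [|n] /=; rewrite ?mulr1 ?mul1r // xi_comm.
Qed.

Lemma XI_XM : XI * XM = XM * XI.
Proof.
apply: ser_comm => -[|k] l /=; first by rewrite mul1r mulr1.
exact: xi_XM.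
Qed.

Lemma cbr_XM (f g : S) :
  (forall k l, exists c r, cbr (f k) (g l) = c *: xi r) ->
  cbr XM (cbr f g) = 0.
Proof.
move=> fg; apply/eqP; rewrite subr_eq0; apply/eqP/esym/ser_comm => k l.
rewrite ser_cbr mulr_suml mulr_sumr; apply: eq_bigr => j _.
case: (fg j (k - j)%N) => c [r ->].
by rewrite -[LHS]scalerAl -[RHS]scalerAr xi_XM.
Qed.

(** [Dd 0] fails to be a derivation on the anticommutator {P, XM} only by a multiple of [XM,
    [P, Z]]. For P = x^+(u) or x^+(-u) the coefficients of [P, Z] are combinations of the xi_{i,r},
    so this defect vanishes; the symmetrized products are chosen for that reason. *)
Lemma Dd_half (P Q : S) : cbr P m0 = Q - 1 -> cbr XM (cbr P Z) = 0 ->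
  Q * XM = XM * Q -> Dd 0 (2^-1 *: abr P XM) = Q * XM - XM.
Proof.
move=> Pm PZ QX.
have -> : Dd 0 (2^-1 *: abr P XM) = 2^-1 *: abr (cbr P m0) XM
    + 2^-1 *: abr P (Dd 0 XM) + (2^-1 * d) *: cbr XM (cbr P Z).
  by rewrite /Dd; ncS; field.
rewrite Dd_XM PZ Pm scaler0 addr0.
have -> : abr P 0 = 0 by rewrite /abr mulr0 mul0r addr0.
rewrite scaler0 addr0 /abr mulrBl mulrBr -QX mul1r mulr1.
by ncS; field.
Qed.

Definition Xs : S := 2^-1 *: abr PU XM.
Definition Vs : S := 2^-1 *: abr PM XM.

Lemma cbr0l (A : pzRingType) (x : A) : cbr 0 x = 0.
Proof. by rewrite /cbr mulr0 mul0r subrr. Qed.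
Lemma cbr0r (A : pzRingType) (x : A) : cbr x 0 = 0.
Proof. by rewrite /cbr mulr0 mul0r subrr. Qed.

Lemma Dd_Xs : Dd 0 Xs = XI * XM - XM.
Proof.
apply: Dd_half PU_m0 _ XI_XM; apply: cbr_XM => -[|k] [|l] /=;
  try by exists 0, 0%N; rewrite scale0r ?cbr0l ?cbr0r.
exists ((-1) ^+ l.+1), (k + l)%N; rewrite -p_m add0n.
by nc; ring.
Qed.

Lemma Dd_Vs : Dd 0 Vs = XM * XM - XM.
Proof.
apply: Dd_half PM_m0 _ (erefl _); apply: cbr_XM => -[|k] [|l] /=;
  try by exists 0, 0%N; rewrite scale0r ?cbr0l ?cbr0r.
exists ((-1) ^+ k.+1 * (-1) ^+ l.+1), (k + l)%N; rewrite -p_m !add0n.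
by nc; ring.
Qed.

(** Applied to the left copies and to root vectors in which alpha_i does not occur. *)
Lemma Dd_mull s (f y : S) : f * scst (m s) = scst (m s) * f ->
  f * alt m s = alt m s * f -> Dd s (f * y) = f * Dd s y.
Proof.
move=> f1 f2; rewrite /Dd.
have -> : cbr (f * y) (scst (m s)) + d *: abr (alt m s) (f * y) =
  f * (cbr y (scst (m s)) + d *: abr (alt m s) y) +
  (f * scst (m s) - scst (m s) * f) * y - d *: ((f * alt m s - alt m s * f) * y).
  by ncS; ring.
by rewrite f1 f2 !subrr mul0r scaler0 addr0 subr0.
Qed.

Lemma Dd_mulr s (f y : S) : f * scst (m s) = scst (m s) * f ->
  f * alt m s = alt m s * f -> Dd s (y * f) = Dd s y * f.
Proof.
move=> f1 f2; rewrite /Dd.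
have -> : cbr (y * f) (scst (m s)) + d *: abr (alt m s) (y * f) =
  (cbr y (scst (m s)) + d *: abr (alt m s) y) * f +
  y * (f * scst (m s) - scst (m s) * f) + d *: (y * (f * alt m s - alt m s * f)).
  by ncS; ring.
by rewrite f1 f2 !subrr mulr0 scaler0 !addr0.
Qed.

Lemma Dd_linear s : linear (Dd s).
Proof. by move=> c x y; rewrite /Dd; ncS; ring. Qed.
HB.instance Definition _ s := GRing.isLinear.Build K S S _ (Dd s) (Dd_linear s).

Lemma DdD s x y : Dd s (x + y) = Dd s x + Dd s y. Proof. exact: linearD. Qed.
Lemma DdB s x y : Dd s (x - y) = Dd s x - Dd s y. Proof. exact: linearB. Qed.
Lemma DdZ s c x : Dd s (c *: x) = c *: Dd s x. Proof. exact: linearZ. Qed.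

Lemma Dd0 s : Dd s 0 = 0. Proof. exact: linear0. Qed.

Definition Hp : T := 2 *: xi 1 - xi 0 ^+ 2.

(** The square xi_0^2 contributes -{xi_0, [xi_0, q_s]} = -2 e {xi_0, q_s}. This cancels the
    anticommutator coming from twice the relation for xi_1, so only a shift of the index remains. *)
Lemma Hp_gen e q s : (forall s, cbr (xi 0) (q s) = (2 * e) *: q s) ->
  (forall r s, cbr (xi r.+1) (q s) - cbr (xi r) (q s.+1) = e *: abr (xi r) (q s)) ->
  cbr Hp (q s) = (4 * e) *: q s.+1.
Proof.
move=> xi0 xir; rewrite /Hp.
have -> : cbr (2 *: xi 1 - xi 0 ^+ 2) (q s) =
    2 *: (cbr (xi 1) (q s) - cbr (xi 0) (q s.+1)) + 2 *: cbr (xi 0) (q s.+1)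
    - abr (xi 0) (cbr (xi 0) (q s)) by nc; ring.
by rewrite xir !xi0; nc; ring.
Qed.

Lemma Hp_p s : cbr Hp (p s) = (4 * d) *: p s.+1.
Proof. exact: Hp_gen xi0_p xi_p. Qed.

Lemma Hp_m s : cbr Hp (m s) = - (4 * d) *: m s.+1.
Proof. by rewrite (Hp_gen _ xi0_m xi_m) mulrN. Qed.

Lemma Hp_xi s : cbr Hp (xi s) = 0.
Proof.
have -> : cbr Hp (xi s) = 2 *: cbr (xi 1) (xi s) - abr (xi 0) (cbr (xi 0) (xi s)).
  by rewrite /Hp; nc; ring.
by rewrite !xi_xi /abr mulr0 mul0r addr0 scaler0 subr0.
Qed.


(** * The perturbed recursion *)

(* [L] and [a k] are the left copies of h_{i,1} and b_{i,k}, [bb k] is the image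
   of b_{i,k}, and [Th] gathers the terms of h_{i,1} which come from the positive
   roots other than alpha_i. *)
Variables (L Th : T) (a bb : nat -> T).
Hypothesis L_xi : forall r, L * xi r = xi r * L.
Hypothesis L_p : forall r, L * p r = p r * L.
Hypothesis L_m : forall r, L * m r = m r * L.
Hypothesis a_xi : forall k r, a k * xi r = xi r * a k.
Hypothesis a_p : forall k r, a k * p r = p r * a k.
Hypothesis a_m : forall k r, a k * m r = m r * a k.
Hypothesis L_a : forall k, cbr L (a k) = (4 * d) *: a k.+1.

Local Notation AU := (gen a).
Local Notation BU := (gen bb).
Local Notation a0 := (scst (a 0)).

(* the left copy of h_i(u) *)
Definition HL : S := 1 + d *: (AU * AU) - cbr AU a0.
Hypothesis L_HL : forall n, cbr L (HL n) = 0.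

(* [HH] is the image of h_{i,1}; [Theta] is its part of positive right degree,
   divided by 4 d. *)
Definition Theta : T := 2^-1 *: (p 0 * p 0) + a 0 * p 0 + Th.
Definition HH : T := L + Hp + (4 * d) *: Theta.
Hypothesis bb0 : bb 0 = a 0 + p 0 - m 0.
Hypothesis HH_bb : forall n, cbr HH (bb n) = (4 * d) *: bb n.+1.

(** The division by 4 d makes this derivation a pure shift of indices: p_s to p_{s+1}, a_k to
    a_{k+1}, m_s to -m_{s+1}, while xi_s goes to 0. *)
Definition D0 (y : S) : S := (4 * d)^-1 *: cbr (scst (L + Hp)) y.

Lemma four_neq0 : 4 != 0 :> K.
Proof. by rewrite (_ : 4 = 2 * 2) ?mulf_neq0 // -natrM. Qed.

Lemma four_d_neq0 : 4 * d != 0.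
Proof. by rewrite mulf_neq0 ?four_neq0. Qed.

Local Ltac fld := field; rewrite ?d_neq0 ?four_neq0 ?two_neq0 //.

Lemma D0_linear : linear D0.
Proof. by move=> c x y; rewrite /D0; ncS; ring. Qed.
HB.instance Definition _ := GRing.isLinear.Build K S S _ D0 D0_linear.

Lemma D0M x y : D0 (x * y) = D0 x * y + x * D0 y.
Proof. by rewrite /D0; ncS; ring. Qed.

Lemma D0D x y : D0 (x + y) = D0 x + D0 y. Proof. exact: linearD. Qed.
Lemma D0B x y : D0 (x - y) = D0 x - D0 y. Proof. exact: linearB. Qed.
Lemma D0Z c x : D0 (c *: x) = c *: D0 x. Proof. exact: linearZ. Qed.

Lemma D0_abr x y : D0 (abr x y) = abr (D0 x) y + abr x (D0 y).
Proof. by rewrite /abr D0D !D0M; ncS; ring. Qed.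

Lemma D0_n y n : D0 y n = (4 * d)^-1 *: cbr (L + Hp) (y n).
Proof. by rewrite /D0 serZ scst_ser_cbr. Qed.

Lemma ad_m s : cbr (L + Hp) (m s) = - (4 * d) *: m s.+1.
Proof.
have <- : cbr Hp (m s) = - (4 * d) *: m s.+1 by exact: Hp_m.
by rewrite /cbr mulrDl mulrDr L_m opprD addrACA subrr add0r.
Qed.

Lemma ad_p s : cbr (L + Hp) (p s) = (4 * d) *: p s.+1.
Proof.
have <- : cbr Hp (p s) = (4 * d) *: p s.+1 by exact: Hp_p.
by rewrite /cbr mulrDl mulrDr L_p opprD addrACA subrr add0r.
Qed.

Lemma ad_xi s : cbr (L + Hp) (xi s) = 0.
Proof.
have <- : cbr Hp (xi s) = 0 by exact: Hp_xi.
by rewrite /cbr mulrDl mulrDr L_xi opprD addrACA subrr add0r.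
Qed.

Lemma a_Hp k : a k * Hp = Hp * a k.
Proof.
have e0 := a_xi k 0; have e1 := a_xi k 1; rewrite /Hp.
by nca K [:: a k]; ring.
Qed.

Lemma ad_a k : cbr (L + Hp) (a k) = (4 * d) *: a k.+1.
Proof. by rewrite -L_a /cbr mulrDl mulrDr a_Hp opprD addrACA subrr addr0. Qed.

Lemma D0_alt_m s : D0 (alt m s) = - alt m s.+1.
Proof.
apply/funext => -[|n]; rewrite D0_n serN /=.
  by rewrite cbr0r scaler0 oppr0.
have := ad_m (s + n); rewrite -addSn => e.
have -> : cbr (L + Hp) ((-1) ^+ n.+1 *: m (s + n)%N) =
          (-1) ^+ n.+1 *: cbr (L + Hp) (m (s + n)%N) by nc; ring.
by rewrite e; nc; fld.
Qed.

Lemma D0_PM : D0 PM = alt p 1.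
Proof.
apply/funext => -[|n]; rewrite D0_n /=; first by rewrite cbr0r scaler0.
have := ad_p n; rewrite add0n add1n => e.
have -> : cbr (L + Hp) ((-1) ^+ n.+1 *: p n) =
          (-1) ^+ n.+1 *: cbr (L + Hp) (p n) by nc; ring.
by rewrite e; nc; fld.
Qed.

Lemma gen_rec (q : nat -> T) :
  (forall n, cbr (L + Hp) (q n) = (4 * d) *: q n.+1) ->
  gen q = sh (scst (q 0) + D0 (gen q)).
Proof.
move=> qE; apply/funext => -[|[|n]] //=; rewrite serD D0_n /=.
  by rewrite cbr0r scaler0 addr0.
by rewrite qE scalerA mulVf ?four_d_neq0 // scale1r add0r.
Qed.

Lemma PU_rec : PU = sh (scst (p 0) + D0 PU).
Proof. exact/gen_rec/ad_p. Qed.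

Lemma AU_rec : AU = sh (scst (a 0) + D0 AU).
Proof. exact/gen_rec/ad_a. Qed.

Lemma PM_rec : PM = - sh (scst (p 0) + D0 PM).
Proof. by rewrite D0_PM -altE. Qed.

Lemma Z_rec : Z = sh (D0 Z - m0).
Proof. by rewrite D0_alt_m -opprD addrC shN -altE. Qed.

Lemma D0_XM : D0 XM = 0.
Proof.
apply/funext => n; rewrite D0_n ser0 /XM /series_opp.
have -> : cbr (L + Hp) ((-1) ^+ n *: XI n) = (-1) ^+ n *: cbr (L + Hp) (XI n).
  by nc; ring.
case: n => [|n] /=; last by rewrite ad_xi !scaler0.
by rewrite /cbr mulr1 mul1r subrr !scaler0.
Qed.

Lemma AU_comm (g : S) : (forall k n, a k * g n = g n * a k) -> AU * g = g * AU.
Proof.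
by move=> ag; apply: ser_comm => -[|k] l /=; rewrite ?mul0r ?mulr0.
Qed.

Lemma a0_comm (g : S) : (forall k n, a k * g n = g n * a k) ->
  scst (a 0) * g = g * scst (a 0).
Proof.
by move=> ag; apply: ser_comm => -[|k] l /=; rewrite ?mul0r ?mulr0.
Qed.

Lemma a_XM k n : a k * XM n = XM n * a k.
Proof.
rewrite /XM /series_opp -[LHS]scalerAr -[RHS]scalerAl; congr (_ *: _).
by case: n => [|n] /=; rewrite ?mulr1 ?mul1r.
Qed.

Lemma a_XI k n : a k * XI n = XI n * a k.
Proof. by case: n => [|n] /=; rewrite ?mulr1 ?mul1r. Qed.

Lemma a_alt (q : nat -> T) s : (forall k r, a k * q r = q r * a k) ->
  forall k n, a k * alt q s n = alt q s n * a k.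
Proof.
move=> aq k [|n] /=; first by rewrite mul0r mulr0.
by rewrite -[LHS]scalerAr -[RHS]scalerAl aq.
Qed.

Lemma a_scst (q : nat -> T) s : (forall k r, a k * q r = q r * a k) ->
  forall k n, a k * scst (q s) n = scst (q s) n * a k.
Proof. by move=> aq k [|n] /=; rewrite ?mul0r ?mulr0. Qed.

Lemma D0_HL : D0 HL = 0.
Proof.
apply/funext => n; rewrite D0_n.
have -> : cbr (L + Hp) (HL n) = cbr L (HL n) + cbr Hp (HL n) by nc; ring.
suff -> : cbr Hp (HL n) = 0 by rewrite L_HL addr0 scaler0.
rewrite -scst_ser_cbr; have eA : AU * scst Hp = scst Hp * AU.
  by apply: AU_comm => k [|l] /=; rewrite ?mulr0 ?mul0r ?a_Hp.
have ea : a0 * scst Hp = scst Hp * a0.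
  by apply: a0_comm => k [|l] /=; rewrite ?mulr0 ?mul0r ?a_Hp.
suff -> : cbr (scst Hp) HL = 0 by [].
by rewrite /HL; nca K [:: AU; a0]; ring.
Qed.

(* the component of right degree alpha_i of the image of b_i(u) *)
Definition beta1 : S := HL * Xs - d *: (AU * AU * Vs).

Lemma abr0 (x : S) : abr x 0 = 0.
Proof. by rewrite /abr mulr0 mul0r addr0. Qed.
Lemma Xs_rec : Xs = sh (D0 Xs + 2^-1 *: abr p0 XM).
Proof.
rewrite {1}/Xs {1}PU_rec sh_abrl -shZ; congr sh.
rewrite /Xs D0Z D0_abr D0_XM abr0 addr0.
by ncS; ring.
Qed.

Lemma Vs_rec : Vs = - sh (D0 Vs + 2^-1 *: abr XM p0).
Proof.
rewrite {1}/Vs {1}PM_rec -!shN sh_abrl -shZ; congr sh.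
rewrite /Vs D0Z D0_abr D0_XM abr0 addr0.
by ncS; ring.
Qed.

(** The origin of the two coefficients in [beta1]. Among the inhomogeneous terms, those with d AU^2
    cancel between [HL] and the V-term. By 2 d V = [XM, p_0], what remains besides {p_0, XM} / 2 is
    -[AU, a_0] {p_0, XM} / 2 - {a_0, AU} [XM, p_0] / 2, which equals [a_0 p_0, AU XM]. *)
Lemma beta1_rec : beta1 = sh (D0 beta1 + 2^-1 *: abr p0 XM
  + cbr (scst (a 0 * p 0)) (AU * XM)).
Proof.
have X1 : HL * Xs = sh (D0 (HL * Xs) + HL * (2^-1 *: abr p0 XM)).
  by rewrite {1}Xs_rec shMr mulrDr D0M D0_HL mul0r add0r.
have A1 x : AU * x = sh (a0 * x + D0 AU * x).
  by rewrite {1}AU_rec shMl mulrDl.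
have A2 : AU * AU = sh (AU * a0 + AU * D0 AU).
  by rewrite {2}AU_rec shMr mulrDr.
have A3 : AU * AU * Vs = - sh (AU * AU * D0 Vs + AU * AU * (2^-1 *: abr XM p0)).
  by rewrite {1}Vs_rec mulrN shMr mulrDr.
(* The recursions of the two factors [AU] carry a plus sign and that of [Vs] a minus sign. The
   product is therefore written as its first expansion plus its second minus its third, so that the
   derivative terms add up by the Leibniz rule. *)
have AAV : AU * AU * Vs = sh (D0 (AU * AU * Vs) + (a0 * AU + AU * a0) * Vs
   + AU * AU * (2^-1 *: abr XM p0)).
  have e1 : AU * AU * Vs = sh ((a0 * AU + D0 AU * AU) * Vs).
    by rewrite {1}A1 shMl.
  have e2 : AU * AU * Vs = sh ((AU * a0 + AU * D0 AU) * Vs).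
    by rewrite {1}A2 shMl.
  transitivity (sh ((a0 * AU + D0 AU * AU) * Vs)
      + sh ((AU * a0 + AU * D0 AU) * Vs)
      + sh (AU * AU * D0 Vs + AU * AU * (2^-1 *: abr XM p0))).
    by rewrite -e1 -e2 -[sh (_ + _)]opprK -A3 addrK.
  rewrite -!shD; congr sh.
  by rewrite !D0M; ncS; field.
rewrite /beta1 {1}X1 {1}AAV -shZ -shB; congr sh.
rewrite D0B D0Z.
have dV : (2 * d) *: Vs = cbr XM p0.
  by rewrite XM_p /Vs; ncS; field.
have -> : D0 (HL * Xs) + HL * (2^-1 *: abr p0 XM) -
    d *: (D0 (AU * AU * Vs) + (a0 * AU + AU * a0) * Vs +
          AU * AU * (2^-1 *: abr XM p0)) =
    D0 (HL * Xs) - d *: D0 (AU * AU * Vs) + (HL * (2^-1 *: abr p0 XM)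
    - (a0 * AU + AU * a0) * (2^-1 *: ((2 * d) *: Vs))
    - d *: (AU * AU * (2^-1 *: abr XM p0))).
  by ncS; field.
rewrite dV scstM -[RHS]addrA; congr (_ + _); rewrite /HL.
have := a0_comm (a_scst 0 a_p); have := a0_comm a_XM.
have := AU_comm (a_scst 0 a_p); have := AU_comm a_XM => h1 h2 h3 h4.
by nca K [:: AU; a0]; field.
Qed.

Definition err : S := BU - Z - AU * XM - beta1.

(** What is left of the bracket of [Theta] with the explicit terms once [p_0^2 / 2 + a_0 p_0, Z] and
    [a_0 p_0, AU XM] have been absorbed by the recursions of those terms. *)
Definition src : S := cbr (scst Th) (Z + AU * XM)
  + cbr (scst (2^-1 *: (p 0 * p 0))) (AU * XM) + cbr (scst Theta) beta1.

Lemma BU_rec : BU = sh (scst (bb 0) + D0 BU + cbr (scst Theta) BU).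
Proof.
apply/funext => -[|[|n]] //=; rewrite !serD D0_n scst_ser_cbr /=.
  by rewrite !cbr0r scaler0 !addr0.
rewrite add0r; apply: (scalerI four_d_neq0).
by rewrite -HH_bb /HH; nc; fld.
Qed.

Lemma err_rec : err = sh (D0 err + cbr (scst Theta) err + src).
Proof.
have AX : AU * XM = sh (D0 (AU * XM) + a0 * XM).
  by rewrite D0M D0_XM mulr0 addr0 addrC -mulrDl -shMl -AU_rec.
rewrite {1}/err {1}BU_rec {1}Z_rec {1}AX {1}beta1_rec -!shB; congr sh.
rewrite /err !D0B bb0 scstB scstD.
have a0Z : cbr a0 Z = 0 by rewrite /cbr (a0_comm (a_alt 0 a_m)) subrr.
(* By [p_0, Z] = XM - 1, bracketing Z with the alpha_i-part of [Theta] supplies the inhomogeneous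
   terms of [AU * XM] and [beta1], while -a_0 and -p_0 cancel the summands of b_{i,0}. *)
have key : cbr (2^-1 *: (p0 * p0) + a0 * p0) Z
    - (2^-1 *: abr p0 XM - p0 + a0 * XM - a0) = 0.
  have -> : cbr (2^-1 *: (p0 * p0) + a0 * p0) Z =
      2^-1 *: abr p0 (cbr p0 Z) + a0 * cbr p0 Z + cbr a0 Z * p0.
    by ncS; field.
  by rewrite p0_Z a0Z mul0r addr0; ncS; field.
rewrite /src /Theta !scstD !scstZ !scstM.
apply/eqP; rewrite -subr_eq0 -key; apply/eqP.
by ncS; field.
Qed.


(** The class is arbitrary because two instances are needed: right degrees in Q_+, and the part of
    the nonnegative subalgebra with degrees in alpha_i + Q_+. *)
Lemma err_in (N : T -> Prop) : lin N -> cf N src ->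
  (forall x, N x -> N (cbr HH x)) -> cf N err.
Proof.
move=> lN Nsrc NHH; elim=> [|n IH]; rewrite err_rec; first exact: linp0.
rewrite /= !serD D0_n scst_ser_cbr.
have -> : (4 * d)^-1 *: cbr (L + Hp) (err n) + cbr Theta (err n) =
   (4 * d)^-1 *: cbr HH (err n) by rewrite /HH; nc; fld.
by apply: linpD => //; apply: linpZ => //; apply: NHH.
Qed.

Lemma AU0 : (forall k, a k = 0) -> AU = 0.
Proof. by move=> a0'; apply/funext => -[|n] //=; rewrite a0'. Qed.

Lemma HL0 : (forall k, a k = 0) -> HL = 1.
Proof. by move/AU0; rewrite /HL => ->; rewrite mul0r scaler0 cbr0l subr0 addr0. Qed.

Lemma beta10 : (forall k, a k = 0) -> beta1 = Xs.
Proof.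
move=> a0'; rewrite /beta1 HL0 // AU0 // mul1r.
by rewrite !mul0r scaler0 subr0.
Qed.

Lemma err0 : (forall k, a k = 0) -> err = BU - Z - Xs.
Proof. by move=> a0'; rewrite /err beta10 // AU0 // mul0r subr0. Qed.

Lemma src0 : (forall k, a k = 0) ->
  src = cbr (scst Th) Z + cbr (scst (2^-1 *: (p 0 * p 0) + Th)) Xs.
Proof.
move=> a0'; rewrite /src beta10 // /Theta a0' AU0 //.
by rewrite !mul0r !addr0 cbr0r addr0.
Qed.

(* The classes of elements whose degree in the right factor lies in
   {0} u Q_+, Q_+, alpha_i + ({0} u Q_+) and alpha_i + Q_+. *)
Variables M0 M Mi M1 : T -> Prop.
Hypotheses (lM0 : lin M0) (lM : lin M) (lMi : lin Mi) (lM1 : lin M1).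
Hypothesis M_M0 : forall x, M x -> M0 x.
Hypothesis Mi_M : forall x, Mi x -> M x.
Hypothesis M1_Mi : forall x, M1 x -> Mi x.
Hypothesis M0M0 : forall x y, M0 x -> M0 y -> M0 (x * y).
Hypothesis M0M : forall x y, M0 x -> M y -> M (x * y).
Hypothesis MM0 : forall x y, M x -> M0 y -> M (x * y).
Hypothesis M0Mi : forall x y, M0 x -> Mi y -> Mi (x * y).
Hypothesis MiM0 : forall x y, Mi x -> M0 y -> Mi (x * y).
Hypothesis M0M1 : forall x y, M0 x -> M1 y -> M1 (x * y).
Hypothesis M1M0 : forall x y, M1 x -> M0 y -> M1 (x * y).
Hypothesis MMi : forall x y, M x -> Mi y -> M1 (x * y).
Hypothesis MiM : forall x y, Mi x -> M y -> M1 (x * y).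
Hypothesis M0_1 : M0 1.
Hypothesis M0_xi : forall r, M0 (xi r).
Hypothesis M0_a : forall k, M0 (a k).
Hypothesis M0_L : M0 L.
Hypothesis Mi_p : forall r, Mi (p r).
Hypothesis Mi_m : forall x s, Mi x -> M0 (x * m s).
Hypothesis m_Mi : forall x s, Mi x -> M0 (m s * x).
Hypothesis M1_m : forall x s, M1 x -> M (x * m s).
Hypothesis m_M1 : forall x s, M1 x -> M (m s * x).

Lemma M1_M x : M1 x -> M x. Proof. by move/M1_Mi/Mi_M. Qed.
Lemma Mi_M0 x : Mi x -> M0 x. Proof. by move/Mi_M/M_M0. Qed.

Lemma cf_XM : cf M0 XM.
Proof. by move=> [|n]; apply: linpZ => //=. Qed.
Lemma cf_gen P q : lin P -> (forall n, P (q n)) -> cf P (gen q).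
Proof. by move=> lP Pq [|n] //=; apply: linp0. Qed.
Lemma cf_alt P q s : lin P -> (forall n, P (q n)) -> cf P (alt q s).
Proof. by move=> lP Pq [|n] /=; [apply: linp0|apply: linpZ]. Qed.
Lemma cf_AU : cf M0 AU. Proof. exact: cf_gen. Qed.
Lemma cf_AX : cf M0 (AU * XM). Proof. exact: (cfM lM0 M0M0 cf_AU cf_XM). Qed.

Lemma cf_Xs : cf Mi Xs.
Proof.
apply: cfZ => //; apply: (@cf_abr _ _ Mi M0) => //; last exact: cf_XM.
  by move=> x y Mx My; apply: M0Mi.
exact: cf_gen.
Qed.

Lemma cf_Vs : cf Mi Vs.
Proof.
apply: cfZ => //; apply: (@cf_abr _ _ Mi M0) => //; last exact: cf_XM.
  by move=> x y Mx My; apply: M0Mi.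
exact: cf_alt.
Qed.

Lemma cf_HL : cf M0 HL.
Proof.
have MA := cf_AU; have Ma : cf M0 a0 by apply: cf_scst.
apply: cfB; rewrite // ?ser1; last first.
  by apply: (cf_cbr lM0 M0M0 _ MA Ma) => x y Mx My; apply: M0M0.
by apply: cfD; [by []|exact: cf_scst|apply: cfZ => //; exact: (cfM lM0 M0M0 MA MA)].
Qed.

Lemma cf_beta1 : cf Mi beta1.
Proof.
apply: cfB => //; first exact: (cfM lMi M0Mi cf_HL cf_Xs).
by apply: cfZ => //; apply: (cfM lMi M0Mi _ cf_Vs); apply: (cfM lM0 M0M0 cf_AU cf_AU).
Qed.

Hypothesis M_Th : M Th.
Hypothesis Th_m : forall s, M (cbr Th (m s)).
Hypothesis Dd_Th : forall s, cf M (Dd s (cbr (scst Th) (Z + AU * XM))).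

Lemma M_Theta : M Theta.
Proof.
apply: linpD => //; apply: linpD => //.
  by apply: linpZ => //; apply/Mi_M/MiM0 => //; apply: Mi_M0.
by apply/Mi_M/M0Mi.
Qed.

Lemma cbrM0 x y : M0 x -> M y -> M (cbr x y).
Proof. by move=> Mx My; apply: linpB; [|apply: M0M|apply: MM0]. Qed.

Lemma M0_Hp : M0 Hp.
Proof. by apply: linpB => //; [apply: linpZ|rewrite expr2; apply: M0M0]. Qed.

Lemma M0_LHp : M0 (L + Hp).
Proof. by apply: linpD => //; apply: M0_Hp. Qed.

Lemma M0_HH : M0 HH.
Proof.
by apply: linpD; [|apply: M0_LHp|apply: linpZ => //; apply/M_M0/M_Theta].
Qed.

Lemma cf_ThZ : cf M (cbr (scst Th) Z).
Proof.
move=> [|n]; rewrite scst_ser_cbr /=; first by rewrite cbr0r; apply: linp0.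
have -> : cbr Th ((-1) ^+ n.+1 *: m n) = (-1) ^+ n.+1 *: cbr Th (m n).
  by nc; ring.
exact: linpZ.
Qed.

Lemma M1_p2 : M1 (2^-1 *: (p 0 * p 0)).
Proof. by apply: linpZ => //; apply: MiM => //; apply: Mi_M. Qed.

Lemma cf_src2 : cf M1 (cbr (scst (2^-1 *: (p 0 * p 0))) (AU * XM)).
Proof.
apply: (@cf_cbr _ _ M1 M0) => //; last exact: cf_AX.
  by move=> x y Mx My; apply: M0M1.
by apply: cf_scst => //; apply: M1_p2.
Qed.

Lemma cf_src3 : cf M1 (cbr (scst Theta) beta1).
Proof.
apply: (@cf_cbr _ _ M Mi) => //; last exact: cf_beta1.
  by move=> x y Mx My; apply: MiM.
by apply: cf_scst => //; apply: M_Theta.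
Qed.

Lemma cf_src : cf M src.
Proof.
apply: cfD => //; last exact: (cf_sub M1_M cf_src3).
apply: cfD => //; last exact: (cf_sub M1_M cf_src2).
rewrite (_ : cbr _ _ = cbr (scst Th) Z + cbr (scst Th) (AU * XM)); last by ncS; ring.
apply: cfD => //; first exact: cf_ThZ.
apply: (@cf_cbr _ _ M M0) => //; last exact: cf_AX.
  by move=> x y Mx My; apply: M0M.
exact: cf_scst.
Qed.

Lemma cf_err : cf M err.
Proof.
apply: (err_in lM cf_src) => x Mx; by apply: cbrM0 => //; apply: M0_HH.
Qed.

(** Every term of [Dd s] has exactly one factor m, so degrees drop by alpha_i only once. *)
Lemma cf_Dd s f : cf M1 f -> cf M (Dd s f).
Proof.
move=> Mf n; rewrite /Dd serD ser_cbr_scst serZ; apply: linpD => //.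
  by apply: linpB => //; [apply: M1_m|apply: m_M1].
apply: linpZ => //; apply: linpD => //; apply: linp_sum => // k _.
  (* The predecessor is the index of m in a nonzero coefficient of [alt m s]; coefficient 0 vanishes
     and is treated apart. *)
  have : M (m (s + (k.-1))%N * f (n - k)%N) by apply: m_M1.
  by case: (k : nat) => [|j] /=; rewrite ?mul0r -?scalerAl => *; [apply: linp0|apply: linpZ].
have : M (f k * m (s + (n - k).-1)%N) by apply: M1_m.
by case: (n - k)%N => [|j] /=; rewrite ?mulr0 -?scalerAr => *; [apply: linp0|apply: linpZ].
Qed.

Lemma cf_Dd_src s : cf M (Dd s src).
Proof.
rewrite /src 2!DdD; apply: cfD => //; last exact: (cf_Dd _ cf_src3).
by apply: cfD => //; exact: (cf_Dd _ cf_src2).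
Qed.

(** Degree 0 occurs, since [a_0 p_0, m_s] = a_0 xi_s. This suffices because the bracket is only
    multiplied by [err], whose degrees lie in Q_+. *)
Lemma M0_Theta_m s : M0 (cbr Theta (m s)).
Proof.
have -> : cbr Theta (m s) =
  cbr (2^-1 *: (p 0 * p 0) + a 0 * p 0) (m s) + cbr Th (m s).
  by rewrite /Theta; nc; ring.
have Mi1 : Mi (2^-1 *: (p 0 * p 0) + a 0 * p 0).
  by apply: linpD => //; [apply/M1_Mi/M1_p2|apply: M0Mi].
by apply: linpD => //; [apply: linpB => //; [apply: Mi_m|apply: m_Mi]|apply: M_M0].
Qed.

Lemma D0_m s : D0 (scst (m s)) = - scst (m s.+1).
Proof.
apply/funext => -[|n]; rewrite D0_n serN /=; last by rewrite cbr0r scaler0 oppr0.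
by rewrite ad_m; nc; fld.
Qed.

(** [D0] replaces m_s by -m_{s+1}, whence the term at [s.+1]. The last two terms measure the failure
    of [Dd s] to commute with the bracket by [Theta]. *)
Lemma Dd_err_rec s : Dd s err = sh (D0 (Dd s err) + cbr (scst Theta) (Dd s err)
  + Dd s src + Dd s.+1 err - (cbr err (cbr (scst Theta) (scst (m s)))
  + d *: abr (cbr (scst Theta) (alt m s)) err)).
Proof.
have DE : D0 (Dd s err) = Dd s (D0 err) - Dd s.+1 err.
  rewrite {1}/Dd D0D D0Z D0_abr D0_alt_m.
  have -> : D0 (cbr err (scst (m s))) =
      cbr (D0 err) (scst (m s)) + cbr err (D0 (scst (m s))).
    by rewrite /D0; ncS; ring.
  by rewrite D0_m /Dd; ncS; ring.
rewrite {1}err_rec {1}/Dd sh_cbrl sh_abrr -shZ -shD -/(Dd s _); congr sh.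
by rewrite DE /Dd; ncS; ring.
Qed.

Lemma cf_Dd_err s : cf M (Dd s err).
Proof.
move=> n; elim: n s => [|n IH] s; rewrite Dd_err_rec /=; first exact: linp0.
rewrite !serD serN !serD D0_n scst_ser_cbr serZ.
apply: linpD => //; last first.
  apply: linpN => //; apply: linpD => //; last first.
    apply: linpZ => //; apply: (@cf_abr _ _ M0 M) => //; last exact: cf_err.
      by move=> x y Mx My; apply: MM0.
    move=> [|k]; rewrite scst_ser_cbr /=; first by rewrite cbr0r; apply: linp0.
    have -> : cbr Theta ((-1) ^+ k.+1 *: m (s + k)%N) =
              (-1) ^+ k.+1 *: cbr Theta (m (s + k)%N) by nc; ring.
    by apply: linpZ => //; apply: M0_Theta_m.
  rewrite -scst_cbr ser_cbr_scst; apply: linpB => //.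
    by apply: MM0; [apply: cf_err|apply: M0_Theta_m].
  by apply: M0M; [apply: M0_Theta_m|apply: cf_err].
apply: linpD => //; apply: linpD => //; last exact: cf_Dd_src.
apply: linpD => //.
  by apply: linpZ => //; apply: cbrM0 => //; apply: M0_LHp.
by apply: cbrM0 => //; apply/M_M0/M_Theta.
Qed.

Lemma Dd_AU s y : Dd s (AU * y) = AU * Dd s y.
Proof.
by apply: Dd_mull; apply: AU_comm; [apply: a_scst|apply: a_alt].
Qed.

Lemma Dd_a0 s y : Dd s (a0 * y) = a0 * Dd s y.
Proof.
by apply: Dd_mull; apply: a0_comm; [apply: a_scst|apply: a_alt].
Qed.

Lemma Dd_HL s x : Dd s (HL * x) = HL * Dd s x.
Proof.
have HLE y : HL * y = y + d *: (AU * (AU * y)) - (AU * (a0 * y) - a0 * (AU * y)).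
  by rewrite /HL; ncS; ring.
by rewrite !HLE DdB DdD DdZ [Dd _ (_ - _)]DdB !(Dd_AU, Dd_a0).
Qed.

Lemma Dd_beta1 :
  Dd 0 beta1 = HL * (XI * XM - XM) - d *: (AU * AU * (XM * XM - XM)).
Proof.
by rewrite /beta1 DdB DdZ -[AU * AU * Vs]mulrA !Dd_AU Dd_Vs mulrA Dd_HL Dd_Xs.
Qed.

(* the image of h_i(u) *)
Definition FU : S := 1 + d *: (BU * BU) - cbr BU (scst (bb 0)).

Theorem FU_mod : cf M (FU - HL * (XI * XM)).
Proof.
set B := AU * XM + (beta1 + err).
have BUE : BU = Z + B by rewrite /B /err; ncS; ring.
have a0Z : cbr Z a0 = 0 by rewrite /cbr (a0_comm (a_alt 0 a_m)) subrr.
have a0X : cbr XM a0 = 0 by rewrite /cbr (a0_comm a_XM) subrr.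
(* Z alone contributes 1 by [Z_m0], the bracket [p_0, Z] contributes XM - 1, and the terms in which
   B meets Z or m_0 form [Dd 0 B]. *)
have FE : FU = XM + Dd 0 B + d *: (B * B) - cbr B (a0 + p0).
  rewrite /FU BUE bb0 scstB scstD.
  have -> : 1 + d *: ((Z + B) * (Z + B)) - cbr (Z + B) (a0 + p0 - m0) =
    1 + (cbr Z m0 + d *: (Z * Z)) - cbr Z a0 + cbr p0 Z
     + Dd 0 B + d *: (B * B) - cbr B (a0 + p0) by rewrite /Dd; ncS; ring.
  by rewrite Z_m0 p0_Z a0Z addr0 subr0 [1 + _]addrC subrK.
(* The term -d AU^2 XM^2 coming from V cancels d (AU XM)^2. The remaining XM + d AU^2 XM - [AU, a_0]
   XM is HL XM, which completes HL (XI XM - XM). *)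
have pure : XM + HL * (XI * XM - XM) - d *: (AU * AU * (XM * XM - XM))
   + d *: ((AU * XM) * (AU * XM)) - cbr (AU * XM) a0 = HL * (XI * XM).
  have := AU_comm a_XM; have := AU_comm a_XI; have := a0_comm a_XM.
  have := a0_comm a_XI => h1 h2 h3 h4; rewrite /HL.
  by nca K [:: AU; a0]; ring.
have -> : FU - HL * (XI * XM) = Dd 0 err + d *: ((beta1 + err) * B
    + (AU * XM) * (beta1 + err)) - cbr (beta1 + err) (a0 + p0) - cbr (AU * XM) p0.
  have -> : FU = XM + HL * (XI * XM - XM) - d *: (AU * AU * (XM * XM - XM))
      + Dd 0 err + d *: (B * B) - cbr B (a0 + p0).
    rewrite FE /B 2!DdD Dd_beta1 Dd_AU Dd_XM.
    by rewrite mulr0 add0r -!addrA.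
  by rewrite -pure /B; ncS; ring.
have MbE : cf M (beta1 + err).
  by apply: cfD => //; [apply: (cf_sub Mi_M cf_beta1)|apply: cf_err].
have MB : cf M0 B by apply: cfD => //; [apply: cf_AX|apply: (cf_sub M_M0 MbE)].
have Mp0 : cf M p0 by apply: cf_scst => //; apply: Mi_M.
apply: cfB => //; last first.
  apply: (@cf_cbr _ _ M0 M) => //; last exact: cf_AX.
  by move=> x y Mx My; apply: MM0.
apply: cfB => //; last first.
  apply: (@cf_cbr _ _ M M0) => //; first by move=> x y Mx My; apply: M0M.
  by apply: cfD => //; [apply: cf_scst|apply: (cf_sub M_M0 Mp0)].
apply: cfD; [by []|exact: cf_Dd_err|apply: cfZ => //].
by apply: cfD => //; [apply: (cfM lM MM0 MbE MB)|apply: (cfM lM M0M cf_AX MbE)].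
Qed.

Theorem BU_mod : cf M (BU - Z - AU * XM).
Proof.
rewrite (_ : _ - _ = err + beta1); last by rewrite /err subrK.
by apply: cfD => //; [apply: cf_err|apply: (cf_sub Mi_M cf_beta1)].
Qed.


(* what the contribution of one root to [Th] has to satisfy *)
Definition root_ok (t : T) := [/\ M t, forall s, M (cbr t (m s)) &
  forall s, cf M (Dd s (cbr (scst t) (Z + AU * XM)))].

Lemma lin_root_ok : lin root_ok.
Proof.
split=> [|c x y [Mx mx Dx] [My my Dy]].
  split=> [|s|s]; rewrite ?cbr0l; try exact: linp0.
  have -> : scst (0 : T) = 0 by apply/funext => -[|n].
  by rewrite cbr0l Dd0 => n; apply: linp0.
split=> [|s|s].
- by apply: linpD => //; apply: linpZ.
- have -> : cbr (c *: x + y) (m s) = c *: cbr x (m s) + cbr y (m s) by nc; ring.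
  by apply: linpD => //; apply: linpZ.
have -> : cbr (scst (c *: x + y)) (Z + AU * XM) =
   c *: cbr (scst x) (Z + AU * XM) + cbr (scst y) (Z + AU * XM).
  by rewrite scstD scstZ; ncS; ring.
by rewrite DdD DdZ; apply: cfD => //; apply: cfZ.
Qed.

Lemma scst_comm_gen x (g : S) : (forall n, x * g n = g n * x) ->
  scst x * g = g * scst x.
Proof. by move=> xg; apply: ser_comm => -[|k] l //=; rewrite mul0r mulr0. Qed.

Lemma scst_comm_m x s : (forall r, x * m r = m r * x) ->
  scst x * scst (m s) = scst (m s) * scst x.
Proof. by move=> xm; rewrite -!scstM xm. Qed.

Lemma scst_comm_alt x s : (forall r, x * m r = m r * x) ->
  scst x * alt m s = alt m s * scst x.
Proof.
move=> xm; apply: scst_comm_gen => -[|n] /=; first by rewrite mul0r mulr0.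
by rewrite -[LHS]scalerAr -[RHS]scalerAl xm.
Qed.

Lemma Dd_AX s : Dd s (AU * XM) = 0.
Proof. by rewrite Dd_AU Dd_XM mulr0. Qed.

(** The case of a root without alpha_i. The element commutes with every m_r, so its bracket with Z
    vanishes, and [Dd s] passes through it to [AU * XM], which it kills. *)
Lemma root_ok_comm (E w : T) : M E -> M0 w ->
  (forall r, w * m r = m r * w) -> (forall r, E * m r = m r * E) ->
  root_ok (E * E + 2 *: (w * E)).
Proof.
move=> ME Mw wm Em; set t := E * E + _.
have tm r : t * m r = m r * t.
  have h1 := Em r; have h2 := wm r; rewrite /t.
  rewrite mulrDl mulrDr -scalerAl -scalerAr -!mulrA h1 [E * (m r * E)]mulrA h1.
  by rewrite [w * (m r * E)]mulrA h2 !mulrA.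
split=> [|s|s].
- apply: linpD => //; first by apply: MM0 => //; apply: M_M0.
  by apply: linpZ => //; apply: M0M.
- by rewrite /cbr tm subrr; apply: linp0.
have -> : cbr (scst t) (Z + AU * XM) = scst t * (AU * XM) - (AU * XM) * scst t.
  have h : scst t * Z = Z * scst t by apply: scst_comm_alt.
  by rewrite /cbr mulrDr mulrDl h opprD addrACA subrr add0r.
rewrite DdB Dd_mull; [|exact: scst_comm_m|exact: scst_comm_alt].
rewrite Dd_AX mulr0 sub0r.
rewrite Dd_mulr; [|exact: scst_comm_m|exact: scst_comm_alt].
by rewrite Dd_AX mul0r oppr0 => n; apply: linp0.
Qed.

(** The case of a root other than alpha_i in which alpha_i occurs. All terms of the expanded bracket
    have right degree in alpha_i + Q_+ and fall under [cf_Dd], except 2 w [E, Z], where [E, Z] is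
    only known to have degrees in Q_+; the last hypothesis serves that term. *)
Lemma root_ok_gt (E w : T) : M1 E -> M0 w ->
  (forall r, w * m r = m r * w) -> (forall s, M (cbr E (m s))) ->
  (forall s, cf M (Dd s (cbr (scst E) Z))) -> root_ok (E * E + 2 *: (w * E)).
Proof.
move=> M1E Mw wm Em DE; have ME := M1_M M1E; have M0E := M_M0 ME.
have M1t : M1 (E * E + 2 *: (w * E)).
  by apply: linpD; [|apply: M1M0|apply: linpZ => //; apply: M0M1].
split=> [|s|s]; first exact: M1_M.
- have -> : cbr (E * E + 2 *: (w * E)) (m s) = E * cbr E (m s) + cbr E (m s) * E
     + 2 *: (w * cbr E (m s)).
    (* The commutation of w and m_s is fed in by adding the zero term 2 (w m_s - m_s w) E. *)
    rewrite -[RHS]addr0 -[X in _ = _ + X](scaler0 _ 2) -(mul0r E).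
    by rewrite -(subrr (m s * w)) -{1}(wm s); nc; ring.
  apply: linpD => //; first by apply: linpD => //; [apply: M0M|apply: MM0].
  by apply: linpZ => //; apply: M0M.
have -> : cbr (scst (E * E + 2 *: (w * E))) (Z + AU * XM) =
    abr (scst E) (cbr (scst E) Z)
    + cbr (scst (E * E + 2 *: (w * E))) (AU * XM)
    + 2 *: (scst w * cbr (scst E) Z).
  have h : scst w * Z = Z * scst w by apply: scst_comm_alt.
  rewrite scstD scstZ !scstM.
  have -> : cbr (scst E * scst E + 2 *: (scst w * scst E)) (Z + AU * XM) =
    abr (scst E) (cbr (scst E) Z)
    + cbr (scst E * scst E + 2 *: (scst w * scst E)) (AU * XM)
    + 2 *: (scst w * cbr (scst E) Z)
    + 2 *: ((scst w * Z - Z * scst w) * scst E) by ncS; ring.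
  by rewrite h subrr mul0r scaler0 addr0.
rewrite DdD DdZ Dd_mull; [|exact: scst_comm_m|exact: scst_comm_alt].
have M1cE : cf M1 (scst E) by apply: cf_scst.
have MEZ : cf M (cbr (scst E) Z).
  move=> [|n]; rewrite scst_ser_cbr /=; first by rewrite cbr0r; apply: linp0.
  have -> : cbr E ((-1) ^+ n.+1 *: m n) = (-1) ^+ n.+1 *: cbr E (m n) by nc; ring.
  exact: linpZ.
apply: cfD => //; last first.
  apply: cfZ => //; apply: (cfM lM M0M _ (DE s)); exact: cf_scst.
apply: cf_Dd; apply: cfD => //.
  apply: (cf_abr lM1 _ _ M1cE MEZ) => x y M1x My.
    by apply: MiM => //; apply: M1_Mi.
  by apply: MMi => //; apply: M1_Mi.
apply: (cf_cbr lM1 _ _ (cf_scst lM1 M1t) cf_AX) => x y Mx My.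
  exact: M1M0.
exact: M0M1.
Qed.

End RankOne.

(** * The triangular decomposition of the Lie algebra *)

Lemma lspan_mono (K : fieldType) (V : lmodType K) (P Q : V -> Prop) x :
  (forall y, P y -> lspan Q y) -> lspan P x -> lspan Q x.
Proof.
move=> PQ; elim=> [|c y z Py _ IH]; first exact: lspan0.
by apply: lspanD => //; apply/lspanZ/PQ.
Qed.

Lemma lspan_sum (K : fieldType) (V : lmodType K) (P : V -> Prop) (J : Type)
  (r : seq J) (D : pred J) (F : J -> V) :
  (forall j, D j -> lspan P (F j)) -> lspan P (\sum_(j <- r | D j) F j).
Proof.
by move=> PF; elim/big_ind: _ => // [|x y Px Py]; [apply: lspan0|apply: lspanD].
Qed.

(** A subspace of maximal dimension among those contained in the span must be all of it. Subspaces
    are needed because [chev_generate] quantifies over them. *)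
Lemma lspan_vspace (K : fieldType) (V : vectType K) (P : V -> Prop) :
  exists U : {vspace V}, forall x, x \in U <-> lspan P x.
Proof.
pose B n := `[< exists U : {vspace V}, \dim U = n /\ forall x, x \in U -> lspan P x >].
have exB : exists n, B n.
  exists 0%N; apply/asboolP; exists 0%VS; split=> [|x]; first exact: dimv0.
  by rewrite memv0 => /eqP ->; apply: lspan0.
have ubB n : B n -> (n <= \dim (fullv : {vspace V}))%N.
  by move=> /asboolP [U [<- _]]; apply/dimvS/subvf.
case: (ex_maxnP exB ubB) => n /asboolP [U [dU UP]] maxU.
exists U => x; split=> [|Px]; first exact: UP.
have : \dim (U + <[x]>) = \dim U.
  apply/eqP; rewrite eqn_leq (dimvS (addvSl _ _)) andbT dU; apply: maxU.
  apply/asboolP; exists (U + <[x]>)%VS; split=> // y /memv_addP [u Uu [v]].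
  by move=> /vlineP [c ->] ->; apply: lspanD; [apply: UP|apply: lspanZ].
move=> e; have : (U == U + <[x]>)%VS by rewrite eqEdim addvSl e leqnn.
by move/eqP ->; apply: (subvP (addvSr _ _)); apply: memv_line.
Qed.

Section LieBracket.
Variables (K : fieldType) (g : lieAlgebra K).
Implicit Types x y z : g.
Local Notation br := (@lie_br K g).

Lemma brDl x y z : br (x + y) z = br x z + br y z.
Proof. exact: (linD _ _ (@lie_br_linear_l K g z)). Qed.
Lemma brDr x y z : br z (x + y) = br z x + br z y.
Proof. exact: (linD _ _ (@lie_br_linear_r K g z)). Qed.
Lemma brZl c x z : br (c *: x) z = c *: br x z.
Proof. exact: (linZ _ _ (@lie_br_linear_l K g z)). Qed.
Lemma brZr c x z : br z (c *: x) = c *: br z x.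
Proof. exact: (linZ _ _ (@lie_br_linear_r K g z)). Qed.
Lemma br0l z : br 0 z = 0.
Proof. exact: (lin0 (@lie_br_linear_l K g z)). Qed.
Lemma br0r z : br z 0 = 0.
Proof. exact: (lin0 (@lie_br_linear_r K g z)). Qed.
Lemma brNl x z : br (- x) z = - br x z.
Proof. by rewrite -scaleN1r brZl scaleN1r. Qed.
Lemma brNr x z : br z (- x) = - br z x.
Proof. by rewrite -scaleN1r brZr scaleN1r. Qed.
Lemma brC x y : br x y = - br y x.
Proof.
apply/eqP; rewrite -subr_eq0 opprK; apply/eqP.
by have := lie_br_alt (x + y); rewrite brDl !brDr !lie_br_alt addr0 add0r.
Qed.
Lemma brA x y z : br x (br y z) = br (br x y) z + br y (br x z).
Proof.
have := lie_jacobi x y z; rewrite (brC z x) brNr (brC z) => /eqP.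
by rewrite -addrA addr_eq0 opprD !opprK addrC => /eqP.
Qed.

End LieBracket.

Section Roots.
Variables (K : fieldType) (g : lieAlgebra K) (I : finType).
Hypothesis char0 : forall n : nat, n.+1%:R != 0 :> K.
Variable D : chevalleyData g I.
Hypothesis chev_comm : forall i j : I, i != j ->
  lie_br (chev D false i) (chev D true j) = 0.

Local Notation br := (@lie_br K g).
Local Notation hh := (cartan_sub D).
Local Notation wt b := (weight D b).
Local Notation form := (Defs.form D).
Implicit Types (x y z t : g) (b : rootLattice I).

Lemma formDr x y z : form x (y + z) = form x y + form x z.
Proof. by have := Defs.form_linear D x 1 y z; rewrite scale1r mul1r. Qed.
Lemma form0r x : form x 0 = 0.
Proof. by have /eqP := formDr x 0 0; rewrite addr0 -subr_eq subrr => /eqP. Qed.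
Lemma formZr c x y : form x (c *: y) = c * form x y.
Proof. by have := Defs.form_linear D x c y 0; rewrite addr0 form0r addr0. Qed.
Lemma formNr x y : form x (- y) = - form x y.
Proof. by rewrite -scaleN1r formZr mulN1r. Qed.
Lemma formDl x y z : form (x + y) z = form x z + form y z.
Proof. by rewrite ![form _ z](Defs.form_sym D) formDr. Qed.
Lemma formNl x y : form (- x) y = - form x y.
Proof. by rewrite ![form _ y](Defs.form_sym D) formNr. Qed.
Lemma form0l x : form 0 x = 0.
Proof. by rewrite (Defs.form_sym D) form0r. Qed.

Lemma weight0 : wt 0 = 0.
Proof. by rewrite /weight big1 // => i _; rewrite ffunE scale0r. Qed.
Lemma weightD b (c : rootLattice I) : wt (b + c) = wt b + wt c.
Proof.
rewrite /weight -big_split; apply: eq_bigr => i _.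
by rewrite ffunE rmorphD /= scalerDl.
Qed.
Lemma weightN b : wt (- b) = - wt b.
Proof.
rewrite /weight -sumrN; apply: eq_bigr => i _.
by rewrite ffunE rmorphN /= scaleNr.
Qed.
Lemma weight_simple i : wt (simple_root i) = alpha D i.
Proof.
rewrite /weight (bigD1 i) //= big1 => [|j ne]; rewrite ffunE ?eqxx ?scale1r ?addr0 //.
by rewrite (negPf ne) scale0r.
Qed.

Lemma signQD s b (c : rootLattice I) : signQ s (b + c) = signQ s b + signQ s c.
Proof. by case: s; rewrite //= opprD. Qed.

Lemma alpha_cartan i : alpha D i \in hh.
Proof.
have /andP [/eqP <- _] := alpha_basis D.
by apply: memv_span; apply: codom_f.
Qed.

Lemma weight_cartan b : wt b \in hh.
Proof. by apply: memv_suml => i _; apply/memvZ/alpha_cartan. Qed.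

Lemma cartanP x : x \in hh <-> (forall y, y \in hh -> br x y = 0).
Proof. by case: (cartan_subP D) => H _; apply: H. Qed.

Lemma weightM t u x y : in_weight_space D t x -> in_weight_space D u y ->
  in_weight_space D (t + u) (br x y).
Proof.
move=> tx uy z hz; rewrite brA (tx z hz) (uy z hz) brZl brZr -scalerDl.
by rewrite formDl.
Qed.

Lemma cartan_weight0 x : x \in hh <-> in_weight_space D 0 x.
Proof.
rewrite cartanP; split=> H y hy; first by rewrite brC H // form0l scale0r oppr0.
by rewrite brC H // form0l scale0r oppr0.
Qed.

Lemma chev_xi_cartan i : chev_xi D i \in hh.
Proof.
apply/cartan_weight0; have := weightM (chev_weight (c0 := D) false i) (chev_weight (c0 := D) true i).
by rewrite /= weightN subrr.
Qed.

Definition wbr s (j : I) (w : seq I) : g :=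
  foldr (fun k y => br (chev D s k) y) (chev D s j) w.

Definition wdeg (j : I) (w : seq I) : rootLattice I :=
  simple_root j + \sum_(k <- w) simple_root k.

Lemma wdeg_cons j k w : wdeg j (k :: w) = simple_root k + wdeg j w.
Proof. by rewrite /wdeg big_cons addrCA. Qed.

Lemma wbr_weight s j w : in_weight_space D (wt (signQ s (wdeg j w))) (wbr s j w).
Proof.
elim: w => [|k w IH]; first by rewrite /wdeg big_nil addr0; apply: chev_weight.
rewrite wdeg_cons signQD weightD.
exact: weightM (chev_weight (c0 := D) s k) IH.
Qed.

Definition short_words s n : g -> Prop :=
  lspan (fun x => (exists k, x = chev_xi D k) \/
    exists j w, (size w < n)%N /\ x = wbr s j w).

Lemma chev_chev s j k : exists c, br (chev D (~~ s) j) (chev D s k) = c *: chev_xi D j.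
Proof.
have [<-|ne] := eqVneq j k; last first.
  exists 0; rewrite scale0r; case: s => /=; first exact: chev_comm.
  by rewrite brC chev_comm ?oppr0 // eq_sym.
case: s => /=; first by exists 1; rewrite scale1r.
by exists (-1); rewrite brC scaleN1r.
Qed.

Lemma chev_short s n k x :
  short_words s n x -> short_words s n.+1 (br (chev D s k) x).
Proof.
elim=> [|c y z Py _ IH]; first by rewrite br0r; apply: lspan0.
rewrite brDr brZr; apply: lspanD => //; apply: lspanZ.
case: Py => [[j ->]|[j [w [sz ->]]]].
  rewrite brC (chev_weight (c0 := D) s k) ?chev_xi_cartan //.
  by apply/lspanN/lspanZ/lspan_gen; right; exists k, [::].
by apply: lspan_gen; right; exists j, (k :: w).
Qed.

(** The Jacobi identity moves the opposite generator inwards. Where it meets a letter it leaves a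
    multiple of some [chev_xi], which acts on the rest of the word by a scalar, so a letter is
    lost. *)
Lemma opp_chev_word s k j w :
  short_words s (size w) (br (chev D (~~ s) k) (wbr s j w)).
Proof.
elim: w => [|k' w IH] /=.
  have [c ->] := chev_chev s k j.
  by apply/lspanZ/lspan_gen; left; exists k.
rewrite brA; apply: lspanD; last exact: chev_short.
have [c ->] := chev_chev s k k'; rewrite brZl; apply: lspanZ.
rewrite wbr_weight ?chev_xi_cartan //.
by apply/lspanZ/lspan_gen; right; exists j, w.
Qed.

Definition homog_word b x :=
  (b = 0 /\ x \in hh) \/ exists s j w, b = signQ s (wdeg j w) /\ x = wbr s j w.

Lemma homog_word_weight b x : homog_word b x -> in_weight_space D (wt b) x.
Proof.
case=> [[-> hx]|[s [j [w [-> ->]]]]]; last exact: wbr_weight.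
by rewrite weight0; apply/cartan_weight0.
Qed.

Definition word_span := lspan (fun x => exists b, homog_word b x).

Lemma short_word_span s n x : short_words s n x -> word_span x.
Proof.
apply: lspan_mono => y; case=> [[k ->]|[j [w [_ ->]]]]; apply: lspan_gen.
  by exists 0; left; split=> //; apply: chev_xi_cartan.
by exists (signQ s (wdeg j w)); right; exists s, j, w.
Qed.

Lemma word_span_chev s k x : word_span x -> word_span (br (chev D s k) x).
Proof.
elim=> [|c y z [b Py] _ IH]; first by rewrite br0r; apply: lspan0.
rewrite brDr brZr; apply: lspanD => //; apply: lspanZ.
case: Py => [[_ hy]|[s' [j [w [_ ->]]]]].
  rewrite brC chev_weight //; apply/lspanN/lspanZ/lspan_gen.
  exists (signQ s (wdeg k [::])); right.
  by exists s, k, [::].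
have [->|ne] := eqVneq s' s; first last.
  have -> : s = ~~ s' by move: ne; case: (s); case: (s').
  exact: short_word_span (opp_chev_word s' k j w).
by apply: lspan_gen; exists (signQ s (wdeg j (k :: w))); right; exists s, j, (k :: w).
Qed.

(** [chev_generate] is used twice: the elements whose bracket preserves the span of the words form a
    subalgebra containing the generators, hence everything; the span itself is then a subalgebra
    containing the generators. *)
Lemma word_spanT x : word_span x.
Proof.
have [U UP] := lspan_vspace (fun x => exists b, homog_word b x).
have [W WP] := lspan_vspace (fun x => forall u, u \in U -> br x u \in U).
have WE y : y \in W -> forall u, u \in U -> br y u \in U.
  move=> /WP; elim=> [|c v z Pv _ IH] u Uu; first by rewrite br0l mem0v.
  by rewrite brDl brZl memvD ?memvZ ?Pv ?IH.
have WT : W = fullv.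
  apply: (@chev_generate _ _ _ D) => [s i|y z Wy Wz].
    by apply/WP/lspan_gen => u /UP Uu; apply/UP/word_span_chev.
  apply/WP/lspan_gen => u Uu.
  have -> : br (br y z) u = br y (br z u) - br z (br y u).
    by rewrite brA addrK.
  by rewrite memvB // WE // WE.
apply/UP; suff -> : U = fullv by apply: memvf.
apply: (@chev_generate _ _ _ D) => [s i|y z _ Uz].
  apply/UP/lspan_gen; exists (signQ s (wdeg i [::])); right.
  by exists s, i, [::].
by apply: WE => //; rewrite WT memvf.
Qed.

(** A homogeneous word y whose weight pairs to zero with the Cartan subalgebra centralizes it, hence
    belongs to it. Otherwise some u has (wt b, u) <> 0, and invariance gives (wt b, u) (t, y) =
    ([t, u], y) = 0. So t is orthogonal to all of g. *)
Lemma form_cartan_nondeg t : t \in hh -> (forall y, y \in hh -> form t y = 0) ->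
  t = 0.
Proof.
move=> ht t0; apply: (form_nondegenerate (c0 := D)) => x.
elim: (word_spanT x) => [|c y z [b Py] _ IH]; first exact: form0r.
rewrite formDr formZr IH addr0.
suff -> : form t y = 0 by rewrite mulr0.
have yb := homog_word_weight Py.
have [b0|/existsNP [u]] := pselect (forall u, u \in hh -> form (wt b) u = 0).
  apply: t0; apply/cartanP => u hu; rewrite brC yb //.
  by rewrite b0 // scale0r oppr0.
move=> /not_implyP [hu /eqP nz]; apply/eqP.
have : form (wt b) u * form t y = 0.
  rewrite -formZr -yb // -form_invariant.
  by move/cartanP: ht => ->; rewrite // form0l.
by move/eqP; rewrite mulf_eq0 (negPf nz).
Qed.

Lemma cartan_alpha x : x \in hh -> lspan (fun y => exists i, y = alpha D i) x.
Proof.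
move=> hx; have [U UP] := lspan_vspace (fun y => exists i, y = alpha D i).
apply/UP; move: x hx; apply/subvP; have /andP [/eqP <- _] := alpha_basis D.
apply/span_subvP => y /codomP [i ->]; apply/UP/lspan_gen.
by exists i.
Qed.

Lemma alpha_neq0 i : alpha D i != 0.
Proof.
have /andP [_ fr] := alpha_basis D; apply: contraTneq fr => ai0.
apply/negP => /free_not0 /(_ (codom_f (alpha D) i)).
by rewrite ai0 eqxx.
Qed.

Lemma form_alpha_neq0 i : form (alpha D i) (alpha D i) != 0.
Proof.
apply/eqP => f0; have /eqP := alpha_neq0 i; apply.
apply: form_cartan_nondeg => [|y hy]; first exact: alpha_cartan.
elim: (cartan_alpha hy) => [|c u v [j ->] _ IH]; first exact: form0r.
by rewrite formDr formZr IH addr0 -cartan_mxP f0 !mul0r mulr0.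
Qed.

Lemma weight_eq0 b : wt b = 0 -> b = 0.
Proof.
move=> b0; have /andP [_ fr] := alpha_basis D.
have e : size (codom (alpha D)) = #|I| by rewrite size_codom.
have fr' : free (codom_tuple (alpha D)) by [].
have k0 := freeP fr' (fun k => (b (enum_val k))%:~R).
apply/ffunP => i; rewrite ffunE.
have /k0 /(_ (enum_rank i)) : \sum_(k < #|I|) (b (enum_val k))%:~R *: (codom_tuple (alpha D))`_k = 0.
  rewrite -[RHS]b0 /weight [RHS](reindex_onto enum_val enum_rank) /=; last first.
    by move=> j _; rewrite enum_rankK.
  rewrite [RHS](eq_bigl xpredT) => [|k]; last by rewrite enum_valK eqxx.
  apply: eq_bigr => k _; congr (_ *: _).
  by rewrite codomE (nth_map (enum_val k)) -?cardE ?ltn_ord // -enum_val_nth.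
rewrite enum_rankK; case: (b i) => [[|n]|n] // /eqP.
  by rewrite -pmulrn (negPf (char0 n)).
by rewrite NegzE mulrNz oppr_eq0 -pmulrn (negPf (char0 n)).
Qed.

Lemma weight_sep b (c : rootLattice I) : b != c ->
  exists2 y, y \in hh & form (wt b) y != form (wt c) y.
Proof.
move=> ne; apply: contrapT => H; move/eqP: ne; apply; apply/subr0_eq.
apply: weight_eq0; apply: form_cartan_nondeg; first exact: weight_cartan.
move=> y hy; rewrite weightD weightN formDl formNl; apply/eqP; rewrite subr_eq0.
by apply: contrapT => /negP ne; apply: H; exists y.
Qed.

(** Independence of weight spaces. A Cartan element y separating b from the weight of the first
    vector is used to remove that vector: bracketing by y and subtracting its eigenvalue on it
    leaves a shorter sum, again of weight b. *)
Lemma weight_sum0 b (l : seq (rootLattice I * g)) :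
  (forall u, u \in l -> u.1 != b /\ in_weight_space D (wt u.1) u.2) ->
  in_weight_space D (wt b) (\sum_(u <- l) u.2) -> \sum_(u <- l) u.2 = 0.
Proof.
elim: l {-2}l (leqnn (size l)) => [|x0 l0 IH] [|x l] //=; rewrite ?big_nil //.
rewrite ltnS => sz lP; set S := \sum_(r <- _) r.2 => Sb.
have [xb xw] := lP x (mem_head _ _).
have [y hy ne] := weight_sep xb.
pose l' := [seq (r.1, (form (wt r.1) y - form (wt x.1) y) *: r.2) | r <- l].
have e : (form (wt b) y - form (wt x.1) y) *: S = \sum_(r <- l') r.2.
  rewrite scalerBl -Sb // /S !big_cons brDr scalerDr (xw _ hy) opprD addrACA subrr add0r.
  rewrite scaler_sumr -sumrN big_map.
  have -> : br y (\sum_(j <- l) j.2) = \sum_(j <- l) br y j.2.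
    elim: (l) => [|u v IHl]; first by rewrite !big_nil br0r.
    by rewrite !big_cons brDr IHl.
  rewrite -big_split /= !big_seq; apply: eq_bigr => r zl.
  have [_ zw] := lP r (mem_behead (s := x :: l) zl).
  by rewrite zw // scalerBl.
have /eqP : \sum_(r <- l') r.2 = 0.
  apply: IH; first by rewrite size_map.
    move=> z /mapP [u ul ->] /=; have [ub uw] := lP u (mem_behead (s := x :: l) ul).
    by split=> // v hv; rewrite brZr uw // !scalerA mulrC.
  by rewrite -e => v hv; rewrite brZr Sb // !scalerA mulrC.
rewrite -e scaler_eq0 subr_eq0 eq_sym (negPf ne) => /eqP.
by [].
Qed.

(** Words span g, and the words of degree other than b contribute 0 by [weight_sum0]. *)
Lemma weight_component b v : in_weight_space D (wt b) v -> lspan (homog_word b) v.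
Proof.
move=> vb.
suff [u [l [bu lP e]]] : exists u l, [/\ lspan (homog_word b) u,
    forall r : rootLattice I * g, r \in l -> r.1 != b /\ in_weight_space D (wt r.1) r.2 &
    v = u + \sum_(r <- l) r.2].
  suff s0 : \sum_(r <- l) r.2 = 0 by rewrite e s0 addr0.
  apply: (weight_sum0 lP) => y hy.
  have -> : \sum_(r <- l) r.2 = v - u by rewrite e addrC addKr.
  have ub : in_weight_space D (wt b) u.
    elim: bu => [|c x z Px _ IH] t ht; first by rewrite br0r scaler0.
    by rewrite brDr brZr (homog_word_weight Px) // IH // scalerDr !scalerA mulrC.
  by rewrite brDr brNr vb // ub // scalerBr.
elim: (word_spanT v) => [|c x z [b' Px] _ [u [l [bu lP e]]]].
  by exists 0, [::]; split=> //; rewrite ?big_nil ?addr0 //; apply: lspan0.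
have [eb|ne] := eqVneq b' b.
  exists (c *: x + u), l; split=> //; last by rewrite e addrA.
  by apply: lspanD => //; apply/lspanZ/lspan_gen; rewrite -eb.
exists u, ((b', c *: x) :: l); split=> //; last by rewrite big_cons e addrCA.
move=> y; rewrite inE => /orP [/eqP ->|/lP //]; split=> // t ht /=.
by rewrite brZr (homog_word_weight Px) // !scalerA mulrC.
Qed.

Lemma wdeg_Qplus j w : Qplus (wdeg j w).
Proof.
elim: w => [|k w [IH1 IH2]].
  rewrite /wdeg big_nil addr0; split=> [i|]; first by rewrite ffunE.
  by rewrite (bigD1 j) //= big1 ?ffunE ?eqxx // => i ne; rewrite ffunE (negPf ne).
rewrite wdeg_cons; split=> [i|]; first by rewrite ffunE addr_ge0 ?IH1 // ffunE.
under eq_bigr do rewrite ffunE.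
rewrite big_split /=; apply: ltr_wpDl IH2; apply: sumr_ge0 => i _.
by rewrite ffunE.
Qed.

Lemma Qplus_neq0 b : Qplus b -> b <> 0.
Proof. by case=> _ + b0; rewrite b0 big1 // => i _; rewrite ffunE. Qed.

Lemma QplusN b : Qplus b -> ~ Qplus (- b).
Proof.
case=> _ bp [_]; under eq_bigr do rewrite ffunE.
by rewrite sumrN oppr_gt0 => /(lt_trans bp); rewrite ltxx.
Qed.

Definition pos_words b := lspan (fun x => exists j w, wdeg j w = b /\ x = wbr false j w).

Lemma rvec_words b : b \in pos_roots D -> pos_words b (rvec D false b).
Proof.
move=> bP; have /pos_rootsP [bQ _] := bP.
have := weight_component (rvec_weight (c0 := D) false bP).
apply: lspan_mono => x; case=> [[b0]|[s [j [w [e ->]]]]].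
  by case: (Qplus_neq0 bQ b0).
case: s e => /= e; last by apply: lspan_gen; exists j, w.
by have := QplusN (wdeg_Qplus j w); rewrite -e.
Qed.

(** * Fixed points of the Chevalley involution *)

Variable L : g -> Prop.
Hypotheses (L0 : L 0) (L_lin : forall c x y, L x -> L y -> L (c *: x + y)).
Hypothesis L_br : forall x y, L x -> L y -> L (br x y).
Hypothesis L_chev : forall i, L (chev D false i - chev D true i).

Lemma omegaD x y : omega D (x + y) = omega D x + omega D y.
Proof. exact: (linD _ _ (omega_linear D)). Qed.
Lemma omegaZ c x : omega D (c *: x) = c *: omega D x.
Proof. exact: (linZ _ _ (omega_linear D)). Qed.
Lemma omega0 : omega D 0 = 0.
Proof. exact: (lin0 (omega_linear D)). Qed.
Lemma L_D x y : L x -> L y -> L (x + y).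
Proof. by move=> Lx; rewrite -[x]scale1r; apply: L_lin. Qed.
(* The fixed points of [omega] are generated by the [omega]-orbit sums of the
   simple root vectors: expanding the bracket of two orbit sums gives the orbit
   sum of a longer word and that of a combination of shorter ones. *)
Lemma omega_orbit_word n j w : (size w < n)%N ->
  L (wbr false j w + omega D (wbr false j w)).
Proof.
elim: n j w => // n IH j [_|k w].
  by rewrite /= omega_chev.
rewrite ltnS => sz /=; set x := wbr false j w.
have Lx : L (x + omega D x) by apply: IH.
have Lk : L (chev D false k + omega D (chev D false k)) by rewrite omega_chev.
have Lz : L (br (chev D true k) x + omega D (br (chev D true k) x)).
  have := opp_chev_word false k j w; rewrite -/x /=.
  elim=> [|c u v Pu _ IHl]; first by rewrite omega0 addr0.
  rewrite omegaD omegaZ addrACA -scalerDr; apply: L_lin => //.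
  case: Pu => [[i ->]|[j' [w' [sz' ->]]]]; first by rewrite omega_xi subrr.
  by apply: IH; apply: leq_trans sz' (ltnW sz).
have -> : br (chev D false k) x + omega D (br (chev D false k) x) =
  br (chev D false k + omega D (chev D false k)) (x + omega D x) +
  (br (chev D true k) x + omega D (br (chev D true k) x)).
  rewrite brDl !brDr !omega_lie !omega_chev /= !brNl.
  have zmodE (p q r m : g) : p - q = p + r + (- m - q) + (m - r).
    by rewrite -!addrA; congr (_ + _); rewrite addrA -[m - r]opprB addrCA subrr addr0.
  exact: zmodE.
by apply: L_D => //; apply: L_br.
Qed.

Lemma omega_orbit b v : pos_words b v -> L (v + omega D v).
Proof.
elim=> [|c x z [j [w [_ ->]]] _ IH]; first by rewrite omega0 addr0.
rewrite omegaD omegaZ addrACA -scalerDr; apply: L_lin => //.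
exact: omega_orbit_word (ltnSn (size w)).
Qed.

End Roots.

(** * Iterated commutators of the simple root vectors *)

Section Words.
Variables (K : fieldType) (T : algType K) (d : K) (I : eqType) (i : I).
Variables (X : I -> T) (xi m : nat -> T).
Hypothesis xi0_m : forall s, cbr (xi 0) (m s) = (2 * - d) *: m s.
Hypothesis X_m : forall s, cbr (X i) (m s) = xi s.
Hypothesis xi_m : forall r s,
  cbr (xi r.+1) (m s) - cbr (xi r) (m s.+1) = (- d) *: abr (xi r) (m s).
Hypothesis Xj_m : forall j s, j != i -> X j * m s = m s * X j.

Local Notation S := (ser T).
Local Ltac nc := nca K (@nil T).
Local Ltac ncS := nca K (@nil S).
Local Notation Z := (alt m 0).

Definition cword (j : I) (w : seq I) : T := foldr (fun k y => cbr (X k) y) (X j) w.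

Lemma cword_comm j w s : i \notin j :: w -> cword j w * m s = m s * cword j w.
Proof.
elim: w => [|k w IH]; first by rewrite inE eq_sym => /Xj_m ->.
rewrite !inE !negb_or => /and3P [ij ik iw] /=.
have {IH} := IH; rewrite inE negb_or ij iw => /(_ isT) => e1.
have e2 : X k * m s = m s * X k by apply: Xj_m; rewrite eq_sym.
rewrite /cbr mulrBl mulrBr -!mulrA e1 e2.
by rewrite (mulrA (X k)) e2 (mulrA (cword _ _)) e1 !mulrA.
Qed.

Lemma cword_Z j w s : i \notin j :: w ->
  scst (cword j w) * alt m s = alt m s * scst (cword j w).
Proof. by move=> ijw; apply: scst_comm_alt => r; apply: cword_comm. Qed.

Lemma Xi_Z : cbr (scst (X i)) Z = XM xi - 1.
Proof.
apply/funext => -[|n]; rewrite scst_ser_cbr serB /XM /series_opp /=.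
  by rewrite /cbr mulr0 mul0r subrr expr0 scale1r subrr.
by rewrite add0n subr0 -X_m; nc; ring.
Qed.

(** For the letter i alone, [X_i, Z] = XM - 1 and [Dd s] only sees -1. If i comes first, the rest
    commutes with every m_r, so the series is a commutator of [XM] with something that passes
    through [Dd s]. Otherwise the first letter itself passes through [Dd s], and it commutes with
    the value found for the rest. *)
Lemma Dd_cword j w s : count_mem i (j :: w) = 1%N ->
  Dd d m s (cbr (scst (cword j w)) Z) =
  if w is [::] then - (2 * d) *: alt m s else 0.
Proof.
elim: w => [|k w IH]; rewrite [count_mem _ _]/=.
  case: eqVneq => [->|] //= _; rewrite Xi_Z DdB Dd_XM //.
  by rewrite /Dd; ncS; ring.
have [->|nki] := eqVneq k i => e.
  have ijw : i \notin j :: w.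
    by rewrite -has_pred1 has_count /=; move: e; rewrite addnCA add1n => -[->].
  have c1 : scst (cword j w) * scst (m s) = scst (m s) * scst (cword j w).
    by rewrite -!scstM cword_comm.
  have -> : cbr (scst (cword j (i :: w))) Z = XM xi * scst (cword j w)
      - scst (cword j w) * XM xi.
    have -> : cbr (scst (cword j (i :: w))) Z =
       cbr (cbr (scst (X i)) Z) (scst (cword j w))
       + cbr (scst (X i)) (scst (cword j w) * Z - Z * scst (cword j w)).
      by rewrite /= scst_cbr; ncS; ring.
    by rewrite (cword_Z 0 ijw) subrr Xi_Z; ncS; ring.
  rewrite DdB (Dd_mulr d _ c1 (cword_Z s ijw)) (Dd_mull d _ c1 (cword_Z s ijw)).
  by rewrite Dd_XM // mulr0 mul0r subrr.
have {}IH : Dd d m s (cbr (scst (cword j w)) Z) =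
  if w is [::] then - (2 * d) *: alt m s else 0 by apply: IH.
have kr r : X k * m r = m r * X k by apply: Xj_m.
have c1 : scst (X k) * scst (m s) = scst (m s) * scst (X k).
  by rewrite -!scstM kr.
have c2 t : scst (X k) * alt m t = alt m t * scst (X k) by apply: scst_comm_alt.
have -> : cbr (scst (cword j (k :: w))) Z =
    scst (X k) * cbr (scst (cword j w)) Z - cbr (scst (cword j w)) Z * scst (X k).
  have -> : cbr (scst (cword j (k :: w))) Z =
    scst (X k) * cbr (scst (cword j w)) Z - cbr (scst (cword j w)) Z * scst (X k)
    - cbr (scst (cword j w)) (scst (X k) * Z - Z * scst (X k)).
    by rewrite /= scst_cbr; ncS; ring.
  by rewrite c2 subrr cbr0r subr0.
rewrite DdB (Dd_mulr d _ c1 (c2 s)) (Dd_mull d _ c1 (c2 s)) IH.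
case: w {IH e} => [|k' w]; last by rewrite mulr0 mul0r subrr.
by rewrite -scalerAr -scalerAl c2 subrr.
Qed.

End Words.

(** * The Yangian *)

Lemma apr_rel (K : fieldType) (E : algType K) (rel : E -> E -> Prop) x y :
  rel x y -> apr rel x = apr rel y.
Proof.
move=> rxy; apply/qpi_eq/lspan_gen; exists 1, 1, x, y.
by rewrite mul1r mulr1.
Qed.

Lemma apr_cbr (K : fieldType) (E : algType K) (rel : E -> E -> Prop) x y :
  apr rel (cbr x y) = cbr (apr rel x) (apr rel y).
Proof. by rewrite /cbr rmorphB !rmorphM. Qed.

Lemma apr_abr (K : fieldType) (E : algType K) (rel : E -> E -> Prop) x y :
  apr rel (abr x y) = abr (apr rel x) (apr rel y).
Proof. by rewrite /abr rmorphD !rmorphM. Qed.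

Lemma aprD (K : fieldType) (E : algType K) (rel : E -> E -> Prop) x y :
  apr rel (x + y) = apr rel x + apr rel y.
Proof. exact: rmorphD. Qed.

Lemma aprB (K : fieldType) (E : algType K) (rel : E -> E -> Prop) x y :
  apr rel (x - y) = apr rel x - apr rel y.
Proof. exact: rmorphB. Qed.

Lemma aprZ (K : fieldType) (E : algType K) (rel : E -> E -> Prop) c x :
  apr rel (c *: x) = c *: apr rel x.
Proof. exact: linearZ. Qed.

Section YangianRelations.
Variables (K : fieldType) (g : lieAlgebra K) (I : finType).
Variable D : chevalleyData g I.
Local Notation Y := (yangian D).

Lemma yxi_yxi i j r s : cbr (yxi D i r) (yxi D j s) = 0 :> Y.
Proof.
have := apr_rel (yrel_xi_xi D i j r s).
by rewrite apr_cbr rmorph0.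
Qed.

Lemma yxi0_yx e i j s :
  cbr (yxi D i 0) (yx D e j s) = ((-1) ^+ e * ip D i j) *: yx D e j s :> Y.
Proof.
have := apr_rel (yrel_xi0_x D e i j s).
by rewrite apr_cbr aprZ.
Qed.

Lemma yx_yx i j r s : cbr (yx D false i r) (yx D true j s) =
  if i == j then yxi D i (r + s) else 0 :> Y.
Proof.
have := apr_rel (yrel_x_x D i j r s).
by rewrite apr_cbr; case: eqP => _; rewrite ?rmorph0.
Qed.

Lemma yxi_yx e i j r s :
  cbr (yxi D i r.+1) (yx D e j s) - cbr (yxi D i r) (yx D e j s.+1) =
  ((-1) ^+ e * (ip D i j / 2)) *: abr (yxi D i r) (yx D e j s) :> Y.
Proof.
have := apr_rel (yrel_xi_x D e i j r s).
by rewrite aprB !apr_cbr aprZ apr_abr.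
Qed.

Lemma yx_yx_same e i j r s :
  cbr (yx D e i r.+1) (yx D e j s) - cbr (yx D e i r) (yx D e j s.+1) =
  ((-1) ^+ e * (ip D i j / 2)) *: abr (yx D e i r) (yx D e j s) :> Y.
Proof.
have := apr_rel (yrel_xe_xe D e i j r s).
by rewrite aprB !apr_cbr aprZ apr_abr.
Qed.

(** [chevalleyData] does not list this relation; it is read back from the Yangian by injectivity of
    [iota]. *)
Lemma chev_comm_of_inclusion (iota : g -> Y) : is_g_inclusion iota ->
  forall i j, i != j -> lie_br (chev D false i) (chev D true j) = 0.
Proof.
case=> li inj br [_ xE] i j ne; apply: inj.
by rewrite br !xE yx_yx (negPf ne) (lin0 li).
Qed.

Lemma yhomog1 : yhomog 0 (1 : Y).
Proof. by apply: lspan_gen; exists [::]; rewrite !big_nil. Qed.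

Lemma yhomog_generator a : yhomog (ydeg a) (ygenerator D a).
Proof. by apply: lspan_gen; exists [:: a]; rewrite !big_seq1. Qed.

Lemma yhomogM b c (x y : Y) : yhomog b x -> yhomog c y -> yhomog (b + c) (x * y).
Proof.
move=> xb yc; elim: xb => [|k u v [w wb ->] _ IH]; first by rewrite mul0r; apply: lspan0.
rewrite mulrDl; apply: lspanD => //; rewrite -scalerAl; apply: lspanZ.
elim: yc => [|k' u' v' [w' wc ->] _ IH']; first by rewrite mulr0; apply: lspan0.
rewrite mulrDr; apply: lspanD => //; rewrite -scalerAr; apply: lspanZ.
by apply: lspan_gen; exists (w ++ w'); rewrite !big_cat ?wb ?wc.
Qed.

Lemma yangian_inM (S S' S'' : rootLattice I -> Prop) (x y : Y) :
  yangian_in S x -> yangian_in S' y ->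
  (forall b c, S b -> S' c -> S'' (b + c)) -> yangian_in S'' (x * y).
Proof.
move=> xS yS SS; elim: xS => [|k u v [b Sb ub] _ IH].
  by rewrite mul0r; apply: lspan0.
rewrite mulrDl; apply: lspanD => //; rewrite -scalerAl; apply: lspanZ.
elim: yS => [|k' u' v' [c Sc uc] _ IH']; first by rewrite mulr0; apply: lspan0.
rewrite mulrDr; apply: lspanD => //; rewrite -scalerAr; apply: lspanZ.
by apply: lspan_gen; exists (b + c); [apply: SS|apply: yhomogM].
Qed.

Lemma yangian_in_sub (S S' : rootLattice I -> Prop) (x : Y) :
  (forall b, S b -> S' b) -> yangian_in S x -> yangian_in S' x.
Proof.
move=> SS; apply: lspan_mono => y [b Sb yb]; apply: lspan_gen.
by exists b => //; apply: SS.
Qed.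

Lemma yangian_in_homog (S : rootLattice I -> Prop) b (x : Y) :
  yhomog b x -> S b -> yangian_in S x.
Proof. by move=> xb Sb; apply: lspan_gen; exists b. Qed.

Lemma yangian_ge0_inM (S S' S'' : rootLattice I -> Prop) (x y : Y) :
  yangian_ge0_in S x -> yangian_ge0_in S' y ->
  (forall b c, S b -> S' c -> S'' (b + c)) -> yangian_ge0_in S'' (x * y).
Proof.
move=> xS yS SS; elim: xS => [|k u v [u0 [b Sb ub]] _ IH].
  by rewrite mul0r; apply: lspan0.
rewrite mulrDl; apply: lspanD => //; rewrite -scalerAl; apply: lspanZ.
elim: yS => [|k' u' v' [u0' [c Sc uc]] _ IH']; first by rewrite mulr0; apply: lspan0.
rewrite mulrDr; apply: lspanD => //; rewrite -scalerAr; apply: lspanZ.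
apply: lspan_gen; split; first exact: yge0_mul.
by exists (b + c); [apply: SS|apply: yhomogM].
Qed.

Lemma yangian_ge0_in_sub (S S' : rootLattice I -> Prop) (x : Y) :
  (forall b, S b -> S' b) -> yangian_ge0_in S x -> yangian_ge0_in S' x.
Proof.
move=> SS; apply: lspan_mono => y [y0 [b Sb yb]]; apply: lspan_gen; split=> //.
by exists b => //; apply: SS.
Qed.

Lemma yangian_ge0_in_in (S : rootLattice I -> Prop) (x : Y) :
  yangian_ge0_in S x -> yangian_in S x.
Proof.
by apply: lspan_mono => y [_ [b Sb yb]]; apply: lspan_gen; exists b.
Qed.

Lemma lin_lspan (V : algType K) (P : V -> Prop) : lin (lspan P).
Proof.
split=> [|c x y Px Py]; first exact: lspan0.
by apply: lspanD => //; apply: lspanZ.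
Qed.

Variable iota : g -> Y.
Hypothesis iota_incl : is_g_inclusion iota.

Lemma iota_linear : linear iota. Proof. by case: iota_incl. Qed.
Lemma iota_br x y : iota (lie_br x y) = cbr (iota x) (iota y).
Proof. by case: iota_incl. Qed.
Lemma iota_chev s i : iota (chev D s i) = yx D s i 0.
Proof. by case: iota_incl => _ _ _ [_]. Qed.

Lemma iota_wbr j w : iota (wbr D false j w) = cword (fun k => yx D false k 0) j w.
Proof.
elim: w => [|k w IH] /=; first by rewrite iota_chev.
by rewrite iota_br iota_chev -IH.
Qed.

Hypothesis char0 : forall n : nat, n.+1%:R != 0 :> K.

Lemma iota_rvec b : b \in pos_roots D ->
  lspan (fun y : Y => exists j w, wdeg j w = b /\
    y = cword (fun k => yx D false k 0) j w) (iota (rvec D false b)).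
Proof.
move=> bP; have := rvec_words char0 (chev_comm_of_inclusion iota_incl) bP.
elim=> [|c x y [j [w [jw ->]]] _ IH]; first by rewrite (lin0 iota_linear); apply: lspan0.
rewrite iota_linear; apply: lspanD => //; apply/lspanZ/lspan_gen.
by exists j, w; rewrite iota_wbr.
Qed.

Lemma cword_homog j w : yhomog (wdeg j w) (cword (fun k => yx D false k 0) j w).
Proof.
elim: w => [|k w IH].
  by rewrite /wdeg big_nil addr0; apply: (yhomog_generator (inr (false, j, 0%N))).
have hk := yhomog_generator (inr (false, k, 0%N) : ygen I).
rewrite wdeg_cons /= /cbr; apply: lspanD; first exact: (yhomogM hk IH).
by apply: lspanN; rewrite addrC; apply: (yhomogM IH hk).
Qed.

Lemma yangian_ge0Z c (x : Y) : yangian_ge0 x -> yangian_ge0 (c *: x).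
Proof.
move=> x0; rewrite -[c *: x]mul1r -scalerAr scalerAl.
by apply: yge0_mul => //; apply: yge0_scalar.
Qed.

Lemma yangian_ge0_cbr (x y : Y) : yangian_ge0 x -> yangian_ge0 y ->
  yangian_ge0 (cbr x y).
Proof.
move=> x0 y0; apply: yge0_add; first exact: yge0_mul.
by rewrite -scaleN1r; apply/yangian_ge0Z/yge0_mul.
Qed.

Lemma cword_ge0 j w : yangian_ge0 (cword (fun k => yx D false k 0) j w).
Proof.
elim: w => [|k w IH] /=; first exact: yge0_x.
by apply: yangian_ge0_cbr => //; apply: yge0_x.
Qed.

Lemma yangian_ge0_0 : yangian_ge0 (0 : Y).
Proof. by rewrite -(scale0r (1 : Y)); apply: yge0_scalar. Qed.

(** By the Leibniz rule each term replaces one letter by its bracket with x^-_{i,s}, which is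
    xi_{i,s} or 0, so no lowering generator survives. *)
Lemma cword_m_ge0 i j w s :
  yangian_ge0 (cbr (cword (fun k => yx D false k 0) j w) (yx D true i s)).
Proof.
have base k : yangian_ge0 (cbr (yx D false k 0) (yx D true i s)).
  by rewrite yx_yx; case: eqP => _; [apply: yge0_xi|apply: yangian_ge0_0].
elim: w => [|k w IH] //=; set x := cword _ _ _ in IH *.
have -> : cbr (cbr (yx D false k 0) x) (yx D true i s) =
  cbr (cbr (yx D false k 0) (yx D true i s)) x +
  cbr (yx D false k 0) (cbr x (yx D true i s)).
  by nca K (@nil Y); ring.
apply: yge0_add; apply: yangian_ge0_cbr => //; first exact: cword_ge0.
exact: yge0_x.
Qed.

End YangianRelations.

(** * The positive cone of the root lattice *)

Section Lattice.
Variable I : finType.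
Implicit Types b c : rootLattice I.

Definition Qnneg b : Prop := forall k, 0 <= b k.

Lemma Qplus_nneg b : Qplus b -> Qnneg b. Proof. by case. Qed.

Lemma QnnegD b c : Qnneg b -> Qnneg c -> Qnneg (b + c).
Proof. by move=> b0 c0 k; rewrite ffunE addr_ge0 ?b0 ?c0. Qed.

Lemma Qplus_of_nneg b : Qnneg b -> b != 0 -> Qplus b.
Proof.
move=> b0 nz; split=> //; rewrite lt_neqAle sumr_ge0 // andbT eq_sym.
apply: contra nz => /eqP s0; apply/eqP/ffunP => k; rewrite ffunE.
by have /psumr_eq0P := s0; apply.
Qed.

Lemma QplusDl b c : Qplus b -> Qnneg c -> Qplus (b + c).
Proof.
move=> [b0 bs] c0; split; first exact: QnnegD.
under eq_bigr do rewrite ffunE.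
by rewrite big_split ltr_pwDl // sumr_ge0.
Qed.

Lemma QplusDr b c : Qnneg b -> Qplus c -> Qplus (b + c).
Proof. by move=> b0 cp; rewrite addrC; apply: QplusDl. Qed.

Lemma simple_root_Qplus (i : I) : Qplus (simple_root i).
Proof.
split=> [k|]; first by rewrite ffunE.
by rewrite (bigD1 i) //= big1 ?ffunE ?eqxx // => k ne; rewrite ffunE (negPf ne).
Qed.

Lemma wdegE j (w : seq I) k : wdeg j w k = (count_mem k (j :: w))%:Z.
Proof.
elim: w => [|l w IH].
  by rewrite /wdeg big_nil addr0 ffunE /= addn0 eq_sym.
rewrite wdeg_cons ffunE IH ffunE -PoszD /= [(k == l)]eq_sym.
by rewrite addnCA.
Qed.

(** For [E_double]: the data do not list the fact that 2 alpha_i is not a root, but the only word of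
    that degree is [X_i, X_i] = 0. *)
Lemma wdeg_double (i j : I) (w : seq I) :
  wdeg j w = simple_root i + simple_root i -> j = i /\ w = [:: i].
Proof.
move=> e; have cnt k : count_mem k (j :: w) = ((k == i) + (k == i))%N.
  by have /ffunP /(_ k) := e; rewrite wdegE !ffunE -PoszD => -[].
have ai : all (pred1 i) (j :: w).
  apply/allP => k kw; apply/negPn/negP => /= ne.
  by have := cnt k; rewrite (negPf ne) => /count_memPn; rewrite kw.
have sz : size (j :: w) = 2%N.
  by have := cnt i; rewrite eqxx; move: ai; rewrite all_count => /eqP ->.
by case: w ai sz {e cnt} => [|k [|]] //= /and3P [/eqP -> /eqP ->].
Qed.

End Lattice.

(** * Congruences modulo positive degrees in the right factor *)

Section Graded.
Variables (K : fieldType) (g : lieAlgebra K) (I : finType).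
Hypothesis char0 : forall n : nat, n.+1%:R != 0 :> K.
Variables (D : chevalleyData g I) (iota : g -> yangian D).
Hypothesis iota_incl : is_g_inclusion iota.
Variable i : I.

Local Notation Y := (yangian D).
Local Notation alphai := (simple_root i).
Local Notation d := (dnum D i).

Lemma two_neq0_of_char0 : 2 != 0 :> K. Proof. exact: (char0 1). Qed.

Lemma ip_alpha : ip D i i = 2 * d.
Proof. by rewrite /dnum mulrCA mulfV ?mulr1 // two_neq0_of_char0. Qed.

Lemma dnum_neq0 : d != 0.
Proof.
rewrite /dnum mulf_neq0 ?invr_neq0 ?two_neq0_of_char0 // /ip /ipQ !weight_simple.
by apply: form_alpha_neq0; apply: chev_comm_of_inclusion iota_incl.
Qed.

Lemma alphai_root : alphai \in pos_roots D.
Proof.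
apply/pos_rootsP; split; first exact: simple_root_Qplus.
rewrite weight_simple; split; first exact: alpha_cartan.
  exact: alpha_neq0.
exists (chev D false i); last by rewrite -weight_simple; apply: (chev_weight (c0 := D) false i).
apply/eqP => e0; have := chev_form D i; rewrite e0 form0l => /eqP.
by rewrite eq_sym oner_eq0.
Qed.

Variables (T : algType K) (rho : {lrmorphism Y -> T}).
(* [G S] consists of the elements with right degrees in [S] *)
Variable G : (rootLattice I -> Prop) -> T -> Prop.
Hypothesis G_lin : forall S, lin (G S).
Hypothesis G_mul : forall (S S' S'' : rootLattice I -> Prop) x y,
  G S x -> G S' y -> (forall b c, S b -> S' c -> S'' (b + c)) -> G S'' (x * y).
Hypothesis G_sub : forall (S S' : rootLattice I -> Prop) x,
  (forall b, S b -> S' b) -> G S x -> G S' x.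
Hypothesis G_rho : forall S y, yangian_in S y -> G S (rho y).

Variables (L : T) (a bb : nat -> T) (w : rootLattice I -> T).
Hypothesis L_rho : forall y, L * rho y = rho y * L.
Hypothesis a_rho : forall k y, a k * rho y = rho y * a k.
Hypothesis w_rho : forall b y, w b * rho y = rho y * w b.
Hypothesis G_L : G (fun b => b = 0) L.
Hypothesis G_a : forall k, G (fun b => b = 0) (a k).
Hypothesis G_w : forall b, b \in pos_roots D -> G (fun b => b = 0) (w b).
Hypothesis L_a : forall k, cbr L (a k) = (4 * d) *: a k.+1.
Hypothesis L_HL : forall n, cbr L (HL d a n) = 0.
Hypothesis w_alphai : w alphai = a 0.

Let xi n := rho (yxi D i n).
Let p n := rho (yx D false i n).
Let m n := rho (yx D true i n).
Let E b := rho (iota (rvec D false b)).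
Let tau b := E b * E b + 2 *: (w b * E b).

Hypothesis bb0 : bb 0%N = a 0%N + p 0%N - m 0%N.
Hypothesis HH_bb : forall n,
  cbr (L + Hp xi + \sum_(b <- pos_roots D) ipQ D b alphai *: tau b) (bb n)
  = (4 * d) *: bb n.+1.

Let Th : T := (4 * d)^-1 *:
  \sum_(b <- rem alphai (pos_roots D)) ipQ D b alphai *: tau b.

Lemma rho_cbr x y : rho (cbr x y) = cbr (rho x) (rho y).
Proof. by rewrite /cbr rmorphB !rmorphM. Qed.
Lemma rho_abr x y : rho (abr x y) = abr (rho x) (rho y).
Proof. by rewrite /abr rmorphD !rmorphM. Qed.
Lemma rhoB x y : rho (x - y) = rho x - rho y. Proof. exact: rmorphB. Qed.
Lemma rhoZ c x : rho (c *: x) = c *: rho x. Proof. exact: linearZ. Qed.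

Lemma rho_xi_xi r s : cbr (xi r) (xi s) = 0.
Proof. by rewrite -rho_cbr yxi_yxi rmorph0. Qed.
Lemma rho_xi0_p s : cbr (xi 0) (p s) = (2 * d) *: p s.
Proof. by rewrite -rho_cbr yxi0_yx rhoZ expr0 mul1r ip_alpha. Qed.
Lemma rho_xi0_m s : cbr (xi 0) (m s) = (2 * - d) *: m s.
Proof. by rewrite -rho_cbr yxi0_yx rhoZ expr1 mulN1r ip_alpha mulrN. Qed.
Lemma rho_p_m r s : cbr (p r) (m s) = xi (r + s).
Proof. by rewrite -rho_cbr yx_yx eqxx. Qed.
Lemma rho_xi_p r s :
  cbr (xi r.+1) (p s) - cbr (xi r) (p s.+1) = d *: abr (xi r) (p s).
Proof. by rewrite -!rho_cbr -rhoB yxi_yx rhoZ rho_abr expr0 mul1r. Qed.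
Lemma rho_xi_m r s :
  cbr (xi r.+1) (m s) - cbr (xi r) (m s.+1) = (- d) *: abr (xi r) (m s).
Proof. by rewrite -!rho_cbr -rhoB yxi_yx rhoZ rho_abr expr1 mulN1r. Qed.
Lemma rho_m_m r s :
  cbr (m r.+1) (m s) - cbr (m r) (m s.+1) = (- d) *: abr (m r) (m s).
Proof. by rewrite -!rho_cbr -rhoB yx_yx_same rhoZ rho_abr expr1 mulN1r. Qed.

(** Since (alpha_i, alpha_i) = 2 d, the root alpha_i contributes 2 d (p_0^2 + 2 a_0 p_0) = 4 d
    (p_0^2 / 2 + a_0 p_0). This is the origin of the half in [Theta]. *)
Lemma HH_Th : HH d xi p L Th a =
  L + Hp xi + \sum_(b <- pos_roots D) ipQ D b alphai *: tau b.
Proof.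
rewrite /HH; congr (_ + _); rewrite (big_rem _ alphai_root) /=.
have -> : ipQ D alphai alphai = 2 * d by rewrite -ip_alpha.
have nz : 4 * d != 0 by rewrite mulf_neq0 ?dnum_neq0 ?(char0 3).
rewrite /Theta scalerDr [in LHS]/Th scalerA mulfV // scale1r; congr (_ + _).
rewrite /tau w_alphai /E rvec_simple iota_chev // -/(p 0).
have t0 := two_neq0_of_char0.
by nca K (@nil T); field.
Qed.

Let M0 := G (@Qnneg I).
Let M := G (@Qplus I).
Let Mi := G (fun b => Qnneg (b - alphai)).
Let M1 := G (fun b => Qplus (b - alphai)).

Lemma addr_shift (V : zmodType) (b c x : V) : b + c - x = b + (c - x).
Proof. by rewrite addrA. Qed.
Lemma addr_shiftr (V : zmodType) (b c x : V) : b + c - x = (b - x) + c.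
Proof. by rewrite addrAC. Qed.

Lemma subK_nneg b : Qnneg (b - alphai) -> Qplus b.
Proof. by move=> h; rewrite -(subrK alphai b); apply/QplusDr/simple_root_Qplus. Qed.

Let lM0 : lin M0. Proof. exact: G_lin. Qed.
Let lM : lin M. Proof. exact: G_lin. Qed.
Let lMi : lin Mi. Proof. exact: G_lin. Qed.
Let lM1 : lin M1. Proof. exact: G_lin. Qed.

Lemma degree_M_M0 x : M x -> M0 x. Proof. exact/G_sub/Qplus_nneg. Qed.
Lemma degree_Mi_M x : Mi x -> M x. Proof. exact/G_sub/subK_nneg. Qed.
Lemma degree_M1_Mi x : M1 x -> Mi x.
Proof. by apply: G_sub => b; apply: Qplus_nneg. Qed.
Lemma degree_M0M0 x y : M0 x -> M0 y -> M0 (x * y).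
Proof. by move=> hx hy; apply: G_mul hx hy _; apply: QnnegD. Qed.
Lemma degree_M0M x y : M0 x -> M y -> M (x * y).
Proof. by move=> hx hy; apply: G_mul hx hy _; apply: QplusDr. Qed.
Lemma degree_MM0 x y : M x -> M0 y -> M (x * y).
Proof. by move=> hx hy; apply: G_mul hx hy _; apply: QplusDl. Qed.
Lemma degree_M0Mi x y : M0 x -> Mi y -> Mi (x * y).
Proof.
by move=> hx hy; apply: G_mul hx hy _ => b c; rewrite addr_shift; apply: QnnegD.
Qed.
Lemma degree_MiM0 x y : Mi x -> M0 y -> Mi (x * y).
Proof.
by move=> hx hy; apply: G_mul hx hy _ => b c; rewrite addr_shiftr; apply: QnnegD.
Qed.
Lemma degree_M0M1 x y : M0 x -> M1 y -> M1 (x * y).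
Proof.
by move=> hx hy; apply: G_mul hx hy _ => b c; rewrite addr_shift; apply: QplusDr.
Qed.
Lemma degree_M1M0 x y : M1 x -> M0 y -> M1 (x * y).
Proof.
by move=> hx hy; apply: G_mul hx hy _ => b c; rewrite addr_shiftr; apply: QplusDl.
Qed.
Lemma degree_MMi x y : M x -> Mi y -> M1 (x * y).
Proof.
by move=> hx hy; apply: G_mul hx hy _ => b c; rewrite addr_shift; apply: QplusDl.
Qed.
Lemma degree_MiM x y : Mi x -> M y -> M1 (x * y).
Proof.
by move=> hx hy; apply: G_mul hx hy _ => b c; rewrite addr_shiftr; apply: QplusDr.
Qed.

Lemma G_ygen S c : S (ydeg c) -> G S (rho (ygenerator D c)).
Proof.
by move=> Sc; apply: G_rho; apply: yangian_in_homog Sc; apply: yhomog_generator.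
Qed.

Lemma degree_p r : Mi (p r).
Proof. by apply: G_ygen => /=; rewrite subrr => k; rewrite ffunE. Qed.
Lemma degree_xi r : M0 (xi r).
Proof. by apply: G_ygen => /= k; rewrite ffunE. Qed.
Lemma degree_m r : G (fun b => b = - alphai) (m r).
Proof. exact: (G_ygen (c := inr (true, i, r))). Qed.
Lemma degree_0 x : G (fun b => b = 0) x -> M0 x.
Proof. by apply: G_sub => b -> k; rewrite ffunE. Qed.
Lemma degree_1 : M0 1.
Proof.
rewrite -(rmorph1 rho); apply/G_rho/(yangian_in_homog (yhomog1 D)) => k.
by rewrite ffunE.
Qed.
Lemma degree_Mim x s : Mi x -> M0 (x * m s).
Proof. by move=> hx; apply: G_mul hx (degree_m s) _ => b c hb ->. Qed.
Lemma degree_mMi x s : Mi x -> M0 (m s * x).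
Proof. by move=> hx; apply: G_mul (degree_m s) hx _ => b c -> hc; rewrite addrC. Qed.
Lemma degree_M1m x s : M1 x -> M (x * m s).
Proof. by move=> hx; apply: G_mul hx (degree_m s) _ => b c hb ->. Qed.
Lemma degree_mM1 x s : M1 x -> M (m s * x).
Proof. by move=> hx; apply: G_mul (degree_m s) hx _ => b c -> hc; rewrite addrC. Qed.

Let X k := rho (yx D false k 0).
Local Notation Z := (alt m 0).

Lemma Xj_m j s : j != i -> X j * m s = m s * X j.
Proof.
move=> ne; apply/eqP; rewrite -subr_eq0 -/(cbr _ _) -rho_cbr yx_yx (negPf ne).
by rewrite rmorph0.
Qed.

Lemma rho_cword j v : rho (cword (fun k => yx D false k 0) j v) = cword X j v.
Proof. by elim: v => //= k v <-; rewrite rho_cbr. Qed.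

Lemma E_words b : b \in pos_roots D ->
  lspan (fun y => exists j v, wdeg j v = b /\ y = cword X j v) (E b).
Proof.
move=> bP; have := iota_rvec iota_incl char0 bP; rewrite /E.
elim=> [|c x y [j [v [jv ->]]] _ IH]; first by rewrite rmorph0; apply: lspan0.
rewrite linearP /= rho_cword; apply: lspanD => //; apply/lspanZ/lspan_gen.
by exists j, v.
Qed.

Lemma G_cword j v : G (fun b => b = wdeg j v) (cword X j v).
Proof.
rewrite -rho_cword; apply: G_rho.
by apply: yangian_in_homog (cword_homog D j v) _.
Qed.

Lemma G_E b : b \in pos_roots D -> G (fun c => c = b) (E b).
Proof.
move=> bP; elim: (E_words bP) => [|c x y [j [v [<- ->]]] _ IH]; first exact: linp0.
by apply: linpD => //; apply: linpZ => //; apply: G_cword.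
Qed.

Lemma G_Em b s : b \in pos_roots D -> G (fun c => c = b - alphai) (cbr (E b) (m s)).
Proof.
move=> bP; apply: linpB => //.
  by apply: G_mul (G_E bP) (degree_m s) _ => b' c -> ->.
by apply: G_mul (degree_m s) (G_E bP) _ => b' c -> ->; rewrite addrC.
Qed.

Lemma E_comm b s : b \in pos_roots D -> b i = 0 -> E b * m s = m s * E b.
Proof.
move=> bP bi; elim: (E_words bP) => [|c x y [j [v [jv ->]]] _ IH].
  by rewrite mul0r mulr0.
rewrite mulrDl mulrDr IH -scalerAl -scalerAr (@cword_comm _ _ _ i) //.
  exact: Xj_m.
apply/count_memPn; have /ffunP /(_ i) := jv.
by rewrite wdegE bi => -[].
Qed.

Lemma Dd_E b s : b \in pos_roots D -> b i = 1 -> b != alphai ->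
  Dd d m s (cbr (scst (E b)) Z) = 0.
Proof.
move=> bP bi ne; elim: (E_words bP) => [|c x y [j [v [jv ->]]] _ IH].
  have -> : scst (0 : T) = 0 by apply/funext => -[|n].
  by rewrite cbr0l Dd0.
have -> : cbr (scst (c *: cword X j v + y)) Z =
  c *: cbr (scst (cword X j v)) Z + cbr (scst y) Z.
  by rewrite scstD scstZ; nca K (@nil (ser T)); ring.
rewrite DdD DdZ IH addr0 (@Dd_cword _ _ _ _ i _ xi) //.
- case: v jv => [e|*]; last by rewrite scaler0.
  have ej : b = simple_root j by rewrite -e /wdeg big_nil addr0.
  move: ne bi; rewrite ej ffunE; case: (eqVneq i j) => [->|//].
  by rewrite eqxx.
- exact: rho_xi0_m.
- by move=> r; rewrite rho_p_m.
- exact: rho_xi_m.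
- exact: Xj_m.
by have /ffunP /(_ i) := jv; rewrite wdegE bi => -[].
Qed.

Lemma E_double : alphai + alphai \in pos_roots D -> E (alphai + alphai) = 0.
Proof.
move=> bP; elim: (E_words bP) => [|c x y [j [v [jv ->]]] _ ->] //.
have [-> ->] := wdeg_double jv.
by rewrite addr0 /= /cbr subrr scaler0.
Qed.

Lemma tau_ok b : b \in pos_roots D -> b != alphai -> root_ok d xi m a M (tau b).
Proof.
move=> bP ne; have /pos_rootsP [bQ _] := bP.
have Mw : M0 (w b) by apply/degree_0/G_w.
have wm r : w b * m r = m r * w b by apply: w_rho.
have [bi|bi] := eqVneq (b i) 0.
  apply: (@root_ok_comm _ _ _ _ _ rho_xi0_m rho_xi_m _ _ M0 M) => //.
  - by move=> k r; apply: a_rho.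
  - exact: degree_M_M0.
  - exact: degree_M0M.
  - exact: degree_MM0.
  - by apply: G_sub (G_E bP) => c ->.
  - by move=> r; apply: E_comm.
have b1 : Qplus (b - alphai).
  apply: Qplus_of_nneg; last by rewrite subr_eq0.
  move=> k; rewrite !ffunE; have := Qplus_nneg bQ k.
  case: eqVneq => [->|_]; last by rewrite subr0.
  by move: bi; case: (b i) => [[|n]|n] //= _ _; rewrite subr_ge0.
have M1E : M1 (E b) by apply: G_sub (G_E bP) => c ->.
have MEm s : M (cbr (E b) (m s)) by apply: G_sub (G_Em s bP) => c ->.
apply: (@root_ok_gt _ _ _ _ _ _ M0 M Mi M1) => //.
- exact: degree_M_M0.
- exact: degree_Mi_M.
- exact: degree_M1_Mi.
- exact: degree_M0M0.
- exact: degree_M0M.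
- exact: degree_MM0.
- exact: degree_M0M1.
- exact: degree_M1M0.
- exact: degree_MMi.
- exact: degree_MiM.
- exact: degree_1.
- exact: degree_xi.
- by move=> k; apply/degree_0/G_a.
- exact: degree_M1m.
- exact: degree_mM1.
move=> s; have [bi1|bi1] := eqVneq (b i) 1.
  by rewrite Dd_E // => n; apply: linp0.
have [bd|bd] := eqVneq b (alphai + alphai).
  rewrite bd E_double -?bd //.
  have -> : scst (0 : T) = 0 by apply/funext => -[|n].
  by rewrite cbr0l Dd0 => n; apply: linp0.
apply: (@cf_Dd _ _ _ _ M M1) => //.
- exact: degree_M1m.
- exact: degree_mM1.
(* Now alpha_i occurs at least twice in b and b <> 2 alpha_i, so [E b, m_n] still has degree in
   alpha_i + Q_+ and [cf_Dd] applies. *)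
have b2 : Qplus (b - alphai - alphai).
  apply: Qplus_of_nneg; last by rewrite subr_eq0 subr_eq.
  move=> k; rewrite !ffunE; have := Qplus_nneg bQ k.
  case: eqVneq => [->|_]; last by rewrite !subr0.
  move: bi bi1; case: (b i) => [[|[|n]]|n] //= _ _ _.
move=> [|n]; rewrite scst_ser_cbr /=; first by rewrite cbr0r; apply: linp0.
have -> : cbr (E b) ((-1) ^+ n.+1 *: m n) = (-1) ^+ n.+1 *: cbr (E b) (m n).
  by nca K (@nil T); ring.
by apply: linpZ => //; apply: G_sub (G_Em n bP) => c ->.
Qed.

Lemma Th_ok : root_ok d xi m a M Th.
Proof.
have lR : lin (root_ok d xi m a M) by apply: lin_root_ok.
apply: linpZ => //; rewrite big_seq; apply: linp_sum => // b bR.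
apply: linpZ => //; apply: tau_ok; first exact: mem_rem bR.
by apply: contraTneq bR => ->; rewrite mem_rem_uniqF // pos_roots_uniq.
Qed.

Lemma HH_bb_Th n : cbr (HH d xi p L Th a) (bb n) = (4 * d) *: bb n.+1.
Proof. by rewrite HH_Th HH_bb. Qed.

Let t0 := two_neq0_of_char0.
Let d0 := dnum_neq0.

Local Ltac class_rule := first
  [ by move=> *; apply: L_rho | by move=> *; apply: a_rho
  | exact: degree_M_M0 | exact: degree_Mi_M | exact: degree_M1_Mi | exact: degree_M0M0
  | exact: degree_M0M | exact: degree_MM0 | exact: degree_M0Mi | exact: degree_MiM0
  | exact: degree_M0M1 | exact: degree_M1M0 | exact: degree_MMi | exact: degree_MiM
  | exact: degree_1 | exact: degree_xi | by move=> k; apply/degree_0/G_a | exact: degree_0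
  | exact: degree_p | exact: degree_Mim | exact: degree_mMi | exact: degree_M1m | exact: degree_mM1 ].

Theorem graded_FU : cf M (FU d bb - HL d a * (XI xi * XM xi)).
Proof.
have [Th1 Th2 Th3] := Th_ok.
apply: (@FU_mod _ _ _ t0 d0 xi p m rho_xi_xi rho_xi0_p rho_xi0_m rho_p_m rho_xi_p rho_xi_m
  rho_m_m L Th a bb _ _ _ _ _ _ L_a L_HL bb0 HH_bb_Th M0 M Mi M1) => //;
  class_rule.
Qed.

Theorem graded_BU : cf M (gen bb - alt m 0 - gen a * XM xi).
Proof.
have [Th1 Th2 Th3] := Th_ok.
apply: (@BU_mod _ _ _ t0 d0 xi p m rho_xi_xi rho_xi0_p rho_xi0_m rho_p_m rho_xi_p rho_xi_m
  L Th a bb _ _ _ _ _ _ L_a L_HL bb0 HH_bb_Th M0 M Mi M1) => //;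
  class_rule.
Qed.

Theorem graded_err (N : T -> Prop) : (forall k, a k = 0) -> lin N ->
  cf N (cbr (scst Th) Z + cbr (scst (2^-1 *: (p 0%N * p 0%N) + Th)) (Xs xi p)) ->
  (forall x, N x -> N (cbr (L + Hp xi +
     \sum_(b <- pos_roots D) ipQ D b alphai *: tau b) x)) ->
  cf N (gen bb - Z - Xs xi p).
Proof.
rewrite -HH_Th => a0 lN Nsrc NHH; rewrite -(@err0 _ _ d xi p m a bb) //; move: NHH.
apply: (@err_in _ _ _ t0 d0 xi p m rho_xi_xi rho_xi0_p rho_xi0_m rho_p_m rho_xi_p rho_xi_m
  L Th a bb _ _ _ _ _ _ L_a L_HL bb0 HH_bb_Th N) => //; try class_rule.
by rewrite (@src0 _ _ d xi p m Th a).
Qed.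

End Graded.

(** * The twisted Yangian *)

Section TwistedRelations.
Variables (K : fieldType) (g : lieAlgebra K) (I : finType).
Hypothesis two_neq0 : 2 != 0 :> K.
Variables (D : chevalleyData g I) (i : I).
Local Notation tY := (twisted_yangian D).
Local Notation d := (dnum D i).

Lemma th_neg1 : th D i (-1) = 1 :> tY. Proof. exact: rmorph1. Qed.

Lemma th_even n : ~~ odd n -> th D i n%:Z = 0 :> tY.
Proof. by move=> /negPf e; rewrite /th /= e rmorph0. Qed.

Lemma th_th (r s : nat) : cbr (th D i r) (th D i s) = 0 :> tY.
Proof. by have := apr_rel (trel_h_h D i i r s); rewrite apr_cbr rmorph0. Qed.

Lemma ip_dnum : ip D i i = 2 * d.
Proof. by rewrite /dnum mulrCA mulfV ?mulr1. Qed.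

(** At r = 0 the relation involves h_{i,-1} = 1: its commutators vanish, and its anticommutator with
    b_{i,s+1} doubles (alpha_i, alpha_i) = 2 d. *)
Lemma th1_tb s : cbr (th D i 1) (tb D i s) = (4 * d) *: tb D i s.+1 :> tY.
Proof.
have := apr_rel (trel_h_b D i i 0 s); rewrite ip_dnum /= aprB !apr_cbr.
rewrite aprD !aprZ apr_abr apr_cbr.
rewrite rmorph1 -/(th D i 1) -/(tb D i s) -/(tb D i s.+1) -/(tb D i s.+2) => e.
have {e} -> : cbr (th D i 1) (tb D i s) =
  (2 * d) *: abr 1 (tb D i s.+1) + ((2 * d) ^+ 2 / 4) *: cbr 1 (tb D i s)
   + cbr 1 (tb D i s.+2) :> tY by rewrite -e subrK.
by nca K (@nil tY); ring.
Qed.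

Lemma tb_tb r s : cbr (tb D i r.+1) (tb D i s) - cbr (tb D i r) (tb D i s.+1) =
  d *: abr (tb D i r) (tb D i s) - (2 * (-1) ^+ s) *: th D i (r + s).+1 :> tY.
Proof.
have := apr_rel (trel_b_b D i i r s).
rewrite [X in X = _ -> _]aprB [X in _ = X -> _]aprB !apr_cbr !aprZ apr_abr.
by rewrite eqxx mulr1 -!PoszD addn1.
Qed.

(* Summing the relation [tb_tb] over r + s = n telescopes its left-hand side. *)
Lemma th_succ n : th D i n.+1 =
  d *: \sum_(k < n.+1) tb D i k * tb D i (n - k)%N
  - cbr (tb D i n.+1) (tb D i 0) :> tY.
Proof.
have tele : \sum_(0 <= k < n.+1) (cbr (tb D i (n - k).+1) (tb D i k)
    - cbr (tb D i (n - k)%N) (tb D i k.+1)) = 2 *: cbr (tb D i n.+1) (tb D i 0) :> tY.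
  pose f k : tY := - cbr (tb D i (n.+1 - k)%N) (tb D i k).
  rewrite (eq_big_nat _ _ (F2 := fun k => f k.+1 - f k)); last first.
    by move=> k /andP [_ kn]; rewrite /f subSS opprK addrC subSn.
  rewrite telescope_sumr // /f subnn subn0.
  by nca K (@nil tY); ring.
(* The alternating sum of signs is 1 for n even; for n odd it is 0, but then h_{i,n+1} = 0 as
   well. *)
have sgn : \sum_(0 <= k < n.+1) (2 * (-1) ^+ k) *: th D i n.+1 = 2 *: th D i n.+1 :> tY.
  have [on|en] := boolP (odd n); last first.
    rewrite -scaler_suml -mulr_sumr; congr (_ *: _).
    suff -> : \sum_(0 <= k < n.+1) (-1) ^+ k = 1 :> K by rewrite mulr1.
    rewrite -[n]odd_double_half (negPf en) add0n.
    elim: (n./2) => [|k IH]; first by rewrite big_nat1.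
    by rewrite doubleS !(big_nat_recr _.+1) //= IH !exprS; ring.
  by rewrite th_even ?scaler0 ?big1 // => [k _|]; rewrite ?scaler0 //= negbK.
have sab : \sum_(0 <= k < n.+1) abr (tb D i (n - k)%N) (tb D i k) =
   2 *: \sum_(k < n.+1) tb D i k * tb D i (n - k)%N :> tY.
  rewrite big_mkord big_split /= (reindex_inj rev_ord_inj) /=.
  rewrite scaler_nat mulr2n; congr (_ + _); apply: eq_bigr => k _.
  by rewrite subSS subKn // -ltnS.
have : 2 *: cbr (tb D i n.+1) (tb D i 0) =
  d *: (2 *: \sum_(k < n.+1) tb D i k * tb D i (n - k)%N) - 2 *: th D i n.+1 :> tY.
  rewrite -tele -sab -sgn scaler_sumr -sumrB; apply: eq_big_nat => k /andP [_ kn].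
  by rewrite tb_tb subnK // -ltnS.
move=> e; apply: (scalerI two_neq0); apply/eqP; rewrite -subr_eq0; apply/eqP.
set x := \sum_(k < _) _ in e *.
have -> : 2 *: th D i n.+1 - 2 *: (d *: x - cbr (tb D i n.+1) (tb D i 0)) =
  2 *: cbr (tb D i n.+1) (tb D i 0) - (d *: (2 *: x) - 2 *: th D i n.+1) :> tY.
  by nca K (@nil tY); ring.
by rewrite e subrr.
Qed.

Lemma h_seriesE : h_series D i = FU d (tb D i) :> ser tY.
Proof.
apply/funext => -[|[|n]]; rewrite /FU serB serD serZ ser_cbr_scst /=.
(* The first two coefficients are h_{i,-1} = 1 and h_{i,0} = 0; the latter matches
   [b_{i,0}, b_{i,0}] = 0. *)
- by rewrite serM big_ord1 /= mul0r scaler0 addr0 cbr0l subr0; apply: th_neg1.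
- rewrite serM !big_ord_recl big_ord0 /= mul0r mulr0 !addr0 scaler0 add0r.
  by rewrite /cbr subrr subr0; apply: (th_even (n := 0)).
rewrite -[gen _]/(sh (tb D i : ser tY)) shMl shMr /= add0r.
by rewrite serM -th_succ.
Qed.

End TwistedRelations.

(** * Algebra morphisms and the algebra behind the coproduct of h_{i,1} *)

Section FUMorphism.
Variables (K : fieldType) (A B : algType K).

Lemma FU_lrmorph (f : {lrmorphism A -> B}) d (b : nat -> A) n :
  FU d (fun k => f (b k)) n = f (FU d b n).
Proof.
have fE x y z : f (x + d *: y - z) = f x + d *: f y - f z.
  by rewrite linearB linearD linearZ.
rewrite /FU !serB !serD !serZ !ser_cbr_scst fE.
congr (_ + _ *: _ - _).
- by case: n => [|n]; rewrite ser1 /= ?rmorph1 ?rmorph0.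
- rewrite !serM rmorph_sum; apply: eq_bigr => k _; rewrite rmorphM.
  by case: (k : nat) => [|k']; case: (n - _)%N => [|l]; rewrite /= ?rmorph0 ?mul0r ?mulr0.
by rewrite /cbr rmorphB !rmorphM; case: n => [|n]; rewrite /= ?rmorph0.
Qed.

(** Meant for e, f the left copies of x_alpha^+, x_alpha^- and r the right copy of x_alpha^+: the
    cross term 2 e r is split as 2 (e - f) r + 2 f r. *)
Lemma coproduct_square (c : K) (e f r : A) : e * r = r * e -> f * r = r * f ->
  c *: (e + r) ^+ 2 = c *: e ^+ 2 + c *: (r * r + 2 *: ((e - f) * r))
    + 2 *: (c *: (f * r)).
Proof. by move=> er fr; nca K [:: e; f]; ring. Qed.

(** The cross term 2 l0 r0 of the square cancels the product in the coproduct of xi_{i,1}, and s3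
    absorbs what [coproduct_square] splits off. *)
Lemma coproduct_quadratic (l1 l0 r1 r0 s1 s2 s3 : A) : l0 * r0 = r0 * l0 ->
  2 *: l1 - l0 ^+ 2 + s1 + (2 *: r1 - r0 ^+ 2) + s2 =
  2 *: (l1 + r1 + l0 * r0 - s3) - (l0 + r0) ^+ 2 + (s1 + s2 + 2 *: s3).
Proof.
move=> lr; have -> : (l0 + r0) ^+ 2 = l0 ^+ 2 + 2 *: (l0 * r0) + r0 ^+ 2.
  by nca K [:: l0]; ring.
by nca K (@nil A); ring.
Qed.

Lemma lrmorph_quadratic (f : {lrmorphism A -> B}) c x y (J : Type) (r : seq J)
  (k : J -> K) (z : J -> A) :
  f (c *: x - y ^+ 2 + \sum_(b <- r) k b *: z b ^+ 2) =
  c *: f x - f y ^+ 2 + \sum_(b <- r) k b *: f (z b) ^+ 2.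
Proof.
rewrite linearD linearB linearZ /= rmorphXn linear_sum; congr (_ + _).
by apply: eq_bigr => b _; rewrite linearZ /= rmorphXn.
Qed.

Lemma lrmorph_cbr (f : {lrmorphism A -> B}) x y : f (cbr x y) = cbr (f x) (f y).
Proof. by rewrite /cbr rmorphB !rmorphM. Qed.

Lemma lrmorphB (f : {lrmorphism A -> B}) x y : f (x - y) = f x - f y.
Proof. exact: rmorphB. Qed.

Lemma lrmorphZ (f : {lrmorphism A -> B}) c x : f (c *: x) = c *: f x.
Proof. exact: linearZ. Qed.

Variable f : A -> B.
Hypotheses (f_linear : linear f) (f_mon : monoid_morphism f).

Definition lrmorph_of : {lrmorphism A -> B} :=
  HB.pack f (GRing.isLinear.Build K A B _ f f_linear)
    (GRing.isMonoidMorphism.Build A B f f_mon).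

Lemma FU_morph d (b : nat -> A) n : FU d (fun k => f (b k)) n = f (FU d b n).
Proof. exact: (FU_lrmorph lrmorph_of). Qed.

Lemma morph_cbr x y : f (cbr x y) = cbr (f x) (f y).
Proof.
rewrite -[f]/(lrmorph_of : A -> B) /cbr.
by rewrite rmorphB !rmorphM.
Qed.

End FUMorphism.

(** * The algebra Y (x) Y *)

Lemma tensor_scaleAl (K : fieldType) (A B : algType K) (c : K) (x y : tensor A B) :
  c *: (x * y) = (c *: x) * y.
Proof. exact: esym (linZ c x (tmul_linear_l y)). Qed.

Lemma tensor_scaleAr (K : fieldType) (A B : algType K) (c : K) (x y : tensor A B) :
  c *: (x * y) = x * (c *: y).
Proof. exact: esym (linZ c y (tmul_linear_r x)). Qed.

Section TensorSquare.
Variables (K : fieldType) (g : lieAlgebra K) (I : finType) (D : chevalleyData g I).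
Local Notation Y := (yangian D).

(** The augmentation sending all generators to 0. Applied to both factors, it shows that 1 <> 0 in
    the tensor square, as the algebra structure demands. *)
Definition yeps (y : Y) : K := faug (projT1 (cid (aprP y))).

Lemma yeps_apr x : yeps (apr (yangian_rel D) x) = faug x.
Proof.
rewrite /yeps; case: cid => z /= /qpi_eq xz; apply/esym/eqP.
rewrite -subr_eq0 -faugB; apply/eqP.
elim: xz => [|c u v [a [b [x' [y' [r ->]]]]] _ IH]; first exact: faug0.
rewrite faugD faugZ IH addr0 !rmorphM rmorphB /= (faug_yangian r) subrr.
by rewrite mulr0 mul0r mulr0.
Qed.

Lemma yeps_linear : linear (yeps : Y -> K^o).
Proof.
move=> c x y; case: (aprP x) (aprP y) => u -> [v ->].
by rewrite -linearP !yeps_apr faugD faugZ.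
Qed.

Definition yangian2 := tensor Y Y.
HB.instance Definition _ := GRing.Lmodule.on yangian2.
HB.instance Definition _ := GRing.PzRing.on yangian2.

Fact yangian2_1_neq0 : (1 : yangian2) != 0.
Proof.
pose f (x y : Y) : K^o := yeps x * yeps y.
have fl w : linear (f^~ w) by move=> c x y; rewrite /f yeps_linear mulrDl scalerAl.
have fr v : linear (f v) by move=> c x y; rewrite /f yeps_linear mulrDr scalerAr.
apply/eqP => e; have : tlift f (1 : yangian2) = 0.
  by rewrite e (lin0 (tlift_linear fl fr)).
rewrite -[1 : yangian2]/(tens 1 1) tlift_tens // /f.
have -> : yeps 1 = 1 by rewrite -[1 : Y]/(apr (yangian_rel D) 1) yeps_apr rmorph1.
by move/eqP; rewrite mulr1 oner_eq0.
Qed.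
HB.instance Definition _ :=
  GRing.PzSemiRing_isNonZero.Build yangian2 yangian2_1_neq0.

Fact yangian2_scaleAl (c : K) (x y : yangian2) : c *: (x * y) = (c *: x) * y.
Proof. exact: tensor_scaleAl. Qed.
HB.instance Definition _ := GRing.Lmodule_isLalgebra.Build K yangian2 yangian2_scaleAl.

Fact yangian2_scaleAr (c : K) (x y : yangian2) : c *: (x * y) = x * (c *: y).
Proof. exact: tensor_scaleAr. Qed.
HB.instance Definition _ := GRing.Lalgebra_isAlgebra.Build K yangian2 yangian2_scaleAr.

Definition tensl (x : Y) : yangian2 := tens x 1.
Definition tensr (x : Y) : yangian2 := tens 1 x.

Lemma tensM (a b a' b' : Y) :
  (tens a b : yangian2) * tens a' b' = tens (a * a') (b * b').
Proof. exact: tmul_tens. Qed.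

Fact tensl_linear : linear tensl. Proof. exact: tens_linear_l. Qed.
HB.instance Definition _ := GRing.isLinear.Build K Y yangian2 _ tensl tensl_linear.
Fact tensl_monoid : monoid_morphism tensl.
Proof. by split=> // x y; rewrite /tensl tensM mulr1. Qed.
HB.instance Definition _ := GRing.isMonoidMorphism.Build Y yangian2 tensl tensl_monoid.
Fact tensr_linear : linear tensr. Proof. exact: tens_linear_r. Qed.
HB.instance Definition _ := GRing.isLinear.Build K Y yangian2 _ tensr tensr_linear.
Fact tensr_monoid : monoid_morphism tensr.
Proof. by split=> // x y; rewrite /tensr tensM mulr1. Qed.
HB.instance Definition _ := GRing.isMonoidMorphism.Build Y yangian2 tensr tensr_monoid.

Lemma tensE2 x y : tens x y = tensl x * tensr y :> yangian2.
Proof. by rewrite tensM mulr1 mul1r. Qed.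

Lemma tensl_r x y : tensl x * tensr y = tensr y * tensl x.
Proof. by rewrite !tensM !mul1r !mulr1. Qed.

End TensorSquare.

(** * The congruences for h_i(u) and b_i(u) in the Yangian *)

Section Claims.
Variables (K : fieldType) (g : lieAlgebra K) (I : finType).
Hypothesis char0 : forall n : nat, n.+1%:R != 0 :> K.
Variables (D : chevalleyData g I) (iota : g -> yangian D).
Variables (Delta : yangian D -> tensor (yangian D) (yangian D)).
Variable phi : twisted_yangian D -> yangian D.
Hypothesis iota_incl : is_g_inclusion iota.
Hypothesis Delta_cop : is_coproduct iota Delta.
Hypothesis phi_emb : is_coideal_embedding iota Delta phi.
Variable i : I.

Local Notation Y := (yangian D).
Local Notation YY := (yangian2 D).
Local Notation tY := (twisted_yangian D).
Local Notation d := (dnum D i).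
Local Notation alphai := (simple_root i).
Local Notation E b := (iota (rvec D false b)).
Local Notation F b := (iota (rvec D true b)).

Let phi_linear : linear phi. Proof. by case: phi_emb. Qed.
Let phi_mon : monoid_morphism phi. Proof. by case: phi_emb. Qed.
Let phi1 : phi 1 = 1. Proof. by case: phi_mon. Qed.
Let phiM x y : phi (x * y) = phi x * phi y. Proof. by case: phi_mon. Qed.
Let phi_cbr x y : phi (cbr x y) = cbr (phi x) (phi y).
Proof. exact: morph_cbr. Qed.
Let phiZ c x : phi (c *: x) = c *: phi x. Proof. exact: linZ. Qed.

Let bY n := phi (tb D i n).

Lemma phi_tb0 : bY 0 = yx D false i 0 - yx D true i 0.
Proof.
have [_ _ _ [e _] _] := phi_emb.
by rewrite /bY e !(iota_chev iota_incl).
Qed.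

Lemma phi_th1 : phi (th D i 1) = 2 *: yxi D i 1 - yxi D i 0 ^+ 2
  + \sum_(b <- pos_roots D) ipQ D b alphai *: E b ^+ 2.
Proof. by have [_ _ _ [_ e] _] := phi_emb; apply: e. Qed.

Lemma phi_th1_tb n : cbr (phi (th D i 1)) (bY n) = (4 * d) *: bY n.+1.
Proof. by rewrite -phi_cbr (th1_tb (char0 1)) phiZ. Qed.

Lemma yangian_HH : 0 + Hp (yxi D i)
    + \sum_(b <- pos_roots D) ipQ D b alphai *: (E b * E b + 2 *: (0 * E b))
  = phi (th D i 1).
Proof.
rewrite phi_th1 add0r; congr (_ + _); apply: eq_bigr => b _.
by rewrite mul0r scaler0 addr0 expr2.
Qed.

Lemma HL_0 (T : algType K) : HL d (fun _ : nat => 0 : T) = 1.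
Proof. exact: HL0. Qed.

Lemma yangian_in_lin S : lin (@yangian_in _ _ _ D S).
Proof. exact: lin_lspan. Qed.

Lemma claim_h : cf (yangian_in (@Qplus I))
  ((fun n => phi (h_series D i n)) - XI (yxi D i) * XM (yxi D i) : ser Y).
Proof.
have := @graded_FU _ _ _ char0 D iota iota_incl i Y idfun (@yangian_in _ _ _ D)
  yangian_in_lin (@yangian_inM _ _ _ D) (@yangian_in_sub _ _ _ D) _
  0 (fun=> 0) bY (fun=> 0).
have -> : FU d bY = (fun n => phi (h_series D i n)).
  apply/funext => n; rewrite (h_seriesE (char0 1)).
  exact: (FU_morph phi_linear phi_mon).
rewrite HL_0 mul1r; apply => //=.
- by move=> y; rewrite mul0r mulr0.
- by move=> k y; rewrite mul0r mulr0.
- by move=> b y; rewrite mul0r mulr0.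
- exact: lspan0.
- by move=> k; apply: lspan0.
- by move=> b _; apply: lspan0.
- by move=> k; rewrite cbr0l scaler0.
- by move=> n; rewrite cbr0l.
- by rewrite phi_tb0 add0r.
by move=> n; rewrite -phi_th1_tb; congr cbr; rewrite -yangian_HH.
Qed.

Lemma ge0_E b : b \in pos_roots D -> yangian_ge0_in (fun c => c = b) (E b).
Proof.
move=> bP; apply: lspan_mono (iota_rvec iota_incl char0 bP) => y [j [w [jw ->]]].
apply: lspan_gen; split; first exact: cword_ge0.
by exists b => //; rewrite -jw; apply: cword_homog.
Qed.

Lemma yhomog_cbr b c (x y : Y) : yhomog b x -> yhomog c y -> yhomog (b + c) (cbr x y).
Proof.
move=> hx hy; apply: lspanD; first exact: yhomogM.
by apply: lspanN; rewrite addrC; apply: yhomogM.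
Qed.

Lemma ge0_Em b n : b \in pos_roots D ->
  yangian_ge0_in (fun c => c = b - alphai) (cbr (E b) (yx D true i n)).
Proof.
move=> bP; elim: (iota_rvec iota_incl char0 bP) => [|c x y [j [w [jw ->]]] _ IH].
  by rewrite cbr0l; apply: lspan0.
have -> : forall u : Y, cbr (c *: u + y) (yx D true i n) =
   c *: cbr u (yx D true i n) + cbr y (yx D true i n).
  by move=> u; nca K (@nil Y); ring.
apply: lspanD => //; apply/lspanZ/lspan_gen; split; first exact: cword_m_ge0.
exists (b - alphai) => //; rewrite -jw; apply: yhomog_cbr; first exact: cword_homog.
exact: (yhomog_generator D (inr (true, i, n))).
Qed.

Lemma ge0_lin S : lin (@yangian_ge0_in _ _ _ D S).
Proof. exact: lin_lspan. Qed.

Lemma ge0_gen S (c : ygen I) : yangian_ge0 (ygenerator D c) -> S (ydeg c) ->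
  yangian_ge0_in S (ygenerator D c).
Proof.
move=> c0 Sc; apply: lspan_gen; split=> //.
by exists (ydeg c) => //; apply: yhomog_generator.
Qed.

Lemma ge0_cbr (S S' S'' : rootLattice I -> Prop) (x y : Y) :
  yangian_ge0_in S x -> yangian_ge0_in S' y ->
  (forall b c, S b -> S' c -> S'' (b + c)) -> yangian_ge0_in S'' (cbr x y).
Proof.
move=> hx hy SS; apply: linpB; first exact: ge0_lin.
  exact: yangian_ge0_inM hx hy SS.
by apply: yangian_ge0_inM hy hx _ => b c Sb Sc; rewrite addrC; apply: SS.
Qed.

Let N : Y -> Prop := yangian_ge0_in (shift_Qplus i).

Lemma ge0_E2 b : b \in pos_roots D -> yangian_ge0_in (@Qplus I) (E b * E b).
Proof.
move=> bP; have /pos_rootsP [bQ _] := bP.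
apply: yangian_ge0_inM (ge0_E bP) (ge0_E bP) _ => b1 b2 -> ->.
by apply: QplusDl => //; apply: Qplus_nneg.
Qed.

(** If alpha_i does not occur in b the bracket is 0. Otherwise its degree is 2 b - alpha_i = alpha_i
    + 2 (b - alpha_i), with b - alpha_i in Q_+. *)
Lemma ge0_E2m b n : b \in pos_roots D -> b != alphai ->
  N (cbr (E b * E b) (yx D true i n)).
Proof.
move=> bP ne; have /pos_rootsP [bQ _] := bP.
have [bi|bi] := eqVneq (b i) 0.
  have e : E b * yx D true i n = yx D true i n * E b.
    exact: (@E_comm _ _ _ char0 D iota iota_incl i Y idfun b n bP bi).
  have -> : cbr (E b * E b) (yx D true i n) = 0.
    by rewrite /cbr -mulrA e mulrA e -mulrA subrr.
  exact: lspan0.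
have -> : cbr (E b * E b) (yx D true i n) =
   E b * cbr (E b) (yx D true i n) + cbr (E b) (yx D true i n) * E b.
  by nca K (@nil Y); ring.
have b1 : Qplus (b - alphai).
  apply: Qplus_of_nneg; last by rewrite subr_eq0.
  move=> k; rewrite !ffunE; have := Qplus_nneg bQ k.
  case: eqVneq => [->|_]; last by rewrite subr0.
  by move: bi; case: (b i) => [[|k']|k'] //= _ _; rewrite subr_ge0.
have shift b1' b2' : b1' = b -> b2' = b - alphai -> shift_Qplus i (b1' + b2').
  move=> -> ->; exists ((b - alphai) + (b - alphai)).
    by apply: QplusDl => //; apply: Qplus_nneg.
  by rewrite !addrA [alphai + b]addrC addrK.
apply: linpD; first exact: ge0_lin.
  by apply: yangian_ge0_inM (ge0_E bP) (ge0_Em n bP) _ => b1' b2'; apply: shift.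
apply: yangian_ge0_inM (ge0_Em n bP) (ge0_E bP) _ => b1' b2' h1 h2.
by rewrite addrC; apply: shift.
Qed.

Lemma ge0_XM : cf (yangian_ge0_in (fun b => b = 0)) (XM (yxi D i)).
Proof.
move=> n; apply: lspanZ; case: n => [|n] /=.
  apply: lspan_gen; split; last by exists 0 => //; apply: yhomog1.
  by rewrite -[1]scale1r; apply: yge0_scalar.
by apply: (ge0_gen (c := inl (i, n))) => //; apply: yge0_xi.
Qed.

Lemma ge0_Xs : cf (yangian_ge0_in (fun b => b = alphai)) (Xs (yxi D i) (yx D false i)).
Proof.
apply: cfZ; first exact: ge0_lin.
have hp : cf (yangian_ge0_in (fun b => b = alphai)) (gen (yx D false i)).
  move=> [|n] /=; first exact: lspan0.
  by apply: (ge0_gen (c := inr (false, i, n))) => //; apply: yge0_x.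
apply: (cf_abr _ _ _ hp ge0_XM); first exact: ge0_lin.
  by move=> x y hx hy; apply: yangian_ge0_inM hx hy _ => b c -> ->; rewrite addr0.
by move=> x y hx hy; apply: yangian_ge0_inM hy hx _ => b c -> ->; rewrite add0r.
Qed.

Lemma ge0_HH : yangian_ge0_in (@Qnneg I) (phi (th D i 1)).
Proof.
have hxi n : yangian_ge0_in (@Qnneg I) (yxi D i n).
  apply: (ge0_gen (c := inl (i, n))); first exact: yge0_xi.
  by move=> k; rewrite ffunE.
rewrite phi_th1; apply: linpD; first exact: ge0_lin.
  apply: linpB; [exact: ge0_lin|exact: lspanZ (hxi 1%N)|].
  by rewrite expr2; apply: yangian_ge0_inM (hxi 0%N) (hxi 0%N) _; apply: QnnegD.
rewrite big_seq; apply: lspan_sum => b bP; apply: lspanZ; rewrite expr2.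
by apply: yangian_ge0_in_sub (ge0_E2 bP) => c; apply: Qplus_nneg.
Qed.

(** The lowering generators in Z enter the source only through brackets with squares of root
    vectors, where [ge0_E2m] applies. The other brackets stay in the nonnegative subalgebra and add
    a degree in Q_+ to alpha_i. *)
Lemma claim_b : cf N ((gen bY - alt (yx D true i) 0 - Xs (yxi D i) (yx D false i))).
Proof.
have lN : lin N by exact: ge0_lin.
apply: (@graded_err _ _ _ char0 D iota iota_incl i Y idfun 0 (fun=> 0) bY (fun=> 0))
  => //=.
- by move=> y; rewrite mul0r mulr0.
- by move=> k y; rewrite mul0r mulr0.
- by move=> k; rewrite cbr0l scaler0.
- by move=> n; rewrite cbr0l.
- by rewrite phi_tb0 add0r.
- by move=> n; rewrite -phi_th1_tb; congr cbr; rewrite -yangian_HH.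
- have -> : \sum_(b <- rem alphai (pos_roots D)) ipQ D b alphai *:
      (E b * E b + 2 *: (0 * E b)) =
      \sum_(b <- rem alphai (pos_roots D)) ipQ D b alphai *: (E b * E b).
    by apply: eq_bigr => b _; rewrite mul0r scaler0 addr0.
  set Th := (4 * d)^-1 *: _; apply: cfD => //.
    move=> [|n]; rewrite scst_ser_cbr /=; first by rewrite cbr0r; apply: lspan0.
    have -> : cbr Th ((-1) ^+ n.+1 *: yx D true i n) =
        (-1) ^+ n.+1 *: cbr Th (yx D true i n) by nca K (@nil Y); ring.
    apply: lspanZ.
    have -> : cbr Th (yx D true i n) = (4 * d)^-1 *:
      \sum_(b <- rem alphai (pos_roots D)) ipQ D b alphai *:
         cbr (E b * E b) (yx D true i n).
      rewrite /Th; set s := \sum_(b <- _) _; set s' := \sum_(b <- _) _.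
      suff -> : s' = cbr s (yx D true i n) by nca K (@nil Y); ring.
      rewrite /cbr /s mulr_suml mulr_sumr -sumrB; apply: eq_bigr => b _.
      by nca K (@nil Y); ring.
    apply: lspanZ; rewrite big_seq; apply: lspan_sum => b bR; apply: lspanZ.
    apply: ge0_E2m; first exact: mem_rem bR.
    by apply: contraTneq bR => ->; rewrite mem_rem_uniqF // pos_roots_uniq.
  have hT : yangian_ge0_in (@Qplus I) (2^-1 *: (yx D false i 0 * yx D false i 0) + Th).
    apply: lspanD; apply: lspanZ.
      rewrite -(iota_chev iota_incl) -rvec_simple; apply: ge0_E2.
      by apply: alphai_root.
    rewrite big_seq; apply: lspan_sum => b bR; apply: lspanZ; apply: ge0_E2.
    exact: mem_rem bR.
  move=> n; rewrite scst_ser_cbr; apply: ge0_cbr hT (ge0_Xs n) _ => b c bQ ->.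
  by exists b => //; rewrite addrC.
move=> x Nx; rewrite yangian_HH; apply: ge0_cbr ge0_HH Nx _ => b c b0 [c' c'Q ->].
by exists (b + c'); [apply: QplusDr|rewrite addrCA].
Qed.


(** * The coproducts of h_i(u) and b_i(u) *)

Let Delta2 : Y -> YY := Delta.
Let Delta_linear : linear Delta2. Proof. by case: Delta_cop. Qed.
Let Delta_mon : monoid_morphism Delta2. Proof. by case: Delta_cop. Qed.
Let DeltaM : {lrmorphism Y -> YY} := lrmorph_of Delta_linear Delta_mon.

Let G (S : rootLattice I -> Prop) : YY -> Prop := im_tens phi (yangian_in S).
Let LL : YY := tensl (phi (th D i 1)).
Let aa k : YY := tensl (bY k).
Let ww b : YY := tensl (E b - F b).
Let bb n : YY := Delta (bY n).

Lemma G_lin S : lin (G S). Proof. exact: lin_lspan. Qed.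

Lemma G_mul (S S' S'' : rootLattice I -> Prop) x y : G S x -> G S' y ->
  (forall b c, S b -> S' c -> S'' (b + c)) -> G S'' (x * y).
Proof.
move=> hx hy SS; elim: hx => [|c u v [p [q [qS ->]]] _ IH].
  by rewrite mul0r; apply: lspan0.
rewrite mulrDl; apply: lspanD => //; rewrite -scalerAl; apply: lspanZ.
elim: hy => [|c' u' v' [p' [q' [qS' ->]]] _ IH'].
  by rewrite mulr0; apply: lspan0.
rewrite mulrDr; apply: lspanD => //; rewrite -scalerAr; apply: lspanZ.
rewrite tensM -phiM; apply: lspan_gen; exists (p * p'), (q * q'); split=> //.
exact: yangian_inM qS qS' SS.
Qed.

Lemma G_sub (S S' : rootLattice I -> Prop) x :
  (forall b, S b -> S' b) -> G S x -> G S' x.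
Proof.
move=> SS; apply: lspan_mono => y [p [q [qS ->]]]; apply: lspan_gen.
by exists p, q; split=> //; apply: yangian_in_sub qS.
Qed.

Lemma G_tens S p q : yangian_in S q -> G S (tens (phi p) q).
Proof. by move=> qS; apply: lspan_gen; exists p, q. Qed.

Lemma G_tensr S y : yangian_in S y -> G S (tensr y).
Proof. by move=> yS; rewrite /tensr -phi1; apply: G_tens. Qed.

Lemma G_tensl p : G (fun b => b = 0) (tensl (phi p)).
Proof. by apply: G_tens; apply: yangian_in_homog (yhomog1 D) _. Qed.

(** By [rvec_omega] the difference is the orbit sum of the root vector, and the elements that [iota]
    sends into the image of [phi] form a Lie subalgebra to which [omega_orbit] applies. *)
Lemma orbit_in_image b : b \in pos_roots D -> exists p, phi p = E b - F b.
Proof.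
move=> bP; have e : F b = - iota (omega D (rvec D false b)).
  rewrite (rvec_omega false bP) /=.
  by rewrite -[- rvec D true b]scaleN1r (linZ _ _ (iota_linear iota_incl)) scaleN1r opprK.
rewrite e opprK -(linD _ _ (iota_linear iota_incl)).
have bw := rvec_words char0 (chev_comm_of_inclusion iota_incl) bP.
apply: (@omega_orbit _ _ _ D (chev_comm_of_inclusion iota_incl)
  (fun x => exists p, phi p = iota x) _ _ _ _ b _ bw).
- by exists 0; rewrite (lin0 phi_linear) (lin0 (iota_linear iota_incl)).
- move=> c x y [px ex] [py ey]; exists (c *: px + py).
  by rewrite phi_linear ex ey (iota_linear iota_incl).
- move=> x y [px ex] [py ey]; exists (cbr px py).
  by rewrite phi_cbr ex ey (iota_br iota_incl).
move=> j; exists (tb D j 0); have [_ _ _ [-> _] _] := phi_emb.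
rewrite -[- iota _]scaleN1r -(linZ _ _ (iota_linear iota_incl)).
by rewrite -(linD _ _ (iota_linear iota_incl)) scaleN1r.
Qed.

Lemma Delta_iota x : DeltaM (iota x) = tensl (iota x) + tensr (iota x).
Proof. by have [_ _ h _] := Delta_cop; apply: h. Qed.

(** The terms x_b^- (x) x_b^+ from the coproduct of xi_{i,1} turn the cross terms of the squares
    into (x_b^+ - x_b^-) (x) x_b^+, whose left factor lies in the coideal. *)
Lemma Delta_HH : LL + Hp (fun n => tensr (yxi D i n))
    + \sum_(b <- pos_roots D) ipQ D b alphai *:
        (tensr (E b) * tensr (E b) + 2 *: (ww b * tensr (E b)))
  = DeltaM (phi (th D i 1)).
Proof.
have D1 : DeltaM (yxi D i 1) = tensl (yxi D i 1) + tensr (yxi D i 1)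
    + tensl (yxi D i 0) * tensr (yxi D i 0)
    - \sum_(b <- pos_roots D) ipQ D b alphai *: (tensl (F b) * tensr (E b)).
  have [_ _ _ h] := Delta_cop; rewrite -[LHS]/(Delta _) h.
  congr (_ + _ - _); first by rewrite -tensE2.
  by apply: eq_bigr => b _; rewrite -tensE2.
have D0 : DeltaM (yxi D i 0) = tensl (yxi D i 0) + tensr (yxi D i 0).
  by have [_ _ _ [h _]] := iota_incl; rewrite -h Delta_iota.
rewrite phi_th1 (lrmorph_quadratic DeltaM) D1 D0.
rewrite /LL phi_th1 (lrmorph_quadratic (@tensl K g I D)).
rewrite (coproduct_quadratic _ _ _ _ (\sum_(b <- pos_roots D) ipQ D b alphai *:
  (tensl (F b) * tensr (E b))) (tensl_r (yxi D i 0) (yxi D i 0))).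
congr (_ + _); rewrite scaler_sumr -!big_split; apply: eq_bigr => b _.
rewrite Delta_iota /ww (lrmorphB (@tensl K g I D)).
by rewrite (coproduct_square _ (tensl_r (E b) (E b)) (tensl_r (F b) (E b))).
Qed.

Lemma LL_aa k : cbr LL (aa k) = (4 * d) *: aa k.+1.
Proof.
rewrite /LL /aa -[tensl _ in RHS]/(tensl (bY k.+1)) -(lrmorphZ (@tensl K g I D)) -phi_th1_tb.
by rewrite (lrmorph_cbr (@tensl K g I D)).
Qed.

Lemma FU_aa n : FU d aa n = tensl (phi (h_series D i n)).
Proof.
rewrite (h_seriesE (char0 1)) -(FU_morph phi_linear phi_mon).
exact: (FU_lrmorph (@tensl K g I D)).
Qed.

Lemma FU_bb n : FU d bb n = Delta (phi (h_series D i n)).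
Proof.
rewrite (h_seriesE (char0 1)) -(FU_morph phi_linear phi_mon).
exact: (FU_lrmorph DeltaM).
Qed.

Lemma LL_HL n : cbr LL (HL d aa n) = 0.
Proof.
rewrite -[HL d aa n]/(FU d aa n) FU_aa.
have -> : cbr LL (tensl (phi (h_series D i n))) =
    tensl (phi (cbr (th D i 1) (h_series D i n))).
  by rewrite phi_cbr (lrmorph_cbr (@tensl K g I D)).
suff -> : cbr (th D i 1) (h_series D i n) = 0 by rewrite (lin0 phi_linear) rmorph0.
(* Coefficient n+1 is h_{i,n}, and coefficient 0 is h_{i,-1} = 1. *)
case: n => [|n]; last by rewrite /h_series -addn1 PoszD addrK; apply: th_th.
by rewrite /h_series sub0r (th_neg1 D i) /cbr mulr1 mul1r subrr.
Qed.

Lemma bb_0 : bb 0 = aa 0 + tensr (yx D false i 0) - tensr (yx D true i 0).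
Proof.
rewrite /bb /aa phi_tb0 -[Delta _]/(DeltaM _) (lrmorphB DeltaM) (lrmorphB (@tensl K g I D)).
rewrite -!(iota_chev iota_incl) !Delta_iota.
by rewrite opprD addrACA addrA.
Qed.

Lemma HH_bb n : cbr (LL + Hp (fun n => tensr (yxi D i n))
    + \sum_(b <- pos_roots D) ipQ D b alphai *:
        (tensr (E b) * tensr (E b) + 2 *: (ww b * tensr (E b)))) (bb n)
  = (4 * d) *: bb n.+1.
Proof.
rewrite Delta_HH /bb -[Delta (bY n)]/(DeltaM (bY n)) -[Delta (bY n.+1)]/(DeltaM (bY n.+1)).
by rewrite -(lrmorphZ DeltaM) -phi_th1_tb (lrmorph_cbr DeltaM).
Qed.

Lemma ww_alphai : ww alphai = aa 0.
Proof. by rewrite /ww /aa phi_tb0 !rvec_simple !(iota_chev iota_incl). Qed.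

Lemma G_ww b : b \in pos_roots D -> G (fun b => b = 0) (ww b).
Proof. by move=> bP; have [p e] := orbit_in_image bP; rewrite /ww -e; apply: G_tensl. Qed.

Lemma claim_Delta_h : cf (G (@Qplus I)) (FU d bb - HL d aa *
  (XI (fun n => tensr (yxi D i n)) * XM (fun n => tensr (yxi D i n)))).
Proof.
apply: (@graded_FU _ _ _ char0 D iota iota_incl i YY (@tensr K g I D) G G_lin
  G_mul G_sub G_tensr LL aa bb ww) => //.
- by move=> y; apply: tensl_r.
- by move=> k y; apply: tensl_r.
- by move=> b y; apply: tensl_r.
- exact: G_tensl.
- by move=> k; apply: G_tensl.
- exact: G_ww.
- exact: LL_aa.
- exact: LL_HL.
- exact: ww_alphai.
- exact: bb_0.
- exact: HH_bb.
Qed.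

Lemma claim_Delta_b : cf (G (@Qplus I)) (gen bb - alt (fun n => tensr (yx D true i n)) 0
  - gen aa * XM (fun n => tensr (yxi D i n))).
Proof.
apply: (@graded_BU _ _ _ char0 D iota iota_incl i YY (@tensr K g I D) G G_lin
  G_mul G_sub G_tensr LL aa bb ww) => //.
- by move=> y; apply: tensl_r.
- by move=> k y; apply: tensl_r.
- by move=> b y; apply: tensl_r.
- exact: G_tensl.
- by move=> k; apply: G_tensl.
- exact: G_ww.
- exact: LL_aa.
- exact: LL_HL.
- exact: ww_alphai.
- exact: bb_0.
- exact: HH_bb.
Qed.


(** * Translation into the series of the statement *)

Lemma x_seriesE s : x_series D s i = gen (yx D s i).
Proof. by apply/funext => -[|n]. Qed.

Lemma altE_series (T : algType K) (q : nat -> T) n :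
  alt q 0 n = series_opp (gen q) n.
Proof. by case: n => [|n] //; rewrite /series_opp scaler0. Qed.

Lemma rho_alt (q : nat -> Y) n : alt (fun k => tensr (q k)) 0 n = tensr (alt q 0 n) :> YY.
Proof.
by case: n => [|n] /=; rewrite ?(lrmorphZ (@tensr K g I D)) // (rmorph0 (@tensr K g I D)).
Qed.

Lemma tensr_XI n : XI (fun k => tensr (yxi D i k)) n = tensr (XI (yxi D i) n) :> YY.
Proof. by case: n => [|n]. Qed.

Lemma tensr_XM n : XM (fun k => tensr (yxi D i k)) n = tensr (XM (yxi D i) n) :> YY.
Proof. by rewrite /XM /series_opp tensr_XI (lrmorphZ (@tensr K g I D)). Qed.

Lemma tensr_XIXM n :
  (XI (fun k => tensr (yxi D i k)) * XM (fun k => tensr (yxi D i k)) : ser YY) n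
  = tensr ((XI (yxi D i) * XM (yxi D i) : ser Y) n) :> YY.
Proof.
rewrite !serM (rmorph_sum (@tensr K g I D)); apply: eq_bigr => k _.
by rewrite tensr_XI tensr_XM (rmorphM (@tensr K g I D)).
Qed.

Lemma phi_b_series n : phi (b_series D i n) = gen bY n.
Proof. by case: n => [|n] //=; rewrite (lin0 phi_linear). Qed.

Lemma Delta_b_series n : Delta (phi (b_series D i n)) = gen bb n.
Proof. by case: n => [|n] //=; rewrite (lin0 phi_linear); exact: (lin0 Delta_linear). Qed.

(** The graded computation yields 1 (x) Z(u), whereas the last congruence has 1 (x) b_i(u); the
    congruence for b_i(u) itself shows that they agree modulo Q_+. *)
Lemma gen_bY_mod n : yangian_in (@Qplus I) (gen bY n - alt (yx D true i) 0 n).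
Proof.
have -> : gen bY n - alt (yx D true i) 0 n =
   (gen bY - alt (yx D true i) 0 - Xs (yxi D i) (yx D false i)) n
   + Xs (yxi D i) (yx D false i) n by rewrite !serB subrK.
apply: lspanD; apply: yangian_ge0_in_in.
  apply: yangian_ge0_in_sub (claim_b n) => b [c cQ ->].
  by apply: QplusDl; [apply: simple_root_Qplus|apply: Qplus_nneg].
by apply: yangian_ge0_in_sub (ge0_Xs n) => b ->; apply: simple_root_Qplus.
Qed.

Theorem drinfeld_series_estimates :
  [/\ series_eqmod (yangian_in (@Qplus I))
        (fun n => phi (h_series D i n))
        (series_mul (xi_series D i) (series_opp (xi_series D i))),
      series_eqmod (yangian_ge0_in (shift_Qplus i))
        (fun n => phi (b_series D i n))
        (fun n =>
           2^-1 *: series_abr (x_series D false i)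
                     (series_opp (xi_series D i)) n
           + series_opp (x_series D true i) n),
      series_eqmod (im_tens phi (yangian_in (@Qplus I)))
        (fun n => Delta (phi (h_series D i n)))
        (series_tens (fun n => phi (h_series D i n))
           (series_mul (xi_series D i) (series_opp (xi_series D i))))
    & series_eqmod (im_tens phi (yangian_in (@Qplus I)))
        (fun n => Delta (phi (b_series D i n)))
        (fun n =>
           series_tens (fun m => phi (b_series D i m))
             (series_opp (xi_series D i)) n
           + tens 1 (phi (b_series D i n)))].
Proof.
split=> n.
- exact: claim_h.
- rewrite phi_b_series !x_seriesE -altE_series.
  by have := claim_b n; rewrite !serB -addrA -opprD [alt _ _ _ + _]addrC.
- have := claim_Delta_h n; rewrite serB FU_bb serM.
  suff -> : \sum_(k < n.+1) HL d aa k *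
      ((XI (fun k => tensr (yxi D i k)) * XM (fun k => tensr (yxi D i k)) : ser YY)
        (n - k)%N) =
    series_tens (fun n => phi (h_series D i n))
      (series_mul (xi_series D i) (series_opp (xi_series D i))) n by [].
  apply: eq_bigr => k _; rewrite -[HL d aa k]/(FU d aa k) FU_aa tensr_XIXM.
  by rewrite -tensE2.
rewrite Delta_b_series phi_b_series.
have bM : G (@Qplus I) (tensr (gen bY n - alt (yx D true i) 0 n)).
  exact/G_tensr/gen_bY_mod.
have := linpB (G_lin _) (claim_Delta_b n) bM.
rewrite !serB rho_alt (lrmorphB (@tensr K g I D)).
have -> : (gen aa * XM (fun k => tensr (yxi D i k)) : ser YY) n =
    series_tens (fun m => phi (b_series D i m)) (series_opp (xi_series D i)) n.
  rewrite serM; apply: eq_bigr => k _; rewrite tensr_XM phi_b_series.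
  have -> : gen aa k = tensl (gen bY k).
    by case: (k : nat) => [|k'] //=; rewrite (rmorph0 (@tensl K g I D)).
  by rewrite -tensE2.
set u := series_tens _ _ n; set v := alt _ _ _.
suff -> : gen bb n - tensr v - u - (tensr (gen bY n) - tensr v) =
    gen bb n - (u + tens 1 (gen bY n)) by [].
rewrite opprB opprD -[tens 1 (gen bY n)]/(tensr (gen bY n)).
have zmodE (p q r x : YY) : p - q - r + (q - x) = p + (- r - x).
  by rewrite [p - q - r]addrAC addrA subrK addrA.
exact: zmodE.
Qed.

End Claims.

Local Open Scope complex_scope.

Theorem theorem5p1 (R : realType) (g : lieAlgebra R[i]) (I : finType)
    (D : chevalleyData g I)
    (iota : g -> yangian D)
    (Delta : yangian D -> tensor (yangian D) (yangian D))
    (phi : twisted_yangian D -> yangian D) :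
  lie_simple g -> ~ typeG2 D ->
  is_g_inclusion iota ->
  is_coproduct iota Delta ->
  is_coideal_embedding iota Delta phi ->
  forall i : I,
  [/\ series_eqmod (yangian_in (@Qplus I))
        (fun n => phi (h_series D i n))
        (series_mul (xi_series D i) (series_opp (xi_series D i))),
      series_eqmod (yangian_ge0_in (shift_Qplus i))
        (fun n => phi (b_series D i n))
        (fun n =>
           2^-1 *: series_abr (x_series D false i)
                     (series_opp (xi_series D i)) n
           + series_opp (x_series D true i) n),
      series_eqmod (im_tens phi (yangian_in (@Qplus I)))
        (fun n => Delta (phi (h_series D i n)))
        (series_tens (fun n => phi (h_series D i n))
           (series_mul (xi_series D i) (series_opp (xi_series D i))))
    & series_eqmod (im_tens phi (yangian_in (@Qplus I)))
        (fun n => Delta (phi (b_series D i n)))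
        (fun n =>
           series_tens (fun m => phi (b_series D i m))
             (series_opp (xi_series D i)) n
           + tens 1 (phi (b_series D i n)))].
Proof.
move=> _ _ iota_incl Delta_cop phi_emb i.
apply: drinfeld_series_estimates iota_incl Delta_cop phi_emb i => n.
by rewrite pnatr_eq0.
Qed.
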